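(* Let $1\le k\le d$ be integers and let $M\subset\mathbb P^d_{\mathbb R}$ be a nondegenerate submanifold of dimension $k$. Then the Hausdorff dimension of $\mathrm{BA}_M(\psi_{c(k,d)})$ equals $k$.
   Context: $\mathbb P^d_{\mathbb R}$ is real projective space, $\pi:\mathbb R^{d+1}\setminus\{0\}\to\mathbb P^d_{\mathbb R}$, $\pi(\mathbf x)=[\mathbf x]$, and $\mathbb P^d_{\mathbb Q}=\{[\mathbf p]:\mathbf p\in\mathbb Q^{d+1}\setminus\{0\}\}$. Fix a Riemannian metric $\mathrm{dist}$ on $\mathbb P^d_{\mathbb R}$. $\|\cdot\|$ is the max norm. The standard height of $[\mathbf p]\in\mathbb P^d_{\mathbb Q}$ is $H_{\mathrm{std}}([\mathbf p])=\|\mathbf p\|$ where $\mathbf p$ is a primitive integer representative. For $c\ge0$, $\psi_c(q)=q^{-c}$. Submanifolds are $C^\infty$, embedded, not necessarily closed or connected. For a submanifold $M$ and $\psi:(0,\infty)\to(0,\infty)$, $\mathrm{BA}_M(\psi)$ is the set of $[\mathbf x]\in M$ for which there is $\varepsilon>0$ with $\mathrm{dist}([\mathbf r],[\mathbf x])\ge\varepsilon\,\psi(H_{\mathrm{std}}([\mathbf r]))$ for all $[\mathbf r]\in\mathbb P^d_{\mathbb Q}\cap M$. Nondegeneracy: a coordinate lift of a $k$-dimensional submanifold $M$ is a smooth map $\Phi:U\to\mathbb R^{d+1}\setminus\{0\}$, $U\subset\mathbb R^k$ open, such that $\pi\circ\Phi$ is a local parameterization of $M$. For $[\mathbf x]\in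 M$ and $j\ge0$, $T^{(j)}_{[\mathbf x]}(M)=\mathrm{span}\{\partial^\alpha\Phi(\mathbf v):\alpha\in\mathbb N^k,|\alpha|\le j\}$, where $\Phi$ is a coordinate lift with $\pi\circ\Phi(\mathbf v)=[\mathbf x]$ (multi-index notation). $[\mathbf x]$ is $D$-nondegenerate if $T^{(D)}_{[\mathbf x]}(M)=\mathbb R^{d+1}$, nondegenerate if it is $D$-nondegenerate for some $D$, and $M$ is nondegenerate if some point of $M$ is nondegenerate. The exponent: for integers $n,m\ge0$ let $[n,m]=\binom{n+m}{m}$. For $1\le k\le d$ let $n_{k,d}$ be the largest positive integer $n$ such that $d=k+\sum_{j=2}^{n}[k-1,j]+m$ for some integer $m\ge0$ (empty sum if $n=1$), let $m_{k,d}$ be that $m$, let $N_{k,d}=k+\sum_{j=2}^{n_{k,d}}j\,[k-1,j]+(n_{k,d}+1)m_{k,d}$, and $c(k,d)=(d+1)/N_{k,d}$. *)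

(* Defs.v *)
From HB Require Import structures.
From mathcomp Require Import all_boot all_order all_algebra.
From mathcomp Require Import all_classical all_reals all_analysis.
Import Order.TTheory GRing.Theory Num.Theory numFieldNormedType.Exports.

Set Implicit Arguments.
Unset Strict Implicit.
Unset Printing Implicit Defensive.

Local Open Scope classical_set_scope.
Local Open Scope ring_scope.

Definition bracket (n m : nat) : nat := 'C(n + m, m).

Definition osc_dim (k n : nat) : nat :=
  (k + \sum_(2 <= j < n.+1) bracket k.-1 j)%N.

(* Every bracket is positive, so for 1 <= k a number n with osc_dim k n <= d is
   at most d: the bound n < d.+1 loses nothing, see n_kd_max. *)
Definition n_kd (k d : nat) : nat :=
  \max_(n < d.+1 | (0 < n)%N && (osc_dim k n <= d)%N) n.

Definition m_kd (k d : nat) : nat := (d - osc_dim k (n_kd k d))%N.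

Definition N_kd (k d : nat) : nat :=
  (k + \sum_(2 <= j < (n_kd k d).+1) j * bracket k.-1 j
     + (n_kd k d).+1 * m_kd k d)%N.

Definition c_kd (R : realType) (k d : nat) : R := d.+1%:R / (N_kd k d)%:R.

Lemma leq_osc_dim (k n : nat) : (0 < k)%N -> (n <= osc_dim k n)%N.
Proof.
move=> k0; elim: n => // -[_|n IH].
  by rewrite /osc_dim big_geq// addn0.
rewrite /osc_dim big_nat_recr//= addnA -[X in (X <= _)%N]addn1.
by apply: leq_add IH _; rewrite bin_gt0 leq_addl.
Qed.

Lemma n_kd_spec (k d : nat) : (0 < k <= d)%N ->
  (0 < n_kd k d)%N /\ d = (osc_dim k (n_kd k d) + m_kd k d)%N.
Proof.
move=> /andP[k0 kd].
have d1 : (1 < d.+1)%N by rewrite ltnS (leq_trans k0 kd).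
have P1 : (0 < Ordinal d1)%N && (osc_dim k (Ordinal d1) <= d)%N.
  by rewrite /= /osc_dim big_geq// addn0.
pose P := fun n : 'I_d.+1 => (0 < n)%N && (osc_dim k n <= d)%N.
have P0 : (0 < #|P|)%N by apply/card_gt0P; exists (Ordinal d1).
have [i /andP[i0 id] E] := eq_bigmax_cond (fun n : 'I_d.+1 => nat_of_ord n) P0.
by rewrite /m_kd /n_kd E subnKC.
Qed.

Lemma n_kd_max (k d n m : nat) : (0 < k <= d)%N ->
  (0 < n)%N -> d = (osc_dim k n + m)%N -> (n <= n_kd k d)%N.
Proof.
move=> /andP[k0 kd] n0 dE.
have le_od : (osc_dim k n <= d)%N by rewrite dE leq_addr.
have nd : (n < d.+1)%N by rewrite ltnS (leq_trans (leq_osc_dim n k0)).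
by apply: (@leq_bigmax_cond _ _ _ (Ordinal nd)); rewrite /= n0.
Qed.

Definition nzvec (R : realType) (d : nat) : Type :=
  initial_topology (fun x : {x : 'rV[R]_d.+1 | x != 0} => sval x).

HB.instance Definition _ (R : realType) (d : nat) :=
  Topological.on (nzvec R d).

Definition vec (R : realType) (d : nat) (x : nzvec R d) : 'rV[R]_d.+1 := sval x.

Definition proportional (R : realType) (d : nat) (x y : nzvec R d) : bool :=
  `[< exists2 a : R, a != 0 & vec y = a *: vec x >].

Lemma proportional_equiv (R : realType) (d : nat) :
  equiv_class_of (@proportional R d).
Proof.
split=> [x|x y|y x z].
- by apply/asboolP; exists 1; rewrite ?oner_eq0 ?scale1r.
- apply/asboolP/asboolP => -[a a0 e]; exists a^-1; rewrite ?invr_eq0//.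
  + by rewrite e scalerA mulVf// scale1r.
  + by rewrite e scalerA mulVf// scale1r.
- move=> /asboolP[a a0 e] /asboolP[b b0 f].
  apply/asboolP; exists (b * a); first by rewrite mulf_neq0.
  by rewrite f e scalerA.
Qed.

Canonical proportional_equivRel (R : realType) (d : nat) :=
  EquivRelPack (@proportional_equiv R d).

Definition RP (R : realType) (d : nat) : Type :=
  quotient_topology {eq_quot (@proportional R d)}%qT.

HB.instance Definition _ (R : realType) (d : nat) := Topological.on (RP R d).

Definition class_pt (R : realType) (d : nat) (x : nzvec R d) : RP R d :=
  (\pi_({eq_quot (@proportional R d)}%qT) x)%qT.

Lemma class_pt_eq (R : realType) (d : nat) (x y : nzvec R d) :
  class_pt x = class_pt y <-> exists2 a : R, a != 0 & vec y = a *: vec x.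
Proof.
split; first by move/eqquotP => /asboolP.
by move=> h; apply/eqquotP/asboolP.
Qed.

Lemma RP_openE (R : realType) (d : nat) (W : set (RP R d)) :
  open W <-> open (@vec R d @` (@class_pt R d @^-1` W)).
Proof.
have -> : open W = open (@class_pt R d @^-1` W) by [].
split=> [[A oA AE]|oV]; last first.
  exists (@vec R d @` (@class_pt R d @^-1` W)) => //.
  rewrite predeqE => x; split=> [[y Wy /val_inj <-//]|Wx].
  by exists x.
rewrite -AE.
rewrite (_ : _ @` _ = A `&` ~` [set 0]).
  apply: openI => //; rewrite openC.
  exact: accessible_closed_set1 (hausdorff_accessible (@norm_hausdorff _ _)) 0.
rewrite predeqE => v; split=> [[x Ax <-]|[Av /eqP v0]].
  by split=> //=; apply/eqP; exact: (svalP x).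
by exists (exist _ v v0).
Qed.

Definition represents (R : realType) (d : nat) (v : 'rV[R]_d.+1)
    (p : RP R d) : Prop :=
  exists2 x : nzvec R d, vec x = v & class_pt x = p.

Definition rational_points (R : realType) (d : nat) : set (RP R d) :=
  [set p | exists q : 'rV[rat]_d.+1, represents (map_mx ratr q) p].

Definition primitive (d : nat) (p : 'rV[int]_d.+1) : Prop :=
  \big[gcdn/0%N]_(i < d.+1) `|p ord0 i|%N = 1%N.

(* The norm of 'rV[R]_n is the max norm.  The value is 0 (junk) outside
   rational_points. *)
Definition std_height (R : realType) (d : nat) (r : RP R d) : R :=
  xget 0 [set h | exists p : 'rV[int]_d.+1,
    [/\ primitive p, represents (map_mx intr p) r
      & h = `|map_mx intr p : 'rV[R]_d.+1| ]].

Definition ebasis (R : realType) (n : nat) (i : 'I_n) : 'rV[R]_n :=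
  delta_mx ord0 i.

Definition partials (R : realType) (n : nat) (V : normedModType R)
    (s : seq 'I_n) (f : 'rV[R]_n -> V) : 'rV[R]_n -> V :=
  foldr (fun i h => fun v => 'D_(ebasis R i) h v) f s.

Definition smooth_on (R : realType) (n : nat) (V : normedModType R)
    (U : set 'rV[R]_n) (f : 'rV[R]_n -> V) : Prop :=
  forall (s : seq 'I_n) (v : 'rV[R]_n), U v ->
    {for v, continuous (partials s f)} /\
    forall i, derivable (partials s f) v (ebasis R i).

Definition partial_mi (R : realType) (n : nat) (V : normedModType R)
    (al : 'I_n -> nat) (f : 'rV[R]_n -> V) : 'rV[R]_n -> V :=
  partials (flatten [seq nseq (al i) i | i <- enum 'I_n]) f.

(* A Riemannian metric on P^d, given by its pullback under x |-> [x]: a smooth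
   field of symmetric bilinear forms (v, w) |-> v *m G x *m w^T on the nonzero
   vectors.  The tangent space of P^d at [x] is the quotient of R^(d+1) by the
   line R x (the kernel of the differential of x |-> [x]), where v at x and
   a *: v at a *: x are the same tangent vector.  Hence the pullbacks are
   exactly the fields below: rm_hom and rm_vert say that G descends to P^d,
   rm_pos that the form on the quotient by R x is positive definite. *)
Record riemannian_metric (R : realType) (d : nat) := RiemannianMetric {
  rm_form : 'rV[R]_d.+1 -> 'M[R]_d.+1;
  rm_smooth : smooth_on [set x | x != 0] rm_form;
  rm_sym : forall x, x != 0 -> (rm_form x)^T = rm_form x;
  rm_hom : forall (a : R) x, a != 0 -> x != 0 ->
    a ^+ 2 *: rm_form (a *: x) = rm_form x;
  rm_vert : forall x, x != 0 -> x *m rm_form x = 0;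
  rm_pos : forall x v, x != 0 -> v \notin <[x]>%VS ->
    0 < (v *m rm_form x *m v^T) ord0 ord0
}.

(* Curves in P^d are represented by lifts to R^(d+1) \ {0}; every piecewise
   C^1 curve in P^d has a piecewise C^1 lift. *)
Definition piecewise_C1 (R : realType) (d : nat) (gam : R -> nzvec R d) : Prop :=
  exists (n : nat) (t : nat -> R),
    [/\ t 0%N = 0, t n = 1,
        forall i, (i < n)%N -> t i < t i.+1
      & forall i, (i < n)%N -> exists c : R -> 'rV[R]_d.+1,
          [/\ forall s, derivable c s 1, continuous (derive1 c)
            & forall s, t i <= s <= t i.+1 -> vec (gam s) = c s] ].

Definition curve_length (R : realType) (d : nat) (g : riemannian_metric R d)
    (gam : R -> nzvec R d) : R :=
  let gam' := derive1 (fun s => vec (gam s)) in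
  (\int[lebesgue_measure]_(s in `[0%R, 1%R])
     Num.sqrt ((gam' s *m rm_form g (vec (gam s)) *m (gam' s)^T) ord0 ord0))%R.

Definition riem_dist (R : realType) (d : nat) (g : riemannian_metric R d)
    (p q : RP R d) : R :=
  inf [set l | exists gam : R -> nzvec R d,
    [/\ piecewise_C1 gam, class_pt (gam 0) = p, class_pt (gam 1) = q
      & l = curve_length g gam] ].

(* U is open and v |-> [Phi v] is a local parameterization of M on U: a smooth
   immersion (the kernel of the differential of x |-> [x] at Phi v is the line
   spanned by Phi v) which is a homeomorphism onto an open subset of M. Only
   the values of Phi on U matter. *)
Definition coordinate_lift (R : realType) (k d : nat) (M : set (RP R d))
    (U : set 'rV[R]_k) (Phi : 'rV[R]_k -> nzvec R d) : Prop :=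
  [/\ open U,
      smooth_on U (@vec R d \o Phi),
      forall v w, U v -> 'D_w (@vec R d \o Phi) v \in <[vec (Phi v)]>%VS -> w = 0,
      {in U &, injective (fun v => class_pt (Phi v))}
    & forall V : set 'rV[R]_k, open V -> V `<=` U ->
        exists2 W : set (RP R d), open W
          & (fun v => class_pt (Phi v)) @` V = M `&` W ].

Definition submanifold (R : realType) (k d : nat) (M : set (RP R d)) : Prop :=
  forall x, M x -> exists (U : set 'rV[R]_k) (Phi : 'rV[R]_k -> nzvec R d) v,
    [/\ coordinate_lift M U Phi, U v & class_pt (Phi v) = x].

Definition osculating_space (R : realType) (k d : nat)
    (Phi : 'rV[R]_k -> nzvec R d) (j : nat) (v : 'rV[R]_k) :
    {vspace 'rV[R]_d.+1} :=
  (\sum_(al : {ffun 'I_k -> 'I_j.+1} | (\sum_i al i <= j)%N)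
     <[ partial_mi (fun i => al i) (@vec R d \o Phi) v ]>)%VS.

Definition nondegenerate_at (R : realType) (k d : nat) (M : set (RP R d))
    (D : nat) (x : RP R d) : Prop :=
  exists (U : set 'rV[R]_k) (Phi : 'rV[R]_k -> nzvec R d) v,
    [/\ coordinate_lift M U Phi, U v, class_pt (Phi v) = x
      & osculating_space Phi D v = fullv].

Definition nondegenerate_submanifold (R : realType) (k d : nat)
    (M : set (RP R d)) : Prop :=
  exists2 x, M x & exists D, nondegenerate_at k M D x.

Definition psi_pow (R : realType) (c q : R) : R := q `^ (- c).

Definition BA (R : realType) (d : nat) (dist : RP R d -> RP R d -> R)
    (M : set (RP R d)) (f : R -> R) : set (RP R d) :=
  [set x | M x /\ exists2 eps : R, 0 < eps &
     forall r, rational_points r -> M r -> eps * f (std_height r) <= dist r x].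

Section hausdorff.
Local Open Scope ereal_scope.

Definition diam (R : realType) (T : Type) (dist : T -> T -> R) (U : set T) :
    \bar R :=
  ereal_sup [set z | exists x y, [/\ U x, U y & z = (dist x y)%:E] ].

(* diam set0 = -oo, and the 0-th power of a diameter is 1 *)
Definition hausdorff_gauge (R : realType) (T : Type) (dist : T -> T -> R)
    (s : R) (U : set T) : \bar R :=
  if `[< U = set0 >] then 0 else poweR (diam dist U) s.

Definition hausdorff_content (R : realType) (T : Type) (dist : T -> T -> R)
    (s delta : R) (A : set T) : \bar R :=
  ereal_inf [set z | exists U : nat -> set T,
    [/\ A `<=` \bigcup_i U i, forall i, diam dist (U i) <= delta%:E
      & z = \sum_(0 <= i <oo) hausdorff_gauge dist s (U i)] ].

Definition hausdorff_measure (R : realType) (T : Type) (dist : T -> T -> R)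
    (s : R) (A : set T) : \bar R :=
  ereal_sup [set hausdorff_content dist s delta A
            | delta in [set delta : R | (0 < delta)%R] ].

Definition hausdorff_dim (R : realType) (T : Type) (dist : T -> T -> R)
    (A : set T) : \bar R :=
  ereal_inf [set s%:E
            | s in [set s : R | (0 <= s)%R /\ hausdorff_measure dist s A = 0] ].

End hausdorff.

(* Main.v *)
(* Upper bound: M is a countable union of Lipschitz images of k-dimensional balls.

   Lower bound, in a chart Phi around a nondegenerate point: by Taylor expansion,
   the lifts of d+1 points in a cube of side rho have determinant O(rho^N_kd),
   because only [k-1, j] partial derivatives have order j.  Clearing denominators,
   the rational points in the cube of height at most a constant times
   rho^(-N_kd/(d+1)) lie on one hyperplane.  By nondegeneracy the linear form of
   this hyperplane, pulled back by Phi, is close to a nonzero polynomial of bounded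
   degree, whose zero set comes near at most half of the m^k subcubes of side rho/m
   once m is large.  Discarding these subcubes at every step leaves a tree with at
   least m^k/2 children per node whose branches converge to badly approximable
   points.  For s < k and m large, m^k/2 >= m^s, and a cover of small s-dimensional
   cost cannot meet every branch: walking down to a random child, the expected cost
   of the covering sets met stays below 1. *)
Require Import Defs.
From HB Require Import structures.
From mathcomp Require Import all_boot all_order all_algebra.
From mathcomp Require Import all_classical all_reals all_analysis.
From mathcomp Require Import measurable_realfun ring lra zify.
Import Order.TTheory GRing.Theory Num.Theory numFieldNormedType.Exports.

Set Implicit Arguments.
Unset Strict Implicit.
Unset Printing Implicit Defensive.

Local Open Scope classical_set_scope.
Local Open Scope ring_scope.

(** * Determinants and the exponent N_kd *)

(** Keeping half of the [m ^ k] subcubes costs about [log 2 / log m] in dimension, which tends to 0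
    as [m] grows. This dictates the order of the constants: [m] is fixed first, by an estimate
    uniform over all polynomials of degree bounds given by [D] with largest coefficient 1, and only
    then is the cube made so small that the Taylor remainder is negligible. How the hyperplanes of
    different cubes are related never enters. One hyperplane per cube is enough because each
    rational point is dealt with at a single level: for height [H] the side there is comparable to
    [H] to the power [-(d + 1) / N_kd], and staying away from the hyperplane by the side of the next
    level is the required inequality with exponent [c_kd]. The random walk stands in for a mass
    distribution on the limit set. The distance is an infimum over curves of projective space that
    may leave both [M] and the chart. Bounding it below in chart coordinates therefore goes through
    functions defined on all of projective space. *)

Lemma det_mul_expand (R : comRingType) (n : nat) (T : finType)
    (B : 'I_n -> T -> R) (D : T -> 'I_n -> R) :
  \det (\matrix_(i, j) \sum_c B i c * D c j) =
  \sum_(f : {ffun 'I_n -> T})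
     (\prod_i B i (f i)) * \det (\matrix_(i, j) D (f i) j).
Proof.
rewrite /determinant.
under eq_bigr => s _.
  under eq_bigr => i _ do rewrite mxE.
  rewrite bigA_distr_bigA big_distrr /=.
  over.
rewrite exchange_big; apply: eq_bigr => /= f _.
rewrite big_distrr; apply: eq_bigr => s _ /=.
rewrite big_split /= mulrCA; congr (_ * (_ * _)).
by apply: eq_bigr => i _; rewrite mxE.
Qed.

Lemma norm_det_le (R : numDomainType) (n : nat) (A : 'M[R]_n) (b : R) :
  (forall i j, `|A i j| <= b) -> `|\det A| <= n`!%:R * b ^+ n.
Proof.
move=> Ab; rewrite /determinant (le_trans (ler_norm_sum _ _ _))//.
rewrite -[n`! in leRHS]perm.card_Sn mulr_natl -sumr_const.
apply: ler_sum => s _; rewrite normrM normrX normrN1 expr1n mul1r normr_prod.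
rewrite -[X in _ ^+ X](card_ord n) -prodr_const.
by apply: ler_prod => i _; rewrite normr_ge0 Ab.
Qed.

(** A choice [f] that repeats an index gives a determinant with two equal rows, so only injective
    choices contribute to the expansion. Each of these carries [rho] to the sum of its degrees. *)
Lemma norm_det_sum_le (R : numFieldType) (n N : nat) (T : finType)
    (dg : T -> nat) (b : R) :
  (forall f : 'I_n -> T, injective f -> (N <= \sum_i dg (f i))%N) ->
  0 <= b ->
  exists2 C : R, 0 <= C & forall (B : 'I_n -> T -> R) (D : T -> 'I_n -> R) rho,
    0 <= rho <= 1 -> (forall i c, `|B i c| <= b * rho ^+ dg c) ->
    (forall c j, `|D c j| <= b) ->
    `|\det (\matrix_(i, j) \sum_c B i c * D c j)| <= C * rho ^+ N.
Proof.
move=> fN b0; exists (\sum_(f : {ffun 'I_n -> T}) b ^+ n * (n`!%:R * b ^+ n)).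
  by apply: sumr_ge0 => f _; rewrite !mulr_ge0 ?exprn_ge0.
move=> B D rho /andP[r0 r1] hB hD.
rewrite det_mul_expand (le_trans (ler_norm_sum _ _ _))// mulr_suml.
apply: ler_sum => f _.
have [/injectiveP fi|fni] := boolP (injectiveb f); last first.
  have /injectivePn[i1 [i2 i12 E]] := fni.
  rewrite (determinant_alternate i12) ?mulr0 ?normr0; last first.
    by move=> j; rewrite !mxE E.
  by rewrite !mulr_ge0 ?exprn_ge0.
rewrite normrM mulrAC; apply: ler_pM => //; last first.
  by apply: norm_det_le => i j; rewrite mxE.
rewrite normr_prod (@le_trans _ _ (\prod_i (b * rho ^+ dg (f i))))//.
  by apply: ler_prod => i _; rewrite normr_ge0 hB.
rewrite big_split /= prodr_const card_ord ler_wpM2l ?exprn_ge0//.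
by rewrite prodrXr ler_wiXn2l// fN.
Qed.

Lemma sum_bin_diag (k n : nat) :
  (\sum_(0 <= j < n.+1) 'C(k + j, j) = 'C(k.+1 + n, n))%N.
Proof.
elim: n => [|n IH]; first by rewrite big_nat1 !addn0 !bin0.
by rewrite big_nat_recr//= IH -addSnnS addnS -[RHS]/('C((k.+1 + n).+1, n.+1)) binS addnC addSn.
Qed.

Lemma sum_weighted_bin_diag (k n : nat) :
  (\sum_(0 <= j < n.+1) (n.+1 - j) * 'C(k + j, j) = 'C(k.+2 + n, n))%N.
Proof.
elim: n => [|n IH]; first by rewrite big_nat1 !addn0 !bin0.
rewrite big_nat_recr//= subSnn mul1n.
have -> : (\sum_(0 <= i < n.+1) (n.+2 - i) * 'C(k + i, i) =
   \sum_(0 <= j < n.+1) (n.+1 - j) * 'C(k + j, j) +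
   \sum_(0 <= j < n.+1) 'C(k + j, j))%N.
  rewrite -big_split; apply: eq_big_nat => i /andP[_ lin] /=.
  by rewrite subSn ?(ltnW lin)// mulSn addnC.
rewrite IH -addnA -big_nat_recr//= sum_bin_diag.
by rewrite addnS addnC binS !addSn addnS.
Qed.

Lemma osc_dimE (k n : nat) : (0 < n)%N ->
  (osc_dim k.+1 n).+1 = (\sum_(0 <= j < n.+1) 'C(k + j, j))%N.
Proof.
move=> n0; rewrite /osc_dim /bracket /= [RHS]big_ltn// [in RHS]big_ltn//.
by rewrite bin0 bin1 addn1 add1n addSn.
Qed.

(** A tuple of total degree at most [n] leaves [n + 1] minus that degree choices for one more
    exponent; for larger degrees the truncated difference is 0. The sum therefore counts the
    monomials of degree at most [n] in [k + 1] variables. *)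
Lemma sum_codegree (k n : nat) :
  (\sum_(t : k.-tuple 'I_n.+1) (n.+1 - \sum_(i <- t) i) = 'C(k.+1 + n, n))%N.
Proof.
transitivity (#|[set t : k.+1.-tuple 'I_n.+1 | \sum_(i <- t) i <= n]%SET|)%N.
  rewrite -sum1dep_card [RHS]big_mkcond /=.
  rewrite [RHS](reindex (fun p : 'I_n.+1 * k.-tuple 'I_n.+1 => [tuple of p.1 :: p.2])) /=;
    last first.
    exists (fun t => (thead t, [tuple of behead t])).
      by move=> [x t] _ /=; congr (_, _); apply: val_inj.
    by move=> t _; rewrite -tuple_eta.
  rewrite -(pair_bigA _ (fun (x : 'I_n.+1) (t : k.-tuple 'I_n.+1) =>
    if \sum_(i <- x :: t) i <= n then 1 else 0))%N /= exchange_big /=.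
  apply: eq_bigr => t _; rewrite -big_mkcond /=.
  set s := (\sum_(i <- t) i)%N.
  rewrite [RHS](eq_bigl (fun i : 'I_n.+1 => i + s <= n)%N); last first.
    by move=> i; rewrite big_cons.
  rewrite -(big_mkord (fun i => i + s <= n)%N (fun=> 1%N)).
  rewrite (eq_bigl (fun i => i < n.+1 - s)%N); last by move=> i /=; lia.
  have -> : (\sum_(0 <= i < n.+1 | i < n.+1 - s) 1 = \sum_(0 <= i < n.+1 - s) 1)%N.
    by rewrite -(big_nat_widen _ _ _ xpredT)// leq_subr.
  by rewrite sum_nat_const_nat subn0 muln1.
by rewrite card_partial_ord_partitions -[LHS]bin_sub ?leq_addr// addKn.
Qed.

Definition mdeg (k n : nat) (al : k.-tuple 'I_n) : nat := \sum_(i <- al) i.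

(* In the Taylor expansion of d+1 points at mutual distance rho, a monomial of
   degree j has size rho^j and a coordinate of the remainder (inr) rho^(n+1). *)
Definition col_degree (k n p : nat) (c : k.-tuple 'I_n.+1 + 'I_p) : nat :=
  match c with inl al => minn (mdeg al) n.+1 | inr _ => n.+1 end.

Lemma N_kd_le_col_degree (k d : nat) (n := n_kd k d)
    (f : 'I_d.+1 -> k.-tuple 'I_n.+1 + 'I_d.+1) :
  (0 < k <= d)%N -> injective f -> (N_kd k d <= \sum_i col_degree (f i))%N.
Proof.
move=> hk fi; have [n0 dE] := n_kd_spec hk; rewrite -/n in n0 dE.
have codeg c : (n.+1 - @col_degree k n d.+1 c + col_degree c = n.+1)%N.
  by rewrite subnK// /col_degree; case: c => [al|_] //; rewrite geq_minr.
have S1 : (\sum_(i < d.+1) (n.+1 - col_degree (f i)) + \sum_i col_degree (f i)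
    = d.+1 * n.+1)%N.
  by rewrite -big_split /= (eq_bigr _ (fun i _ => codeg (f i))) sum_nat_const card_ord.
have S2 : (\sum_(i < d.+1) (n.+1 - col_degree (f i)) <= 'C(k.+1 + n, n))%N.
  rewrite -(sum_codegree k n).
  pose F (c : k.-tuple 'I_n.+1 + 'I_d.+1) := (n.+1 - col_degree c)%N.
  have -> : (\sum_(t : k.-tuple 'I_n.+1) (n.+1 - \sum_(i <- t) i) = \sum_c F c)%N.
    rewrite big_sumType /= addnC [X in (X + _)%N]big1 ?add0n.
      by apply: eq_bigr => t _; rewrite /F /col_degree /mdeg; lia.
    by move=> i _; rewrite /F /= subnn.
  rewrite [leqRHS](bigID (mem (f @: [set: 'I_d.+1]%SET)%SET)) /=.
  rewrite big_imset /=; last by move=> x y _ _; exact: fi.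
  by rewrite [in leqRHS](eq_bigl xpredT) ?leq_addr// => i; rewrite inE.
have S3 : (\sum_(0 <= j < n.+1) j * 'C(k.-1 + j, j) + 'C(k.+1 + n, n) =
    n.+1 * (osc_dim k n).+1)%N.
  case: k hk {dE S1 S2 f fi codeg} @n n0 => // k _ n n0.
  rewrite osc_dimE// -(sum_weighted_bin_diag k n) -big_split big_distrr /=.
  by apply: eq_big_nat => i /andP[_ lin]; rewrite -mulnDl addnC subnK// ltnW.
have S4 : N_kd k d = (\sum_(0 <= j < n.+1) j * 'C(k.-1 + j, j) + n.+1 * m_kd k d)%N.
  rewrite /N_kd -/n /bracket; congr (_ + _)%N.
  case: k hk {dE S1 S2 S3 f fi codeg} @n n0 => // k _ n n0.
  by rewrite [RHS]big_ltn// [in RHS]big_ltn// mul0n add0n mul1n bin1 addn1.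
have S5 : (d.+1 * n.+1 = n.+1 * (osc_dim k n).+1 + n.+1 * m_kd k d)%N.
  by rewrite -mulnDr addSn -dE mulnC.
lia.
Qed.

(** A set contained in no hyperplane yields a basis by greedy choice, and the matrix of this basis
    is invertible. *)
Lemma hyperplane_of_det0 (F : fieldType) (n : nat) (S : set 'rV[F]_n.+1) :
  (forall A : 'M[F]_n.+1, (forall i, S (row i A)) -> \det A = 0) ->
  exists2 l : 'cV[F]_n.+1, l != 0 & forall s, S s -> s *m l = 0.
Proof.
move=> S0; apply: contrapT => nl.
suff /(_ n.+1 (leqnn _))[B [Bf SB]] : forall p, (p <= n.+1)%N ->
    exists B : 'M[F]_(p, n.+1), row_free B /\ forall i, S (row i B).
  by move: Bf; rewrite row_free_unit unitmxE S0// unitr0.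
elim=> [|p IH] pn; first by exists 0; split; [rewrite -row_leq_rank | case].
have [B [Bf SB]] := IH (ltnW pn).
have [allB|] := pselect (forall s, S s -> (s <= B)%MS).
  exfalso; apply: nl.
  (* A nonzero column of the cokernel is a nonzero linear form vanishing on the row space of [B]. *)
  have : cokermx B != 0.
    by rewrite -mxrank_eq0 mxrank_coker -lt0n subn_gt0 (leq_ltn_trans (rank_leq_row _)).
  move=> /matrix0Pn[i [j Bij]]; exists (col j (cokermx B)).
    by apply/matrix0Pn; exists i, ord0; rewrite mxE.
  move=> s /allB sB; apply/matrixP => x y.
  move: sB; rewrite submxE => /eqP/matrixP/(_ x j); rewrite !mxE => sB.
  by rewrite -[RHS]sB; apply: eq_bigr => z _; rewrite mxE.
move=> /existsNP[s /not_implyP[Ss nsB]].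
have -> : p.+1 = (p + 1)%N by rewrite addn1.
exists (col_mx B s); split; last first.
  move=> i; case: (splitP i) => j ij.
    have -> : i = lshift 1 j by apply: val_inj.
    by rewrite rowKu.
  have -> : i = rshift p j by apply: val_inj.
  by rewrite rowKd row_id.
rewrite -row_leq_rank -addsmxE addn1.
have : (B < B + s)%MS.
  by rewrite ltmxE addsmxSl addsmx_sub submx_refl /=; apply/negP.
by rewrite ltmxErank (eqP Bf) => /andP[].
Qed.

(** * Sublevel sets of polynomials on grids *)

Definition monom (R : pzRingType) (k n : nat) (u : k.-tuple R)
    (al : k.-tuple 'I_n) : R := \prod_i tnth u i ^+ tnth al i.

Lemma monom_cons (R : pzRingType) (k n : nat) (x : R) (u : k.-tuple R)
    (a : 'I_n) (al : k.-tuple 'I_n) :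
  monom [tuple of x :: u] [tuple of a :: al] = x ^+ a * monom u al.
Proof.
rewrite /monom big_ord_recl !tnth0; congr (_ * _).
by apply: eq_bigr => i _; rewrite !tnthS.
Qed.

Lemma sum_tuple_cons (V : nmodType) (T : finType) (k : nat)
    (F : k.+1.-tuple T -> V) :
  \sum_t F t = \sum_(x : T) \sum_(t : k.-tuple T) F [tuple of x :: t].
Proof.
rewrite pair_bigA /= (reindex (fun p : T * k.-tuple T => [tuple of p.1 :: p.2])) //.
exists (fun t => (thead t, [tuple of behead t])).
  by move=> [x t] _ /=; congr (_, _); apply: val_inj.
by move=> t _; rewrite -tuple_eta.
Qed.

(* Pigeonhole: picking every q-th element of the sorted exceptional set gives
   n points at mutual distance at least q. *)
Lemma separated_subset (m q n : nat) (A : {set 'I_m}) :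
  (0 < n)%N -> (n * q < #|A|)%N ->
  exists f : 'I_n -> 'I_m, (forall i, f i \in A) /\
    forall i j : 'I_n, (i < j)%N -> (f i + q <= f j)%N.
Proof.
move=> n0 hA; have [x0 x0A] : exists x, x \in A.
  by apply/set0Pn; rewrite -card_gt0 (leq_ltn_trans _ hA).
pose s := map val (enum A).
have srt : sorted ltn s.
  rewrite sorted_map; apply: sorted_filter; first by move=> ? ? ?; apply: ltn_trans.
  by rewrite -enumT -sorted_map val_enum_ord iota_ltn_sorted.
have sz : size s = #|A| by rewrite size_map -cardE.
have gap i j : (i + j < size s)%N -> (nth 0 s i + j <= nth 0 s (i + j))%N.
  elim: j => [|j IH] ijs; first by rewrite !addn0.
  rewrite addnS (leq_ltn_trans (IH _))//; first by rewrite (leq_trans _ ijs)// addnS.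
  move: ijs; rewrite addnS => ijs.
  by apply: (sorted_ltn_nth ltn_trans 0 srt); rewrite ?inE// ltnW.
have lt_s (i : 'I_n) : (i * q < size s)%N.
  by rewrite sz (leq_ltn_trans _ hA)// leq_mul2r ltnW ?orbT.
exists (fun i : 'I_n => nth x0 (enum A) (i * q)); split.
  by move=> i; rewrite -mem_enum mem_nth// -cardE -sz.
move=> i j ij.
have E (l : 'I_n) : nth x0 (enum A) (l * q) = nth 0 s (l * q) :> nat.
  by rewrite (nth_map x0)// -cardE -sz.
rewrite !E; have jE : (j * q = i * q + (j * q - i * q))%N by rewrite subnKC// leq_mul2r ltnW ?orbT.
rewrite [X in (_ <= nth _ _ X)%N]jE (leq_trans _ (gap _ _ _)) -?jE//.
by rewrite leq_add2l -mulnBl leq_pmull// subn_gt0.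
Qed.

(** With too many small values, [D + 1] of the points would be well separated, with Vandermonde
    determinant at least [sigma]. Recovering the coefficients through the adjugate would then bound
    all of them by 1/2. *)
Lemma grid_sublevel_1d (R : realType) (D : nat) (eta : R) : 0 < eta ->
  exists2 delta : R, 0 < delta & exists m0 : nat, forall m (b : 'I_D.+1 -> R),
    (m0 <= m)%N -> (exists a, 1 <= `|b a|) ->
    #|[set e : 'I_m | `|\sum_a b a * (e%:R / m%:R) ^+ a| <= delta]%SET|%:R
      <= eta * m%:R.
Proof.
move=> eta0; set n := D.+1; pose s := eta / (2 * n%:R).
have n0 : 0 < n%:R :> R by rewrite ltr0n.
have s0 : 0 < s by rewrite divr_gt0// mulr_gt0.
pose sigma := \prod_(i < n) \prod_(j < n | (i < j)%N) s.
have sigma0 : 0 < sigma by apply: prodr_gt0 => i _; apply: prodr_gt0.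
have f0 : 0 < D`!%:R :> R by rewrite ltr0n fact_gt0.
pose delta := sigma / (2 * (n%:R * D`!%:R)).
have delta0 : 0 < delta by rewrite divr_gt0// !mulr_gt0.
(* This bound on [m] gives [s * m >= 1], so rounding [eta * m / n = 2 * s * m] down to [q] still
   leaves [q >= s * m]. *)
exists delta => //; exists (Num.trunc (s^-1)).+1 => m b mm [a ba].
have sm : 1 <= s * m%:R.
  rewrite mulrC -ler_pdivrMr// div1r (le_trans (ltW (truncnS_gt _)))// ler_nat.
  exact: mm.
have m0 : 0 < m%:R :> R by rewrite ltr0n (leq_trans _ mm).
set A := [set e : 'I_m | _]%SET; rewrite leNgt; apply/negP => hA.
pose q := Num.trunc (eta * m%:R / n%:R).
have q_le : n%:R * q%:R <= eta * m%:R.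
  rewrite mulrC -ler_pdivlMr// truncn_le// !mulr_ge0// ltW// ?invr_gt0//.
have q_ge : s * m%:R <= q%:R.
  have := truncnS_gt (eta * m%:R / n%:R); rewrite -/q -natr1.
  have -> : eta * m%:R / n%:R = 2 * (s * m%:R) by rewrite /s; field; rewrite ?gt_eqF.
  lra.
have [f [fA fq]] : exists f : 'I_n -> 'I_m, (forall i, f i \in A) /\
    forall i j : 'I_n, (i < j)%N -> (f i + q <= f j)%N.
  by apply: separated_subset => //; rewrite -(ltr_nat R) natrM (le_lt_trans q_le).
pose t : 'rV[R]_n := \row_i ((f i)%:R / m%:R).
have t01 i : 0 <= t 0 i <= 1.
  by rewrite mxE divr_ge0//= ler_pdivrMr// mul1r ler_nat ltnW.
have dV : sigma <= \det (Vandermonde n t).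
  rewrite det_Vandermonde; apply: ler_prod => i _.
  apply/andP; split; first by apply: prodr_ge0 => j _; rewrite ltW.
  apply: ler_prod => j ij; rewrite (ltW s0)/= !mxE -mulrBl ler_pdivlMr//.
  by rewrite (le_trans q_ge)// lerBrDl -natrD ler_nat fq.
pose bv : 'rV[R]_n := \row_i b i.
have : (bv *m Vandermonde n t) *m \adj (Vandermonde n t) = \det (Vandermonde n t) *: bv.
  by rewrite -mulmxA mul_mx_adj mul_mx_scalar.
move=> /matrixP/(_ ord0 a); rewrite !mxE => E.
have : sigma <= n%:R * (delta * D`!%:R).
  apply: (le_trans dV); rewrite -[leLHS]mulr1.
  have dV0 : 0 <= \det (Vandermonde n t) by rewrite (le_trans _ dV)// ltW.
  apply: (le_trans (ler_wpM2l dV0 ba)); rewrite -[X in X * _](ger0_norm dV0).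
  rewrite -normrM -E (le_trans (ler_norm_sum _ _ _))//.
  rewrite -[X in X%:R * _](card_ord n) mulr_natl -sumr_const.
  apply: ler_sum => i _; rewrite normrM; apply: ler_pM => //.
    have := fA i; rewrite inE; congr (`|_| <= _); rewrite mxE.
    by apply: eq_bigr => j _; rewrite !mxE.
  (* A cofactor is a [D] by [D] determinant with entries of absolute value at most 1, whence the
     factorial in [delta]. *)
  rewrite mxE /cofactor normrM normrX normrN1 expr1n mul1r.
  rewrite -[leRHS]mulr1 -[X in _ * X](expr1n _ D); apply: norm_det_le => x y.
  have -> : row' a (col' i (Vandermonde n t)) x y = t 0 (lift i y) ^+ lift a x.
    by rewrite !mxE.
  by have /andP[h1 h2] := t01 (lift i y); rewrite normrX exprn_ile1// ger0_norm.
rewrite /delta leNgt => /negP; apply.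
have -> : n%:R * (sigma / (2 * (n%:R * D`!%:R)) * D`!%:R) = sigma / 2.
  by field; rewrite ?gt_eqF.
by rewrite ltr_pdivrMr// ltr_pMr// ltr1n.
Qed.

(** Induction by slicing: the polynomial is read in its first variable, with coefficients [c e a]
    that are polynomials in the others. Half of [eta] pays for the slices where one chosen
    coefficient is small, the other half for the small values inside the remaining slices. *)
Lemma grid_sublevel (R : realType) (k D : nat) (eta : R) : 0 < eta ->
  exists2 delta : R, 0 < delta & exists m0 : nat,
  forall m (b : k.-tuple 'I_D.+1 -> R), (m0 <= m)%N -> (exists al, 1 <= `|b al|) ->
    #|[set e : k.-tuple 'I_m |
       `|\sum_al b al * monom [tuple (tnth e i)%:R / m%:R | i < k] al| <= delta]%SET|%:R
      <= eta * m%:R ^+ k.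
Proof.
elim: k eta => [|k IH] eta eta0.
  exists (2^-1); rewrite ?invr_gt0//; exists 0%N => m b _ [al bal].
  rewrite (_ : [set e | _]%SET = finset.set0) ?cards0 ?expr0 ?mulr1 ?ltW//.
  apply/finset.setP => e; rewrite !inE; apply/negbTE; rewrite -ltNge.
  rewrite (bigD1 al)//= big1 ?addr0; last first.
    by move=> i /eqP; rewrite (tuple0 i) (tuple0 al).
  by rewrite /monom big_ord0 mulr1 (lt_le_trans _ bal)// invf_lt1// ltr1n.
have e20 : 0 < eta / 2 by rewrite divr_gt0.
have [d1 d10 [m1 H1]] := IH _ e20.
have [d2 d20 [m2 H2]] := grid_sublevel_1d D e20.
exists (d1 * d2); first by rewrite mulr_gt0.
exists (maxn 1 (maxn m1 m2)) => m b; rewrite !geq_max => /and3P[m0 mm1 mm2] [al].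
case/tupleP: al => a al bal.
pose c (e : k.-tuple 'I_m) (a : 'I_D.+1) := \sum_(al : k.-tuple 'I_D.+1) b [tuple of a :: al] *
  monom [tuple (tnth e i)%:R / m%:R | i < k] al.
set A := [set e : k.-tuple 'I_m | `|c e a| <= d1]%SET.
have HA : #|A|%:R <= eta / 2 * m%:R ^+ k by apply: H1 => //; exists al.
have HB (e : k.-tuple 'I_m) : e \notin A ->
    #|[set x : 'I_m | `|\sum_a c e a * (x%:R / m%:R) ^+ a| <= d1 * d2]%SET|%:R
     <= eta / 2 * m%:R.
  rewrite inE -ltNge => ca.
  (* Division by [d1] restores a coefficient of size at least 1, which is why the threshold is the
     product [d1 * d2]. *)
  have H := H2 m (fun a => c e a / d1) mm2.
  apply: le_trans (H _); last first.
    by exists a; rewrite normrM normfV (gtr0_norm d10) ler_pdivlMr// mul1r ltW.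
  rewrite ler_nat; apply/subset_leq_card/fintype.subsetP => x; rewrite !inE => h.
  rewrite (eq_bigr (fun a => d1^-1 * (c e a * (x%:R / m%:R) ^+ a))); last first.
    by move=> i _; rewrite mulrAC mulrC.
  by rewrite -mulr_sumr normrM normfV (gtr0_norm d10) ler_pdivrMl.
rewrite -sum1_card natr_sum big_mkcond sum_tuple_cons exchange_big /=.
have key (e : k.-tuple 'I_m) : \sum_(x < m) (if [tuple of x :: e] \in [set e : k.+1.-tuple 'I_m |
    `|\sum_al b al * monom [tuple (tnth e i)%:R / m%:R | i < k.+1] al| <= d1 * d2]%SET
    then 1%:R else 0) <= (if e \in A then m%:R else 0) + eta / 2 * m%:R :> R.
  rewrite -big_mkcond -natr_sum sum1_card.
  have [eA|/HB] := boolP (e \in A).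
    rewrite -[leLHS]addr0; apply: lerD; last by rewrite mulr_ge0// ltW.
    by rewrite ler_nat (leq_trans (max_card _))// card_ord.
  rewrite add0r; apply: le_trans; rewrite ler_nat; apply/eq_leq/eq_card => x.
  rewrite [RHS]inE /in_mem /=; rewrite [LHS](inE, inE); congr (`|_| <= _).
  rewrite sum_tuple_cons; apply: eq_bigr => i _.
  rewrite /c mulr_suml; apply: eq_bigr => be _.
  rewrite (_ : [tuple _ | _ < _] = [tuple of (x%:R / m%:R) ::
     [tuple (tnth e i)%:R / m%:R | i < k]]) ?monom_cons; last first.
    apply: eq_from_tnth => j; rewrite tnth_mktuple.
    by case: (unliftP ord0 j) => [j'|] ->; rewrite ?tnthS ?tnth0// tnth_mktuple.
  by rewrite -mulrA [X in _ * X]mulrC.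
apply: le_trans (ler_sum _ (fun e _ => key e)) _.
rewrite big_split /= -big_mkcond /= sumr_const sumr_const card_tuple card_ord.
rewrite -[X in X + _]mulr_natr -[X in _ + X]mulr_natr natrX exprS.
have := ler_wpM2l (ler0n R m) HA; lra.
Qed.

Lemma norm_monom_le (R : numDomainType) (k n : nat) (u : k.-tuple R)
    (al : k.-tuple 'I_n) (r : R) :
  (forall i, `|tnth u i| <= r) -> `|monom u al| <= r ^+ mdeg al.
Proof.
move=> ur; rewrite /monom normr_prod /mdeg big_tuple -prodrXr.
apply: ler_prod => i _; rewrite normr_ge0/= normrX.
by apply: lerXn2r; rewrite ?nnegrE ?(le_trans _ (ur i)).
Qed.

Lemma monom_lipschitz (R : realFieldType) (k n : nat) (r : R) : 0 <= r ->
  exists2 L : R, 0 <= L & forall (u v : k.-tuple R) (al : k.-tuple 'I_n) t,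
    (forall i, `|tnth u i| <= r) -> (forall i, `|tnth v i| <= r) ->
    (forall i, `|tnth u i - tnth v i| <= t) ->
    `|monom u al - monom v al| <= L * t.
Proof.
move=> r0; have X1 (a : nat) : exists2 L : R, 0 <= L & forall x y t,
    `|x| <= r -> `|y| <= r -> `|x - y| <= t -> `|x ^+ a - y ^+ a| <= L * t.
  elim: a => [|a [L L0 IH]].
    by exists 0 => // x y t _ _ _; rewrite !expr0 subrr normr0 mul0r.
  exists (r ^+ a + r * L) => [|x y t xr yr xyt].
    by rewrite addr_ge0 ?mulr_ge0 ?exprn_ge0.
  have -> : x ^+ a.+1 - y ^+ a.+1 = (x - y) * x ^+ a + y * (x ^+ a - y ^+ a).
    by rewrite !exprS; ring.
  rewrite (le_trans (ler_normD _ _))// !normrM mulrDl; apply: lerD.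
    by rewrite mulrC ler_pM// normrX lerXn2r ?nnegrE// (le_trans _ xr).
  by rewrite -mulrA ler_pM// IH.
pose L1 (a : nat) := s2val (cid2 (X1 a)).
pose L0 := \sum_(a < n) L1 a.
have L1_ge0 a : 0 <= L1 a by exact: (s2valP (cid2 (X1 a))).
have L00 : 0 <= L0 by apply: sumr_ge0.
have X2 (a : 'I_n) x y t : `|x| <= r -> `|y| <= r -> `|x - y| <= t ->
    `|x ^+ a - y ^+ a| <= L0 * t.
  move=> xr yr xyt; have /= := s2valP' (cid2 (X1 a)) x y t xr yr xyt.
  move=> /le_trans; apply; rewrite ler_wpM2r// ?(le_trans _ xyt)//.
  by rewrite /L0 (bigD1 a)//= lerDl sumr_ge0.
(* Powers of a number at least 1 grow with the exponent, so one power of [r1] bounds all the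
   monomials. *)
pose r1 := Num.max 1 r; have r11 : 1 <= r1 by rewrite le_max lexx.
have rr1 : r <= r1 by rewrite le_max lexx orbT.
elim: k => [|k [L Lge0 IH]].
  exists 0 => // u v al t _ _ _; rewrite (tuple0 u) (tuple0 v) subrr normr0 mul0r//.
exists (L0 * r1 ^+ (k * n) + r1 ^+ n * L).
  by rewrite addr_ge0 ?mulr_ge0 ?exprn_ge0// (le_trans ler01).
move=> u v al t; case/tupleP: u => x u; case/tupleP: v => y v; case/tupleP: al => a al.
move=> ur vr uvt; rewrite !monom_cons.
have [xr yr xyt] : [/\ `|x| <= r, `|y| <= r & `|x - y| <= t].
  by move: (ur ord0) (vr ord0) (uvt ord0); rewrite !tnth0.
have {}ur i : `|tnth u i| <= r by have := ur (lift ord0 i); rewrite tnthS.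
have {}vr i : `|tnth v i| <= r by have := vr (lift ord0 i); rewrite tnthS.
have {}uvt i : `|tnth u i - tnth v i| <= t by have := uvt (lift ord0 i); rewrite !tnthS.
have -> : x ^+ a * monom u al - y ^+ a * monom v al =
    (x ^+ a - y ^+ a) * monom u al + y ^+ a * (monom u al - monom v al) by ring.
rewrite (le_trans (ler_normD _ _))// !normrM mulrDl; apply: lerD.
  rewrite mulrAC ler_pM// ?X2//.
  rewrite (@le_trans _ _ (r1 ^+ mdeg al))//.
    by apply: norm_monom_le => i; rewrite (le_trans (ur i)).
  apply: ler_weXn2l => //; rewrite /mdeg big_tuple.
  rewrite -[X in (_ <= X * _)%N]card_ord -sum_nat_const; apply: leq_sum => i _.
  exact: ltnW.
rewrite -mulrA ler_pM// ?IH// normrX.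
by rewrite (@le_trans _ _ (r1 ^+ a))// ?lerXn2r ?nnegrE// ?(le_trans ler01)// ?(le_trans yr)// ler_weXn2l// ltnW.
Qed.

(** The estimate at grid points extends to points within [2 / m] of them once [m] makes the
    Lipschitz error at most [delta / 2]; the upper bound 1 on the coefficients controls this error.
    The proportion 1/2 does not change with [m]. *)
Lemma grid_near_zero (R : realType) (k D : nat) : exists m0 : nat, forall m, (m0 <= m)%N ->
  exists2 tau : R, 0 < tau & forall b : k.-tuple 'I_D.+1 -> R,
    (forall al, `|b al| <= 1) -> (exists al, 1 <= `|b al|) ->
    #|[set e : k.-tuple 'I_m | `[< exists u : k.-tuple R,
        [/\ forall i, `|tnth u i| <= 2,
            forall i, `|(tnth e i)%:R / m%:R - tnth u i| <= 2 / m%:R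
          & `|\sum_al b al * monom u al| <= tau] >] ]%SET|%:R <= 2^-1 * m%:R ^+ k :> R.
Proof.
have h0 : 0 < 2^-1 :> R by rewrite invr_gt0.
have [delta d0 [m1 H1]] := grid_sublevel k D h0.
have [L L0 HL] := @monom_lipschitz R k D.+1 2 (ler0n _ _).
pose c : R := #|{: k.-tuple 'I_D.+1}|%:R * L * 2.
exists (maxn 1 (maxn m1 (Num.trunc (c / (delta / 2))).+1)) => m.
rewrite !geq_max => /and3P[m0 mm1 mm2].
have m0' : 0 < m%:R :> R by rewrite ltr0n.
have cm : c / m%:R <= delta / 2.
  rewrite ler_pdivrMr// mulrC -ler_pdivrMr ?divr_gt0//.
  by rewrite (le_trans (ltW (truncnS_gt _)))// ler_nat.
exists (delta / 2); first by rewrite divr_gt0.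
move=> b b1 bex; apply: le_trans (H1 _ _ mm1 bex).
rewrite ler_nat; apply/subset_leq_card/fintype.subsetP => e; rewrite !inE.
move=> [u [u2 ue Pu]]; set w := [tuple _ | _ < _].
have -> : \sum_al b al * monom w al =
    \sum_al b al * monom u al + \sum_al b al * (monom w al - monom u al).
  by rewrite -big_split; apply: eq_bigr => al _ /=; rewrite mulrBr addrC subrK.
rewrite [leRHS]splitr (le_trans (ler_normD _ _))// lerD// (le_trans _ cm)//.
rewrite (le_trans (ler_norm_sum _ _ _))// /c -!mulrA mulr_natl -sumr_const.
apply: ler_sum => al _; rewrite normrM -[leRHS]mul1r ler_pM// HL//.
  move=> i; rewrite tnth_mktuple ger0_norm ?divr_ge0// ler_pdivrMr// -natrM ler_nat.
  by rewrite (leq_trans (ltnW (ltn_ord _)))// leq_pmull.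
by move=> i; rewrite tnth_mktuple.
Qed.

(** * Branches avoiding a cheap family of nodes *)

(* The weight of a node is the expected cost of the lists still ahead when
   walking down to a uniformly random child; some child does not increase it. *)
Lemma tree_branch_avoiding (R : realType) (T : eqType) (par : T -> T)
    (inv : nat -> T -> Prop) (good : nat -> T -> seq T) (root : T) (N : R)
    (lev : nat -> nat) (C : nat -> seq T) :
  0 < N -> inv 0%N root ->
  (forall j a, inv j a -> [/\ uniq (good j a), N <= (size (good j a))%:R
     & forall c, c \in good j a -> par c = a /\ inv j.+1 c]) ->
  (\sum_(0 <= i <oo) ((size (C i))%:R / N ^+ lev i)%:E < 1)%E ->
  exists a : nat -> T, [/\ a 0%N = root, forall j, a j.+1 \in good j (a j)
    & forall i, a (lev i) \notin C i].
Proof.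
move=> N0 root_inv goodP sum1.
(* [cnt j a i] counts the entries of [C i] whose ancestor at level [j] is [a]. The factor [cf j i]
   is [N] to the power [j - lev i], an upper bound for the chance of reaching a given one of them;
   lists at levels already passed weigh 0. *)
pose cnt j a i := count (fun b => iter (lev i - j) par b == a) (C i).
pose cf j i : R := if (j <= lev i)%N then N ^+ j / N ^+ lev i else 0.
have cf0 j i : 0 <= cf j i.
  by rewrite /cf; case: ifP => // _; rewrite mulr_ge0 ?invr_ge0 ?exprn_ge0// ltW.
have cfS j i : (j < lev i)%N -> cf j.+1 i = N * cf j i.
  by move=> ji; rewrite /cf ji ltnW// exprS mulrA.
pose t j a i : \bar R := ((cnt j a i)%:R * cf j i)%:E.
have t0 j a i : (0 <= t j a i)%E by rewrite lee_fin mulr_ge0.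
pose w j a := (\sum_(0 <= i <oo) t j a i)%E.
have wroot : (w 0%N root < 1)%E.
  apply: le_lt_trans sum1; apply: lee_nneseries => [i _ _|i _]; first exact: t0.
  rewrite lee_fin /cf leq0n expr0 mul1r ler_wpM2r ?invr_ge0 ?exprn_ge0 ?(ltW N0)//.
  by rewrite ler_nat count_size.
(* An entry descends from at most one child, so summing over the duplicate-free list of children
   counts it at most once. *)
have cnt_sum j a i : inv j a -> (j < lev i)%N ->
    (\sum_(c <- good j a) cnt j.+1 c i <= cnt j a i)%N.
  move=> /goodP[ug _ gc] ji; rewrite /cnt.
  under eq_bigr => c _ do rewrite -sum1_count big_mkcond.
  rewrite exchange_big -sum1_count [leqRHS]big_mkcond /=; apply: leq_sum => b _.
  rewrite -big_mkcond /= sum1_count.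
  rewrite (eq_count (a2 := pred1 (iter (lev i - j.+1) par b))); last first.
    by move=> c; rewrite /= eq_sym.
  rewrite count_uniq_mem//; case: (boolP (_ \in _)) => // /gc[<- _].
  by rewrite -iterS subnSK// eqxx.
have step j a : inv j a -> (w j a < 1)%E ->
    exists2 c, c \in good j a & (w j.+1 c <= w j a)%E.
  move=> ja wja; have [ug sz gc] := goodP _ _ ja; apply: contrapT => nc.
  have lt c : c \in good j a -> (w j a < w j.+1 c)%E.
    by move=> cg; rewrite ltNge; apply/negP => h; apply: nc; exists c.
  (* If every child were heavier than [a], the sum over at least [N] children would exceed
     [N * w j a], against this bound. *)
  have sum_le : (\sum_(c <- good j a) w j.+1 c <= N%:E * w j a)%E.
    rewrite /w -nneseries_sum; last by move=> *; exact: t0.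
    rewrite -nneseriesZl; last by move=> *; exact: t0.
    apply: lee_nneseries => [i _ _|i _]; first by apply: sume_ge0 => *; exact: t0.
    rewrite sumEFin -EFinM lee_fin -mulr_suml.
    have [ji|ij] := ltnP j (lev i); last first.
      have -> : cf j.+1 i = 0 by rewrite /cf ltnNge ij.
      by rewrite mulr0; apply: mulr_ge0; [exact: ltW|exact: mulr_ge0].
    rewrite cfS// mulrCA ler_wpM2l ?(ltW N0)// ler_wpM2r// -natr_sum ler_nat.
    exact: cnt_sum.
  have wfin : w j a \is a fin_num.
    by rewrite fin_numElt (lt_trans wja) ?ltry// (lt_le_trans (ltNyr 0))// nneseries_ge0.
  have wfinc c : c \in good j a -> w j.+1 c \is a fin_num.
    move=> cg; rewrite fin_numElt (lt_le_trans (ltNyr 0)) ?nneseries_ge0//=.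
    apply: le_lt_trans (ltry (N * fine (w j a))).
    rewrite EFinM fineK//; apply: le_trans sum_le.
    rewrite (big_rem c)//= leeDl// sume_ge0// => *; exact: nneseries_ge0.
  have good0 : has (mem (good j a)) (good j a).
    apply/hasP; case: (good j a) sz => [/(lt_le_trans N0)|c l _]; first by rewrite ltxx.
    by exists c; exact: mem_head.
  have : \sum_(c <- good j a) fine (w j a) < \sum_(c <- good j a) fine (w j.+1 c).
    rewrite big_seq [ltRHS]big_seq; apply: ltr_sum => // c cg.
    by rewrite -lte_fin (fineK wfin) (fineK (wfinc _ cg)) lt.
  apply/negP; rewrite -leNgt -lee_fin -sumEFin (eq_big_seq (fun c => w j.+1 c)); last first.
    by move=> c cg; rewrite fineK ?wfinc.
  rewrite (le_trans sum_le)// -[w j a in leLHS](fineK wfin) -EFinM lee_fin.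
  rewrite big_const_seq count_predT iter_addr_0 -[leRHS]mulr_natl ler_wpM2r//.
  by rewrite fine_ge0// nneseries_ge0.
have [f fP] : exists f : nat -> T -> T, forall j a, inv j a -> (w j a < 1)%E ->
    f j a \in good j a /\ (w j.+1 (f j a) <= w j a)%E.
  have : forall ja : nat * T, exists c, inv ja.1 ja.2 -> (w ja.1 ja.2 < 1)%E ->
      c \in good ja.1 ja.2 /\ (w ja.1.+1 c <= w ja.1 ja.2)%E.
    move=> [j a] /=; have [[ja wja]|nja] := pselect (inv j a /\ (w j a < 1)%E).
      by have [c cg cw] := step _ _ ja wja; exists c.
    by exists root => ja wja; exfalso; apply: nja.
  by move=> /choice[f fP]; exists (fun j a => f (j, a)) => j a; exact: (fP (j, a)).
pose a := fix a j := if j is j'.+1 then f j' (a j') else root.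
have aP j : inv j (a j) /\ (w j (a j) < 1)%E.
  elim: j => [|j [ia wa]] //=; have [fg fw] := fP _ _ ia wa.
  by have [_ _ gc] := goodP _ _ ia; split; [case: (gc _ fg)|exact: le_lt_trans wa].
exists a; split=> // [j|i]; first by case: (aP j) => ia wa; case: (fP _ _ ia wa).
(* A node that belongs to the list of its own level contributes at least 1 to its weight. *)
apply/negP => ai; have [_] := aP (lev i); apply/negP; rewrite -leNgt.
rewrite (le_trans _ (nneseries_lim_ge i.+1 _))// big_nat_recr//=.
rewrite -[leLHS]add0e; apply: leeD; first by apply: sume_ge0.
rewrite lee_fin /cf leqnn mulfV ?mulr1 ?ler1n ?expf_neq0 ?gt_eqF//.
rewrite -has_count; apply/hasP; exists (a (lev i)) => //.
by rewrite subnn /= eqxx.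
Qed.

(** * Taylor expansion *)

Lemma rV_coord_le (R : realType) (n : nat) (x : 'rV[R]_n) i : `|x ord0 i| <= `|x|.
Proof.
rewrite [leRHS]/Num.norm/= mx_normrE.
exact: (le_bigmax _ (fun ij => `|x ij.1 ij.2|) (ord0, i)).
Qed.

Lemma rV_norm_le (R : realType) (n : nat) (x : 'rV[R]_n) (r : R) :
  0 <= r -> (forall i, `|x ord0 i| <= r) -> `|x| <= r.
Proof.
move=> r0 xr; rewrite [leLHS]/Num.norm/= mx_normrE.
by apply: bigmax_le => // -[i j] _ /=; rewrite ord1.
Qed.

Lemma mean_value_between (R : realType) (h dh : R -> R) (r t : R) :
  (forall x : R, `|x| <= r -> is_derive x 1 h (dh x)) -> `|t| <= r ->
  exists2 c, `|c| <= `|t| & h t - h 0 = dh c * t.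
Proof.
move=> hd tr.
have cont a b : -r <= a -> b <= r -> {within `[a, b], continuous h}.
  move=> ra br; apply: derivable_within_continuous => x; rewrite in_itv /= => /andP[ax xb].
  suff /hd : `|x| <= r by case.
  by rewrite ler_norml (le_trans ra ax) (le_trans xb br).
move: (tr); rewrite ler_norml => /andP[rt tr'].
have r0 : 0 <= r by rewrite (le_trans _ tr).
have [t0|t0] := leP 0 t.
  have [| |c] := @MVT_segment R h dh 0 t t0.
  - by move=> x; rewrite in_itv /= => /andP[x0 xt]; apply: hd; rewrite ger0_norm ?ltW// (lt_le_trans xt).
  - by apply: cont => //; rewrite oppr_le0.
  rewrite in_itv /= subr0 => /andP[c0 ct] E; exists c => //.
  by rewrite !ger0_norm.
have [| |c] := @MVT_segment R h dh t 0 (ltW t0).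
- move=> x; rewrite in_itv /= => /andP[tx x0]; apply: hd.
  by rewrite ltr0_norm// lerNl (le_trans rt)// ltW.
- exact: cont.
rewrite in_itv /= sub0r => /andP[tc c0] E; exists c.
  by rewrite (ltr0_norm t0) ler0_norm// lerN2.
by rewrite -opprB E mulrN opprK.
Qed.

(** The error [h] vanishes at 0 and its derivative is the error for the shifted family [g a.+1], so
    the mean value theorem gives the induction. *)
Lemma taylor_real (R : realType) (n : nat) (g : nat -> R -> R) (r B : R) :
  (forall a (x : R), (a < n)%N -> `|x| <= r -> is_derive x 1 (g a) (g a.+1 x)) ->
  (forall x, `|x| <= r -> `|g n x| <= B) ->
  forall t, `|t| <= r ->
  `|g 0%N t - \sum_(a < n) t ^+ a / a`!%:R * g a 0| <= B * `|t| ^+ n.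
Proof.
elim: n g => [|n IH] g gd gB t tr.
  by rewrite big_ord0 subr0 expr0 mulr1 gB.
pose h (x : R) := g 0%N x - \sum_(a < n.+1) x ^+ a / a`!%:R * g a 0.
pose dh (x : R) := g 1%N x - \sum_(a < n) x ^+ a / a`!%:R * g a.+1 0.
have hd (x : R) : `|x| <= r -> is_derive x 1 h (dh x).
  move=> xr; rewrite /h /dh.
  have -> : (fun x => g 0%N x - \sum_(a < n.+1) x ^+ a / a`!%:R * g a 0) =
    g 0%N - \sum_(a < n.+1) (fun x => x ^+ a / a`!%:R * g a 0).
    by apply/funext => y /=; rewrite fct_sumE.
  apply: is_deriveB; first exact: gd.
  have -> : \sum_(a < n) x ^+ a / a`!%:R * g a.+1 0 =
      0 + \sum_(a < n) x ^+ a / a`!%:R * g a.+1 0 by rewrite add0r.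
  rewrite big_ord_recl; apply: is_deriveD.
    rewrite (_ : (fun _ => _) = cst (g 0%N 0)); first exact: is_derive_cst.
    by apply/funext => y /=; rewrite expr0 fact0 divr1 mul1r.
  apply: is_derive_sum => i.
  rewrite (_ : (fun _ => _) = (g i.+1 0 / i.+1`!%:R) \*: (id ^+ i.+1)).
    apply: is_derive_eq; rewrite /GRing.scale /= mulr1 factS natrM.
    have f0 : i`!%:R != 0 :> R by rewrite pnatr_eq0 -lt0n fact_gt0.
    have i0 : i.+1%:R != 0 :> R by rewrite pnatr_eq0.
    by move: (i.+1%:R : R) i0 (i`!%:R : R) f0 => A A0 C C0; field; rewrite C0 A0.
  by apply/funext => y; rewrite lift0 exprfctE mulrC mulrA mulrAC.
have h0 : h 0 = 0.
  rewrite /h big_ord_recl expr0 fact0 divr1 mul1r big1 ?addr0 ?subrr// => i _.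
  by rewrite expr0n /= !mul0r.
have [c ct] := mean_value_between hd tr.
rewrite h0 subr0 -/(h t) => ->; rewrite normrM exprSr mulrA ler_wpM2r//.
have c_le : `|c| <= r by apply: le_trans tr.
rewrite (le_trans (IH (fun a => g a.+1) _ _ c c_le))//.
  by move=> a x an xr; apply: gd.
rewrite ler_wpM2l//; last by rewrite lerXn2r ?nnegrE.
by rewrite (le_trans _ (gB t tr)).
Qed.

Lemma is_derive_line (R : realType) (k p : nat) (G : 'rV[R]_k -> 'rV[R]_p)
    (v e : 'rV[R]_k) (x : R) j :
  derivable G (v + x *: e) e ->
  is_derive x 1 (fun y : R => G (v + y *: e) ord0 j) ('D_e G (v + x *: e) ord0 j).
Proof.
move=> dG; have /derivable_mxP/(_ ord0 j) dGj := dG.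
have E : (fun h : R => h^-1 *: (G (v + (h *: 1 + x) *: e) ord0 j - G (v + x *: e) ord0 j)) =
   (fun h : R => h^-1 *: (G (h *: e + (v + x *: e)) ord0 j - G (v + x *: e) ord0 j)).
  by apply/funext => h; rewrite [h *: 1]mulr1 scalerDl addrCA addrA.
apply: DeriveDef; first by rewrite /derivable /= E.
by rewrite (derive_mx dG) mxE /derive /= E.
Qed.

Lemma taylor_line (R : realType) (k p : nat) (F : 'rV[R]_k -> 'rV[R]_p)
    (U : set 'rV[R]_k) (s : seq 'I_k) (i : 'I_k) (n : nat) (v : 'rV[R]_k) (r B : R) :
  smooth_on U F ->
  (forall x : R, `|x| <= r -> U (v + x *: ebasis R i) /\
     `|partials (nseq n i ++ s) F (v + x *: ebasis R i)| <= B) ->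
  forall t : R, `|t| <= r ->
  `|partials s F (v + t *: ebasis R i) -
    \sum_(a < n) (t ^+ a / a`!%:R) *: partials (nseq a i ++ s) F v| <= B * `|t| ^+ n.
Proof.
move=> sF hU t tr; have r0 : 0 <= r by rewrite (le_trans _ tr).
have B0 : 0 <= B by case: (hU t tr) => _; apply: le_trans.
apply: rV_norm_le => [|j]; first by rewrite mulr_ge0// exprn_ge0.
pose g a x := partials (nseq a i ++ s) F (v + x *: ebasis R i) ord0 j.
have h1 a (x : R) : (a < n)%N -> `|x| <= r -> is_derive x 1 (g a) (g a.+1 x).
  by move=> an xr; have [Ux _] := hU x xr; apply: is_derive_line; case: (sF (nseq a i ++ s) _ Ux).
have h2 (x : R) : `|x| <= r -> `|g n x| <= B.
  by move=> /hU[_]; apply: le_trans; exact: rV_coord_le.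
rewrite (le_trans _ (taylor_real h1 h2 tr))// !mxE summxE.
rewrite le_eqVlt; apply/orP; left; apply/eqP; congr (`|_ - _|); apply: eq_bigr => a _.
by rewrite mxE /g scale0r addr0.
Qed.

Lemma near_closed_ball (R : realType) (k : nat) (v0 : 'rV[R]_k) (P : set 'rV[R]_k) :
  (\forall v \near v0, P v) ->
  exists2 r : R, 0 < r <= 1 & forall v, `|v - v0| <= r -> P v.
Proof.
move=> /nbhs_ballP[e /= e0 eP]; exists (Num.min 1 (e / 2)).
  by rewrite lt_min ltr01 divr_gt0//= ge_min lexx.
move=> v; rewrite le_min => /andP[_ ve]; apply: eP.
by rewrite -ball_normE /ball_/= distrC (le_lt_trans ve)// ltr_pdivrMr// ltr_pMr// ltr1n.
Qed.

Lemma partials_locally_bounded (R : realType) (k : nat) (V : normedModType R)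
    (F : 'rV[R]_k -> V) (U : set 'rV[R]_k) (T : finType) (L : T -> seq 'I_k)
    (v0 : 'rV[R]_k) :
  open U -> U v0 -> smooth_on U F ->
  exists2 r : R, 0 < r <= 1 & exists2 B : R, 0 <= B & forall v, `|v - v0| <= r ->
    U v /\ forall t, `|partials (L t) F v| <= B.
Proof.
move=> oU Uv0 sF; pose b t := `|partials (L t) F v0| + 1.
have b0 t : 0 <= b t by rewrite addr_ge0.
suff /near_closed_ball[r r0 hr] : \forall v \near v0,
    U v /\ forall t, `|partials (L t) F v| <= b t.
  exists r => //; exists (\sum_t b t); first exact: sumr_ge0.
  move=> v /hr[Uv hb]; split=> // t; rewrite (le_trans (hb t))//.
  by rewrite (bigD1 t)//= lerDl sumr_ge0.
apply: filterI; first exact: open_nbhs_nbhs.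
apply: (@filter_forall _ T (fun t v => `|partials (L t) F v| <= b t) (nbhs v0) (nbhs_filter v0)) => t.
have [/cvgrPdist_le /(_ 1 ltr01) + _] := sF (L t) v0 Uv0.
apply: filterS => v h; rewrite -lerBlDl (le_trans _ h)// distrC.
exact: lerB_dist.
Qed.

Definition tuple_partials (R : realType) (k m n : nat) (V : normedModType R)
    (s : m.-tuple 'I_k) (al : m.-tuple 'I_n) (F : 'rV[R]_k -> V) : 'rV[R]_k -> V :=
  partials (flatten [seq nseq (nat_of_ord p.2) p.1 | p <- zip s al]) F.

Definition subvec (R : realType) (k m : nat) (h : 'rV[R]_k) (s : m.-tuple 'I_k) :
  m.-tuple R := [tuple h ord0 (tnth s i) | i < m].

Definition tuple_fact (m n : nat) (al : m.-tuple 'I_n) : nat :=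
  (\prod_i (tnth al i)`!)%N.

(* Expanding in one variable after the other keeps the partial derivatives
   sorted, so that their commutation is not needed. *)
Lemma taylor_tuple (R : realType) (k m n p : nat) (F : 'rV[R]_k -> 'rV[R]_p)
    (U : set 'rV[R]_k) (v0 : 'rV[R]_k) (s : m.-tuple 'I_k) :
  open U -> U v0 -> smooth_on U F ->
  exists2 r : R, 0 < r <= 1 & exists2 C : R, 0 <= C &
    forall v h : 'rV[R]_k, `|v - v0| <= r -> `|h| <= r ->
    `|F (v + \sum_(i < m) h ord0 (tnth s i) *: ebasis R (tnth s i)) -
      \sum_(al : m.-tuple 'I_n.+1)
        (monom (subvec h s) al / (tuple_fact al)%:R) *: tuple_partials s al F v|
    <= C * `|h| ^+ n.+1.
Proof.
move=> oU Uv0 sF; elim: m s => [|m IH] s.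
  exists 1; first by rewrite ltr01 lexx.
  exists 0 => // v h _ _; rewrite big_ord0 addr0 mul0r (bigD1 [tuple])//= big1.
    by rewrite /monom /tuple_fact !big_ord0 /tuple_partials (tuple0 s)/= divr1 scale1r addr0 subrr normr0.
  by move=> al /eqP; rewrite (tuple0 al).
case/tupleP: s => i s; have [r1 /andP[r10 r11] [C1 C10 H1]] := IH s.
pose L (be : m.-tuple 'I_n.+1) := nseq n.+1 i ++
  flatten [seq nseq (nat_of_ord p.2) p.1 | p <- zip s be].
have [r2 /andP[r20 r21] [B B0 H2]] := partials_locally_bounded L oU Uv0 sF.
pose r := Num.min (r1 / 2) (r2 / 2).
have rr1 : r <= r1 / 2 by rewrite ge_min lexx.
have rr2 : r <= r2 / 2 by rewrite ge_min lexx orbT.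
have r0 : 0 < r by rewrite lt_min !divr_gt0.
exists r; first by rewrite r0 (le_trans rr1)// ler_pdivrMr// mul1r (le_trans r11)// ler1n.
exists (C1 + #|{: m.-tuple 'I_n.+1}|%:R * B); first by rewrite addr_ge0// mulr_ge0.
move=> v h vr hr; set hi := h ord0 i.
have hir : `|hi| <= `|h| by exact: rV_coord_le.
have e1 : `|ebasis R i| <= 1.
  by apply: rV_norm_le => // j; rewrite mxE eqxx /=; case: eqP; rewrite ?normr0 ?normr1.
have near_i (x : R) : `|x| <= r -> `|v + x *: ebasis R i - v0| <= r + r.
  move=> xr; rewrite addrAC (le_trans (ler_normD _ _))// lerD// normrZ.
  by rewrite -[r]mulr1 ler_pM.
rewrite big_ord_recl tnth0 addrA.
under eq_bigr => j _ do rewrite tnthS.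
set w := \sum_(i0 < m) _; rewrite sum_tuple_cons exchange_big /=.
pose c (be : m.-tuple 'I_n.+1) := monom (subvec h s) be / (tuple_fact be)%:R.
pose G (be : m.-tuple 'I_n.+1) := tuple_partials s be F.
pose S (be : m.-tuple 'I_n.+1) := \sum_(a < n.+1) (hi ^+ a / a`!%:R) *:
  partials (nseq a i ++ flatten [seq nseq (nat_of_ord p.2) p.1 | p <- zip s be]) F v.
(* The error splits in two: [F] is expanded in the remaining variables around the displaced point
   [v + hi *: ebasis R i], then each partial derivative occurring there is brought back to [v] along
   direction [i]. *)
have -> : F (v + hi *: ebasis R i + w) - \sum_(be : m.-tuple 'I_n.+1) \sum_(a < n.+1)
    (monom (subvec h [tuple of i :: s]) [tuple of a :: be] /
     (tuple_fact [tuple of a :: be])%:R) *: tuple_partials [tuple of i :: s] [tuple of a :: be] F v =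
  (F (v + hi *: ebasis R i + w) - \sum_be c be *: G be (v + hi *: ebasis R i)) +
  \sum_be c be *: (G be (v + hi *: ebasis R i) - S be).
  rewrite -[RHS]addrA; congr (_ + _).
  rewrite [X in _ = _ + X](eq_bigr (fun be => c be *: G be (v + hi *: ebasis R i) - c be *: S be));
    last by move=> be _; rewrite scalerBr.
  rewrite sumrB addKr; congr (- _); apply: eq_bigr => be _; rewrite scaler_sumr.
  apply: eq_bigr => a _; rewrite scalerA; congr (_ *: _).
  rewrite /c (_ : subvec h [tuple of i :: s] = [tuple of hi :: subvec h s]) ?monom_cons;
    last first.
    apply: eq_from_tnth => j; rewrite tnth_mktuple.
    by case: (unliftP ord0 j) => [j'|] ->; rewrite ?tnthS ?tnth0// tnth_mktuple.
  have -> : tuple_fact [tuple of a :: be] = (a`! * tuple_fact be)%N.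
    rewrite /tuple_fact big_ord_recl tnth0; congr (_ * _)%N.
    by apply: eq_bigr => j _; rewrite tnthS.
  by rewrite natrM invfM mulrACA mulrC.
rewrite (le_trans (ler_normD _ _))// mulrDl; apply: lerD.
  apply: H1; last by rewrite (le_trans hr)// (le_trans rr1)// ler_pdivrMr// ler_pMr// ler1n.
  by rewrite (le_trans (near_i _ (le_trans hir hr)))// (splitr r1) lerD.
rewrite (le_trans (ler_norm_sum _ _ _))// -mulrA mulr_natl -sumr_const.
apply: ler_sum => be _; rewrite normrZ -[leRHS]mul1r ler_pM//.
  rewrite normrM normfV (@ger0_norm _ (tuple_fact be)%:R)// ler_pdivrMr ?mul1r; last first.
    by rewrite ltr0n prodn_gt0// => j; exact: fact_gt0.
  have h1 : `|h| <= 1.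
    by rewrite (le_trans hr)// (le_trans rr1)// ler_pdivrMr// mul1r (le_trans r11)// ler1n.
  rewrite (@le_trans _ _ (1 ^+ mdeg be))//.
    by apply: norm_monom_le => j; rewrite tnth_mktuple (le_trans (rV_coord_le _ _)).
  by rewrite expr1n ler1n prodn_gt0// => j; exact: fact_gt0.
have hB (x : R) : `|x| <= r -> U (v + x *: ebasis R i) /\
    `|partials (nseq n.+1 i ++ flatten [seq nseq (nat_of_ord p.2) p.1 | p <- zip s be]) F
       (v + x *: ebasis R i)| <= B.
  move=> xr; have [|Ux hx] := H2 (v + x *: ebasis R i).
    by rewrite (le_trans (near_i _ xr))// (splitr r2) lerD.
  by split => //; exact: (hx be).
rewrite (le_trans (taylor_line sF hB (le_trans hir hr)))// ler_wpM2l//.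
by rewrite lerXn2r ?nnegrE.
Qed.

(** * Chart points in small cubes *)

Definition coords (R : realType) (k : nat) (h : 'rV[R]_k) : k.-tuple R :=
  subvec h (ord_tuple k).

Definition jet (R : realType) (k n p : nat) (F : 'rV[R]_k -> 'rV[R]_p)
    (al : k.-tuple 'I_n) (v : 'rV[R]_k) : 'rV[R]_p :=
  (tuple_fact al)%:R^-1 *: tuple_partials (ord_tuple k) al F v.

Lemma tuple_fact_gt0 (m n : nat) (al : m.-tuple 'I_n) : (0 < tuple_fact al)%N.
Proof. by rewrite prodn_gt0// => j; exact: fact_gt0. Qed.

Lemma taylor (R : realType) (k n p : nat) (F : 'rV[R]_k -> 'rV[R]_p)
    (U : set 'rV[R]_k) (v0 : 'rV[R]_k) :
  open U -> U v0 -> smooth_on U F ->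
  exists2 r : R, 0 < r <= 1 & exists2 C : R, 0 <= C &
    forall v h : 'rV[R]_k, `|v - v0| <= r -> `|h| <= r ->
    `|F (v + h) - \sum_(al : k.-tuple 'I_n.+1) monom (coords h) al *: jet F al v|
    <= C * `|h| ^+ n.+1.
Proof.
move=> oU Uv0 sF; have [r r0 [C C0 H]] := taylor_tuple n (ord_tuple k) oU Uv0 sF.
exists r => //; exists C => // v h vr hr; have := H v h vr hr.
under eq_bigr => i _ do rewrite tnth_ord_tuple /ebasis.
rewrite -row_sum_delta; apply: le_trans; rewrite le_eqVlt; apply/orP; left.
by apply/eqP; congr (`|_ - _|); apply: eq_bigr => al _; rewrite scalerA.
Qed.

Lemma jet_near (R : realType) (k n p : nat) (F : 'rV[R]_k -> 'rV[R]_p)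
    (U : set 'rV[R]_k) (v0 : 'rV[R]_k) (e : R) :
  U v0 -> smooth_on U F -> 0 < e ->
  exists2 r : R, 0 < r <= 1 & forall v, `|v - v0| <= r ->
    forall al : k.-tuple 'I_n, `|jet F al v - jet F al v0| <= e.
Proof.
move=> Uv0 sF e0; apply: near_closed_ball.
apply: (@filter_forall _ _ (fun al v => `|jet F al v - jet F al v0| <= e)
  (nbhs v0) (nbhs_filter v0)) => al.
pose L := flatten [seq nseq (nat_of_ord p.2) p.1 | p <- zip (ord_tuple k) al].
have [/cvgrPdist_le /(_ e e0) + _] := sF L v0 Uv0.
apply: filterS => v h; rewrite /jet /tuple_partials -/L -scalerBr normrZ normfV normr_nat.
rewrite ler_pdivrMl ?ltr0n ?tuple_fact_gt0// distrC (le_trans h)// ler_peMl ?(ltW e0)//.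
by rewrite ler1n tuple_fact_gt0.
Qed.

Lemma norm_mulmx_le (R : realType) (p : nat) (w : 'rV[R]_p) (l : 'cV[R]_p) (b : R) :
  `|w| <= b -> `|(w *m l) ord0 ord0| <= p%:R * b * `|l|.
Proof.
move=> wb; rewrite mxE (le_trans (ler_norm_sum _ _ _))//.
rewrite -[p in p%:R](card_ord p) -mulrA mulr_natl -sumr_const.
apply: ler_sum => i _; rewrite normrM ler_pM//; first exact: le_trans (rV_coord_le _ _) wb.
rewrite [leRHS]/Num.norm/= mx_normrE.
exact: (le_bigmax _ (fun ij => `|l ij.1 ij.2|) (i, ord0)).
Qed.

(** At [v0] the jets of order at most [D] span, so the coordinates of [l] are combinations of its
    pairings with them, with coefficients controlled by [W]. Continuity of the jets keeps such a
    bound nearby, uniformly in [l]. *)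
Lemma nondegenerate_functional (R : realType) (k D d : nat) (Phi : 'rV[R]_k -> nzvec R d)
    (U : set 'rV[R]_k) (v0 : 'rV[R]_k) (F := @vec R d \o Phi) :
  open U -> U v0 -> smooth_on U F -> osculating_space Phi D v0 = fullv ->
  exists2 r : R, 0 < r <= 1 & exists2 A : R, 0 < A &
    forall v (l : 'cV[R]_d.+1), `|v - v0| <= r -> l != 0 ->
    exists2 al : k.-tuple 'I_D.+1, (mdeg al <= D)%N &
      `|l| <= A * `|(jet F al v *m l) ord0 ord0|.
Proof.
move=> oU Uv0 sF full.
pose I := {ffun 'I_k -> 'I_D.+1}.
pose tup (al : I) : k.-tuple 'I_D.+1 := [tuple al i | i < k].
have partial_jet (al : I) : partial_mi (fun i => al i) F v0 =
    (tuple_fact (tup al))%:R *: jet F (tup al) v0.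
  rewrite /jet scalerA mulfV ?pnatr_eq0 -?lt0n ?tuple_fact_gt0// scale1r.
  rewrite /tuple_partials /partial_mi; congr (partials (flatten _) _ _).
  rewrite /tup /= -[X in zip X _]map_id zip_map -map_comp.
  by [].
have mdeg_tup (al : I) : mdeg (tup al) = (\sum_i al i)%N.
  by rewrite /mdeg big_tuple; apply: eq_bigr => i _; rewrite tnth_mktuple.
have [a aP] : exists a : 'I_d.+1 -> I -> R, forall j, ebasis R j =
    \sum_(al : I | (\sum_i al i <= D)%N) a j al *: partial_mi (fun i => al i) F v0.
  suff : forall j, exists a : I -> R, ebasis R j =
    \sum_(al : I | (\sum_i al i <= D)%N) a al *: partial_mi (fun i => al i) F v0.
    by move=> /choice[a aP]; exists a.
  move=> j; have : ebasis R j \in osculating_space Phi D v0 by rewrite full memvf.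
  move=> /memv_sumP[u up ->].
  have : forall al : I, exists c : R, (\sum_i al i <= D)%N ->
      u al = c *: partial_mi (fun i => al i) F v0.
    move=> al; have [h|_] := boolP (_ <= D)%N; last by exists 0.
    by have /vlineP[c ->] := up al h; exists c.
  move=> /choice[c cP]; exists c; apply: eq_bigr => al h; exact: cP.
pose W := 1 + \sum_j \sum_al `|a j al| * (tuple_fact (tup al))%:R.
have W0 : 0 < W.
  by rewrite ltr_pwDl// sumr_ge0// => j _; rewrite sumr_ge0// => al _; rewrite mulr_ge0.
have at_v0 (l : 'cV[R]_d.+1) (c : R) : 0 <= c ->
    (forall al : k.-tuple 'I_D.+1, (mdeg al <= D)%N ->
      `|(jet F al v0 *m l) ord0 ord0| <= c) -> `|l| <= W * c.
  move=> c0 hc; rewrite [leLHS]/Num.norm/= mx_normrE.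
  apply: bigmax_le => [|[j j0] _ /=]; first by rewrite mulr_ge0// ltW.
  rewrite (ord1 j0); have -> : l j ord0 = (ebasis R j *m l) ord0 ord0.
    by rewrite /ebasis -rowE mxE.
  rewrite aP mulmx_suml summxE (le_trans (ler_norm_sum _ _ _))//.
  apply: (@le_trans _ _ ((\sum_al `|a j al| * (tuple_fact (tup al))%:R) * c)); last first.
    rewrite ler_wpM2r// /W (bigD1 j)//= addrCA lerDl addr_ge0//.
    by rewrite sumr_ge0// => i _; rewrite sumr_ge0// => al _; rewrite mulr_ge0.
  rewrite mulr_suml [leRHS](bigID (fun al : I => (\sum_i al i <= D)%N)) /= -[leLHS]addr0.
  apply: lerD; last by rewrite sumr_ge0// => al _; rewrite !mulr_ge0.
  apply: ler_sum => al hal; rewrite partial_jet.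
  have := hc (tup al); rewrite mdeg_tup hal => /(_ isT).
  move: (jet F (tup al) v0) => J hJ.
  rewrite -!scalemxAl [X in `|X|]mxE [X in _ * X]mxE !normrM normr_nat.
  by rewrite mulrA ler_wpM2l// mulr_ge0.
(* Moving the jets by this much changes a pairing with [l] by at most [|l| / (4 * W)]. If the
   pairings at [v] were below the same bound, the estimate at [v0] would give [|l| <= |l| / 2]. *)
have e0 : 0 < (4 * W * d.+1%:R)^-1 by rewrite invr_gt0 !mulr_gt0.
have [r r0 hr] := @jet_near R k D.+1 d.+1 F U v0 _ Uv0 sF e0.
exists r => //; exists (4 * W); first by rewrite mulr_gt0.
move=> v l vr l0; apply: contrapT => nal.
have lgt0 : 0 < `|l| by rewrite normr_gt0.
have : `|l| <= W * (`|l| / (4 * W) + `|l| / (4 * W)).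
  apply: at_v0 => [|al hal]; first by rewrite addr_ge0// divr_ge0// mulr_ge0// ltW.
  have -> : jet F al v0 = jet F al v - (jet F al v - jet F al v0) by rewrite subKr.
  rewrite mulmxBl mxE [X in _ + X]mxE (le_trans (ler_normB _ _))// lerD//.
    rewrite ler_pdivlMr ?mulr_gt0// leNgt; apply/negP => h; apply: nal.
    by exists al => //; rewrite mulrC ltW.
  rewrite (le_trans (norm_mulmx_le _ (hr v vr al)))// le_eqVlt; apply/orP; left.
  by apply/eqP; field; rewrite gt_eqF//=; rewrite addrC natr1 pnatr_eq0.
have -> : W * (`|l| / (4 * W) + `|l| / (4 * W)) = `|l| / 2 by field; rewrite gt_eqF.
by rewrite ler_pdivlMr// ger_pMr// leNgt ltr1n.
Qed.

(** Taylor expansion at [v] factors the matrix as [B] times [D]: the columns of [B] are monomials,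
    followed by the coordinates of the remainder, which [D] pairs with the standard basis. Stopping
    at order [n_kd] gives the remainder columns degree [n_kd + 1], the weight of the last [m_kd]
    vectors in [N_kd]. *)
Lemma simplex_det (R : realType) (k d : nat) (F : 'rV[R]_k -> 'rV[R]_d.+1)
    (U : set 'rV[R]_k) (v0 : 'rV[R]_k) :
  (0 < k <= d)%N -> open U -> U v0 -> smooth_on U F ->
  exists2 r : R, 0 < r <= 1 & exists2 C : R, 0 <= C &
    forall v rho (w : 'I_d.+1 -> 'rV[R]_k), `|v - v0| <= r -> rho <= r ->
    (forall i, `|w i - v| <= rho) ->
    `|\det (\matrix_(i, j) F (w i) ord0 j)| <= C * rho ^+ N_kd k d.
Proof.
move=> kd oU Uv0 sF; set n := n_kd k d.
have [r1 /andP[r10 r11] [C1 C10 H1]] := @taylor R k n d.+1 F U v0 oU Uv0 sF.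
have [r2 /andP[r20 r21] H2] := @jet_near R k n.+1 d.+1 F U v0 _ Uv0 sF ltr01.
pose b : R := 1 + C1 + \sum_(al : k.-tuple 'I_n.+1) (1 + `|jet F al v0|).
have sum0 : 0 <= \sum_(al : k.-tuple 'I_n.+1) (1 + `|jet F al v0|).
  by apply: sumr_ge0 => al _; rewrite addr_ge0.
have b1 : 1 <= b by rewrite /b -addrA lerDl addr_ge0.
have bC : C1 <= b by rewrite /b addrAC lerDr addr_ge0.
have b0 : 0 <= b by rewrite (le_trans ler01).
have bjet v (al : k.-tuple 'I_n.+1) : `|v - v0| <= r2 -> `|jet F al v| <= b.
  move=> /H2/(_ al) h; rewrite -[jet F al v](subrK (jet F al v0)).
  rewrite (le_trans (ler_normD _ _))// /b (bigD1 al)//= addrA.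
  rewrite -addrA addrCA (le_trans (lerD h (lexx _)))// lerDl !addr_ge0//.
  by rewrite sumr_ge0// => i _; rewrite addr_ge0.
have [C C0 HC] := norm_det_sum_le (fun f => N_kd_le_col_degree kd (f := f)) b0.
exists (Num.min r1 r2); first by rewrite lt_min r10 r20 ge_min r11.
exists C => // v rho w; rewrite !le_min => /andP[v1 v2] /andP[rho1 rho2] wv.
have rho0 : 0 <= rho by rewrite (le_trans _ (wv ord0)).
have rho_le1 : rho <= 1 by rewrite (le_trans rho1).
pose rem i := F (w i) - \sum_(al : k.-tuple 'I_n.+1) monom (coords (w i - v)) al *: jet F al v.
pose B i (c : k.-tuple 'I_n.+1 + 'I_d.+1) :=
  match c with inl al => monom (coords (w i - v)) al | inr j => rem i ord0 j end.
pose D (c : k.-tuple 'I_n.+1 + 'I_d.+1) j :=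
  match c with inl al => jet F al v ord0 j | inr j' => (j' == j)%:R end.
have -> : \matrix_(i, j) F (w i) ord0 j = \matrix_(i, j) \sum_c B i c * D c j.
  apply/matrixP => i j; rewrite !mxE big_sumType /= [X in _ + X](bigD1 j)//= eqxx mulr1.
  rewrite [X in _ + (_ + X)]big1 ?addr0 => [|l /negbTE ->]; last by rewrite mulr0.
  rewrite /rem mxE [X in _ + (_ + X)]mxE summxE addrC.
  rewrite -[LHS](subrK (\sum_(al : k.-tuple 'I_n.+1) monom (coords (w i - v)) al * jet F al v ord0 j)).
  by congr (_ - _ + _); apply: eq_bigr => al _; rewrite [RHS]mxE.
apply: HC; first by rewrite rho0.
  move=> i [al|j] /=.
    rewrite (@le_trans _ _ (rho ^+ mdeg al))//.
      by apply: norm_monom_le => l; rewrite tnth_mktuple (le_trans (rV_coord_le _ _)).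
    (* Each exponent is at most [n], but the total degree may exceed [n + 1]; such monomials are
       charged only degree [n + 1]. *)
    rewrite (@le_trans _ _ (rho ^+ minn (mdeg al) n.+1))// ?ler_wiXn2l// ?geq_minl//.
    by rewrite ler_peMl// exprn_ge0.
  rewrite (le_trans (rV_coord_le _ _))// /rem -{1}[w i](subrKC v).
  rewrite (le_trans (H1 _ _ v1 (le_trans (wv i) rho1)))// ler_pM// ?exprn_ge0//.
  by rewrite lerXn2r ?nnegrE.
move=> [al|j'] j /=; last by case: eqP; rewrite ?normr0 ?normr1.
by rewrite (le_trans (rV_coord_le _ _))// bjet.
Qed.

(* A cube of side rho at v is cut into m^k subcubes, indexed by e; the subcubes
   counted include all those within rho/m of the hyperplane section F * l = 0. *)
Lemma few_cells_near_hyperplane (R : realType) (k D d : nat)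
    (Phi : 'rV[R]_k -> nzvec R d) (U : set 'rV[R]_k) (v0 : 'rV[R]_k)
    (F := @vec R d \o Phi) :
  open U -> U v0 -> smooth_on U F -> osculating_space Phi D v0 = fullv ->
  exists m0 : nat, forall m, (m0 <= m)%N ->
  exists2 rho0 : R, 0 < rho0 <= 1 &
    forall (v : 'rV[R]_k) (rho : R) (l : 'cV[R]_d.+1),
    `|v - v0| <= rho0 -> 0 < rho <= rho0 -> l != 0 ->
    #|[set e : k.-tuple 'I_m | `[< exists h : 'rV[R]_k,
       [/\ `|h| <= 2 * rho,
           forall i, `|(tnth e i)%:R / m%:R * rho - h ord0 i| <= 2 / m%:R * rho
         & F (v + h) *m l = 0] >] ]%SET|%:R <= 2^-1 * m%:R ^+ k :> R.
Proof.
move=> oU Uv0 sF full.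
have [r1 /andP[r10 r11] [C C0 H1]] := @taylor R k D d.+1 F U v0 oU Uv0 sF.
have [r2 /andP[r20 r21] [A A0 H2]] := nondegenerate_functional oU Uv0 sF full.
have [m0 Hm] := grid_near_zero R k D; exists m0 => m mm0.
have [tau tau0 Ht] := Hm m mm0.
(* [c * rho] bounds the Taylor remainder of the linear form relative to its largest rescaled
   coefficient; the last entry of [rho0] brings it below [tau]. *)
pose c := A * (d.+1%:R * (C * 2 ^+ D.+1)).
have c0 : 0 <= c by rewrite !mulr_ge0 ?exprn_ge0 ?(ltW A0).
pose rho0 := Num.min (r1 / 2) (Num.min r2 (tau / (c + 1))).
have rho00 : 0 < rho0 by rewrite !lt_min !divr_gt0// ?r20// ltr_wpDl.
have hr1 : rho0 <= r1 / 2 by rewrite ge_min lexx.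
have hr2 : rho0 <= r2 by rewrite ge_min ge_min lexx orbT.
have hr3 : rho0 <= tau / (c + 1) by rewrite !ge_min lexx !orbT.
exists rho0; first by rewrite rho00 (le_trans hr2).
move=> v rho l vr /andP[rho_gt0 rho_le] l0.
have rho1 : rho <= 1 by rewrite (le_trans rho_le)// (le_trans hr2).
have lgt0 : 0 < `|l| by rewrite normr_gt0.
(* These are the coefficients of the pulled-back form once the cube is rescaled to side 1. Dividing
   by the largest of them, [f al0], gives the normalization that [tau] requires, whatever the
   hyperplane. *)
pose f (al : k.-tuple 'I_D.+1) := (jet F al v *m l) ord0 ord0 * rho ^+ mdeg al.
have [be be_deg be_l] := H2 v l (le_trans vr hr2) l0.
have fbe : `|l| * rho ^+ D <= A * `|f be|.
  rewrite /f normrM (ger0_norm (exprn_ge0 _ (ltW rho_gt0))) mulrA.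
  by rewrite ler_pM ?exprn_ge0// ?(ltW rho_gt0)// ler_wiXn2l// ltW.
pose al0 := [arg max_(al > be) `|f al|]%O.
have al0P al : `|f al| <= `|f al0|.
  by rewrite /al0; case: Order.TotalTheory.arg_maxP => // i _; apply.
have fal0 : `|l| * rho ^+ D <= A * `|f al0|.
  by rewrite (le_trans fbe)// ler_wpM2l// ltW.
have f0 : 0 < `|f al0|.
  by rewrite -(pmulr_rgt0 _ A0) (lt_le_trans _ fal0)// mulr_gt0// exprn_gt0.
apply: le_trans (Ht (fun al => f al / `|f al0|) _ _); last 2 first.
- by move=> al; rewrite normrM normfV normr_id ler_pdivrMr// mul1r.
- by exists al0; rewrite normrM normfV normr_id mulfV// gt_eqF.
rewrite ler_nat; apply/subset_leq_card/fintype.subsetP => e; rewrite !inE.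
move=> [h [h2 he Fh]]; exists (coords (rho^-1 *: h)); split.
- move=> i; rewrite tnth_mktuple tnth_ord_tuple (le_trans (rV_coord_le _ _))//.
  by rewrite normrZ normfV (gtr0_norm rho_gt0) ler_pdivrMl// mulrC.
- move=> i; rewrite tnth_mktuple tnth_ord_tuple mxE.
  rewrite -[X in X - _](mulfK (lt0r_neq0 rho_gt0)) mulrC -mulrBr normrM normfV (gtr0_norm rho_gt0).
  by rewrite ler_pdivrMl// [leRHS]mulrC.
have mon al : monom (coords h) al = rho ^+ mdeg al * monom (coords (rho^-1 *: h)) al.
  rewrite /monom /mdeg big_tuple -prodrXr -big_split /=; apply: eq_bigr => i _.
  rewrite !tnth_mktuple mxE -exprMn mulrA mulfV ?mul1r// gt_eqF//.
rewrite (eq_bigr (fun al => `|f al0|^-1 * (monom (coords h) al * (jet F al v *m l) ord0 ord0))); last first.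
  by move=> al _; rewrite mon /f; ring.
rewrite -mulr_sumr normrM normfV normr_id ler_pdivrMl//.
have hr : `|h| <= r1.
  by rewrite (le_trans h2)// mulrC -ler_pdivlMr// (le_trans rho_le).
have vr1 : `|v - v0| <= r1.
  by rewrite (le_trans vr)// (le_trans hr1)// ler_pdivrMr// ler_peMr ?ler1n// ltW.
have := norm_mulmx_le l (H1 v h vr1 hr).
rewrite mulmxBl Fh sub0r mulmx_suml mxE normrN summxE.
rewrite (eq_bigr (fun al => monom (coords h) al * (jet F al v *m l) ord0 ord0)); last first.
  by move=> al _; rewrite -scalemxAl mxE.
move=> /le_trans; apply; rewrite -(ler_pM2l A0).
have hD : `|h| ^+ D.+1 <= 2 ^+ D.+1 * rho ^+ D.+1.
  by rewrite -exprMn lerXn2r ?nnegrE// mulr_ge0// ltW.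
apply: (@le_trans _ _ (c * rho * (`|l| * rho ^+ D))).
  rewrite /c -!mulrA ler_pM2l// ler_wpM2l// ler_wpM2l//.
  rewrite mulrA (le_trans (ler_wpM2r (normr_ge0 _) hD))// (exprS rho) le_eqVlt.
  by apply/orP; left; apply/eqP; ring.
have ct : c * rho <= tau.
  rewrite (@le_trans _ _ ((c + 1) * rho))// ?ler_wpM2r ?(ltW rho_gt0)// ?lerDl//.
  by rewrite mulrC -ler_pdivlMr ?ltr_wpDl// (le_trans rho_le).
rewrite [leRHS]mulrA [leRHS]mulrC; apply: ler_pM => //.
  by apply: mulr_ge0 => //; exact: ltW.
by apply: mulr_ge0 => //; apply: exprn_ge0; exact: ltW.
Qed.

(** * The Riemannian distance *)

(** The speed of a piecewise curve is only known inside the pieces: at a breakpoint the two-sided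
    derivative may fail to exist and takes an uncontrolled value. The endpoints are negligible for
    the integral. *)
Lemma integrable_piece (R : realType) (h hc : R -> R) (a b : R) : a < b ->
  {within `[a, b], continuous hc} -> (forall s, a < s < b -> h s = hc s) ->
  (@lebesgue_measure R).-integrable `[a, b] (EFin \o h) /\
  (\int[lebesgue_measure]_(s in `[a, b]) h s = \int[lebesgue_measure]_(s in `[a, b]) hc s).
Proof.
move=> ab chc hE.
have ihc : (@lebesgue_measure R).-integrable `[a, b] (EFin \o hc).
  by apply: continuous_compact_integrable => //; exact: segment_compact.
have ihoo : (@lebesgue_measure R).-integrable `]a, b[ (EFin \o h).
  have : (@lebesgue_measure R).-integrable `]a, b[ (EFin \o hc).
    by apply: integrableS ihc => //; exact: subset_itv_oo_cc.
  by apply: eq_integrable => // s; rewrite inE/= in_itv/= => /hE ->.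
have mhoo : measurable_fun `]a, b[ h.
  by apply/measurable_EFinP; exact: (measurable_int _ ihoo).
have mh : measurable_fun `[a, b] h by apply: measurable_fun_itv_cc mhoo.
have mhc : measurable_fun `]a, b[ hc.
  apply: (@measurable_funS _ _ _ _ `[a, b]%classic) => //; first exact: subset_itv_oo_cc.
  by apply/measurable_EFinP; exact: (measurable_int _ ihc).
split.
  apply/integrableP; split; first exact/measurable_EFinP.
  rewrite integral_itv_bndoo; last first.
    by apply: measurableT_comp => //; exact/measurable_EFinP.
  by case/integrableP: ihoo.
rewrite /Rintegral (@integral_itv_bndoo _ _ _ (EFin \o h))//; last exact/measurable_EFinP.
rewrite (@integral_itv_bndoo _ _ _ (EFin \o hc))//; last exact/measurable_EFinP.
by congr fine; apply: eq_integral => s; rewrite inE/= in_itv/= => /hE ->.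
Qed.

Lemma integrable_join (R : realType) (h : R -> R) (a b c : R) : a <= b -> b <= c ->
  (@lebesgue_measure R).-integrable `[a, b] (EFin \o h) ->
  (@lebesgue_measure R).-integrable `[b, c] (EFin \o h) ->
  (@lebesgue_measure R).-integrable `[a, c] (EFin \o h) /\
  (\int[lebesgue_measure]_(s in `[a, c]) h s = \int[lebesgue_measure]_(s in `[a, b]) h s +
     \int[lebesgue_measure]_(s in `[b, c]) h s).
Proof.
move=> ab bc iab ibc.
have ibc' : (@lebesgue_measure R).-integrable `]b, c] (EFin \o h).
  by apply: integrableS ibc => //; apply: subset_itvr; rewrite bnd_simp.
have E : `[a, c]%classic = `[a, b]%classic `|` `]b, c]%classic.
  by rewrite -itv_bndbnd_setU// bnd_simp.
have iac : (@lebesgue_measure R).-integrable `[a, c] (EFin \o h).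
  have mh : measurable_fun `[a, c] (EFin \o h).
    rewrite E measurable_funU//; split; [exact: (measurable_int _ iab)|exact: (measurable_int _ ibc')].
  apply/integrableP; split => //.
  rewrite E ge0_integral_setU//=.
  - by apply: lte_add_pinfty; [case/integrableP: iab|case/integrableP: ibc'].
  - rewrite -E; apply/measurable_EFinP; apply: measurableT_comp => //.
    exact/measurable_EFinP.
  - apply/disj_setPS => y [/=]; rewrite 2!in_itv/= => /andP[_ yx] /andP[].
    by rewrite ltNge yx.
split=> //; rewrite -(Rintegral_itv_obnd_cbnd ibc').
rewrite -(Rintegral_itvB iac) ?bnd_simp//.
by rewrite addrC subrK.
Qed.

(** The fundamental theorem of calculus bounds the increment of [f] on each piece, and the pieces
    add up. Nonnegativity of the integral settles the case [n = 0]. *)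
Lemma piecewise_integral_bound (R : realType) (f h : R -> R) (K : R) (n : nat) (t : nat -> R) :
  0 <= K -> (forall i, (i < n)%N -> t i < t i.+1) ->
  (forall i, (i < n)%N -> exists hc fc dfc : R -> R,
    [/\ {within `[t i, t i.+1], continuous hc},
        {within `[t i, t i.+1], continuous dfc},
        forall s, t i < s < t i.+1 -> h s = hc s,
        forall s, t i <= s <= t i.+1 -> f s = fc s /\ is_derive s 1 fc (dfc s)
      & forall s, t i <= s <= t i.+1 -> `|dfc s| <= K * hc s ]) ->
  0 <= \int[lebesgue_measure]_(s in `[t 0%N, t n]) h s ->
  `|f (t n) - f (t 0%N)| <= K * \int[lebesgue_measure]_(s in `[t 0%N, t n]) h s.
Proof.
move=> K0 tS pieces h0.
suff : forall i, (0 < i <= n)%N -> (t 0%N <= t i) /\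
   (@lebesgue_measure R).-integrable `[t 0%N, t i] (EFin \o h) /\
   `|f (t i) - f (t 0%N)| <= K * \int[lebesgue_measure]_(s in `[t 0%N, t i]) h s.
  case: n => [|n] in tS pieces h0 *; first by rewrite subrr normr0 mulr_ge0.
  by move=> /(_ n.+1); rewrite leqnn => /(_ isT)[_ []].
have piece i : (i < n)%N ->
   (@lebesgue_measure R).-integrable `[t i, t i.+1] (EFin \o h) /\
   `|f (t i.+1) - f (t i)| <= K * \int[lebesgue_measure]_(s in `[t i, t i.+1]) h s.
  move=> iN; have [hc [fc [dfc [chc cdfc hhc ffc bnd]]]] := pieces i iN.
  have lt := tS i iN; have [ih ->] := integrable_piece lt chc hhc; split=> //.
  have [-> _] := ffc (t i.+1) (introT andP (conj (ltW lt) (lexx _))).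
  have [-> _] := ffc (t i) (introT andP (conj (lexx _) (ltW lt))).
  have dd s : t i <= s <= t i.+1 -> derivable fc s 1 by move=> /ffc[_ []].
  have cc s : t i <= s <= t i.+1 -> {for s, continuous fc}.
    by move=> /dd /derivable1_diffP /differentiable_continuous.
  have -> : fc (t i.+1) - fc (t i) = \int[lebesgue_measure]_(s in `[t i, t i.+1]) dfc s.
    rewrite /Rintegral (@continuous_FTC2 _ dfc fc)//.
      split.
      - by move=> s; rewrite in_itv/= => /andP[s1 s2]; apply: dd; rewrite !ltW.
      - by apply: cvg_at_right_filter; apply: cc; rewrite lexx ltW.
      - by apply: cvg_at_left_filter; apply: cc; rewrite lexx ltW.
    move=> s; rewrite in_itv/= => /andP[s1 s2]; rewrite derive1E.
    by have [_ []] := ffc s (introT andP (conj (ltW s1) (ltW s2))).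
  have idfc : (@lebesgue_measure R).-integrable `[t i, t i.+1] (EFin \o dfc).
    by apply: continuous_compact_integrable => //; exact: segment_compact.
  have ihc : (@lebesgue_measure R).-integrable `[t i, t i.+1] (EFin \o hc).
    by apply: continuous_compact_integrable => //; exact: segment_compact.
  rewrite (le_trans (le_normr_Rintegral _ idfc))// -RintegralZl//.
  apply: le_Rintegral => //.
  - by apply/integrable_abse: idfc.
  - by apply: (integrableZl _ K) ihc.
elim=> // i IH /= iN; case: i => [|i] in IH iN *.
  by have [h1 h2] := piece 0%N iN; split; [exact: ltW (tS _ iN)|].
have [t0i [ii bi]] := IH (ltnW iN); have [ii' bi'] := piece _ iN.
have lt := ltW (tS _ iN); split; first exact: le_trans lt.
have [iii ->] := integrable_join t0i lt ii ii'; split => //.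
rewrite mulrDr (le_trans (ler_distD (f (t i.+1)) _ _))// addrC.
by rewrite lerD.
Qed.

Lemma cvg_finsum (R : realType) (T : Type) (F : set_system T) {FF : Filter F}
    (I : finType) (f : I -> T -> R) (l : I -> R) :
  (forall i, f i @ F --> l i) -> (fun t => \sum_i f i t) @ F --> \sum_i l i.
Proof.
move=> fl; rewrite (_ : (fun t => _) = \sum_i f i); last first.
  by apply/funext => t; rewrite fct_sumE.
by elim/big_ind2 : _ => // [|f1 l1 f2 l2 h1 h2]; [exact: cvg_cst|exact: cvgD].
Qed.

Lemma cvg_coord (R : realType) (T : Type) (F : set_system T) {FF : Filter F} (m n : nat)
    (f : T -> 'M[R]_(m, n)) (l : 'M[R]_(m, n)) i j :
  f @ F --> l -> (fun t => f t i j) @ F --> l i j.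
Proof.
move=> fl; apply: (@continuous_cvg _ _ _ F FF f (fun M : 'M[R]_(m, n) => M i j) l _ fl).
exact: coord_continuous.
Qed.

Definition qform (R : realType) (d : nat) (g : riemannian_metric R d)
    (x v : 'rV[R]_d.+1) : R := (v *m rm_form g x *m v^T) ord0 ord0.

Definition dotr (R : realType) (n : nat) (x y : 'rV[R]_n) : R :=
  \sum_i x ord0 i * y ord0 i.

Lemma cvg_qform (R : realType) (d : nat) (g : riemannian_metric R d) (T : Type)
    (F : set_system T) {FF : Filter F} (x v : T -> 'rV[R]_d.+1) (x0 v0 : 'rV[R]_d.+1) : x0 != 0 ->
  x @ F --> x0 -> v @ F --> v0 -> (fun t => qform g (x t) (v t)) @ F --> qform g x0 v0.
Proof.
move=> x00 xF vF.
have E (y w : 'rV[R]_d.+1) : qform g y w =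
    \sum_j (\sum_i w ord0 i * rm_form g y i j) * w ord0 j.
  by rewrite /qform mxE; apply: eq_bigr => j _; rewrite !mxE.
rewrite E (_ : (fun t => _) = (fun t => \sum_j
   (\sum_i v t ord0 i * rm_form g (x t) i j) * v t ord0 j)); last first.
  by apply/funext => t; rewrite E.
have GF : (fun t => rm_form g (x t)) @ F --> rm_form g x0.
  apply: (@continuous_cvg _ _ _ F FF x (rm_form g) x0 _ xF).
  by case: (@rm_smooth _ _ g [::] x0 x00).
apply: cvg_finsum => j; apply: cvgM; last exact: cvg_coord.
by apply: cvg_finsum => i; apply: cvgM; exact: cvg_coord.
Qed.

Lemma cvg_dotr (R : realType) (n : nat) (T : Type) (F : set_system T) {FF : Filter F}
    (x y : T -> 'rV[R]_n) (x0 y0 : 'rV[R]_n) :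
  x @ F --> x0 -> y @ F --> y0 -> (fun t => dotr (x t) (y t)) @ F --> dotr x0 y0.
Proof. by move=> xF yF; apply: cvg_finsum => i; apply: cvgM; exact: cvg_coord. Qed.

Section dotr_theory.
Variables (R : realType) (n : nat).
Implicit Types x y : 'rV[R]_n.

Lemma dotrC x y : dotr x y = dotr y x.
Proof. by apply: eq_bigr => i _; rewrite mulrC. Qed.

Lemma dotrDl x y z : dotr (x + y) z = dotr x z + dotr y z.
Proof. by rewrite /dotr -big_split; apply: eq_bigr => i _ /=; rewrite mxE mulrDl. Qed.

Lemma dotrZl a x y : dotr (a *: x) y = a * dotr x y.
Proof. by rewrite /dotr mulr_sumr; apply: eq_bigr => i _; rewrite mxE mulrA. Qed.

Lemma dotr_ge0 x : 0 <= dotr x x.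
Proof. by apply: sumr_ge0 => i _; rewrite -expr2 sqr_ge0. Qed.

Lemma coord2_le_dotr x i : x ord0 i ^+ 2 <= dotr x x.
Proof. by rewrite /dotr (bigD1 i)//= -expr2 lerDl sumr_ge0// => j _; rewrite -expr2 sqr_ge0. Qed.

Lemma dotr_eq0 x : dotr x x = 0 -> x = 0.
Proof.
move=> x0; apply/rowP => i; rewrite mxE; apply/eqP; rewrite -sqrf_eq0 eq_le sqr_ge0 andbT.
by rewrite -x0 coord2_le_dotr.
Qed.

Lemma dotr_gt0 x : x != 0 -> 0 < dotr x x.
Proof. by move=> x0; rewrite lt_neqAle dotr_ge0 andbT eq_sym; apply: contra_neq x0 => /dotr_eq0. Qed.

Lemma coord_le_sqrt_dotr x i : `|x ord0 i| <= Num.sqrt (dotr x x).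
Proof. by rewrite -sqrtr_sqr ler_wsqrtr// coord2_le_dotr. Qed.

End dotr_theory.

Lemma nonexpansive_continuous (R : realType) (V W : normedModType R) (f : V -> W) :
  (forall p q, `|f p - f q| <= `|p - q|) -> continuous f.
Proof.
move=> fl p; apply/cvgrPdist_le => e e0; near=> q.
rewrite (le_trans (fl p q))//; near: q; exact: cvgr_dist_le.
Unshelve. all: by end_near. Qed.

(** Orthonormal pairs form a compact set on which the form is continuous and positive. A pair is
    encoded as one row vector of double length, so that the extreme value theorem for row vectors
    applies. *)
Lemma qform_lower_bound (R : realType) (d : nat) (g : riemannian_metric R d) :
  exists2 kap : R, 0 < kap & forall x v : 'rV[R]_d.+1,
    dotr x x = 1 -> dotr v v = 1 -> dotr x v = 0 -> kap <= qform g x v.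
Proof.
pose n := d.+1.
pose X (p : 'rV[R]_(n + n)) : 'rV[R]_n := lsubmx p.
pose V (p : 'rV[R]_(n + n)) : 'rV[R]_n := rsubmx p.
pose S := [set p | [/\ dotr (X p) (X p) = 1, dotr (V p) (V p) = 1 & dotr (X p) (V p) = 0]].
have cX : continuous X.
  by apply: nonexpansive_continuous => p q; apply: rV_norm_le => // i; rewrite /X -linearB mxE rV_coord_le.
have cV : continuous V.
  by apply: nonexpansive_continuous => p q; apply: rV_norm_le => // i; rewrite /V -linearB mxE rV_coord_le.
have cdot (f h : 'rV[R]_(n + n) -> 'rV[R]_n) : continuous f -> continuous h ->
    continuous (fun p => dotr (f p) (h p)).
  by move=> cf ch p; apply: (@cvg_dotr _ _ _ (nbhs p) (nbhs_filter p)); [exact: cf|exact: ch].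
(* For [d = 0] there is no orthonormal pair and any constant works. *)
have [[p0 Sp0]|S0] := pselect (S !=set0); last first.
  exists 1 => // x v x1 v1 xv; exfalso; apply: S0; exists (row_mx x v).
  by rewrite /S /X /V /= row_mxKl row_mxKr.
have clS : closed S.
  have -> : S = ((fun p => dotr (X p) (X p)) @^-1` [set 1] `&`
     (fun p => dotr (V p) (V p)) @^-1` [set 1]) `&` (fun p => dotr (X p) (V p)) @^-1` [set 0].
    by apply/seteqP; split=> p /=; [case|case=> -[]].
  have cl1 (c : R) : closed [set c] by exact: closed_eq.
  by apply: closedI; [apply: closedI|]; apply: preimage_closed => // p _; apply: cdot.
have boundS : bounded_set S.
  exists 1; split; first exact: num_real.
  move=> r r1 p [x1 v1 _] /=; rewrite (le_trans _ (ltW r1))//.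
  apply: rV_norm_le => // i; case: (splitP i) => j ij.
    have -> : p ord0 i = X p ord0 j by rewrite mxE; congr (p _ _); apply: val_inj.
    by rewrite (le_trans (coord_le_sqrt_dotr _ _))// x1 sqrtr1.
  have -> : p ord0 i = V p ord0 j by rewrite mxE; congr (p _ _); apply: val_inj.
  by rewrite (le_trans (coord_le_sqrt_dotr _ _))// v1 sqrtr1.
have nz (y : 'rV[R]_n) : dotr y y = 1 -> y != 0.
  move=> y1; apply/eqP => y0; move: y1; rewrite y0 /dotr big1 => [/esym/eqP|i _].
    by rewrite oner_eq0.
  by rewrite mxE mul0r.
have cq : {within S, continuous (fun p => qform g (X p) (V p))}.
  apply: continuous_in_subspaceT => p; rewrite inE => -[x1 _ _].
  by apply: (@cvg_qform _ _ g _ (nbhs p) (nbhs_filter p)); [exact: nz|exact: cX|exact: cV].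
have [c] := EVT_min_rV (ex_intro _ p0 Sp0) (bounded_closed_compact boundS clS) cq.
rewrite inE => -[c1 c2 c3] cmin; exists (qform g (X c) (V c)); last first.
  move=> x v x1 v1 xv; have := cmin (row_mx x v); rewrite /X /V row_mxKl row_mxKr; apply.
  by rewrite inE /S /= /X /V row_mxKl row_mxKr.
apply: rm_pos; first exact: nz.
apply/negP => /vlineP[a Va]; move: c3; rewrite Va dotrC dotrZl c1 mulr1 => a0.
by move: (nz _ c2); rewrite Va a0 scale0r eqxx.
Qed.

(* The embedding [x] |-> x^T x / |x|^2 of projective space into the symmetric
   matrices; it has bounded differential, hence bounds the distance below. *)
Definition vero (R : realType) (n : nat) (x : 'rV[R]_n) (i j : 'I_n) : R :=
  x ord0 i * x ord0 j / dotr x x.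

Definition dvero (R : realType) (n : nat) (x v : 'rV[R]_n) (i j : 'I_n) : R :=
  (v ord0 i * x ord0 j + x ord0 i * v ord0 j) / dotr x x -
  x ord0 i * x ord0 j * (2 * dotr x v) / dotr x x ^+ 2.

Lemma qformZ (R : realType) (d : nat) (g : riemannian_metric R d) x v (a : R) :
  qform g x (a *: v) = a ^+ 2 * qform g x v.
Proof. by rewrite /qform -scalemxAl linearZ /= -scalemxAl -scalemxAr !mxE expr2 mulrA. Qed.

Lemma qform_hom (R : realType) (d : nat) (g : riemannian_metric R d) x v (a : R) :
  a != 0 -> x != 0 -> a ^+ 2 * qform g (a *: x) v = qform g x v.
Proof.
move=> a0 x0; rewrite /qform -[in RHS](rm_hom g a0 x0).
by rewrite -scalemxAr -scalemxAl [RHS]mxE.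
Qed.

Lemma qform_vert (R : realType) (d : nat) (g : riemannian_metric R d) x v (a : R) :
  x != 0 -> qform g x (v + a *: x) = qform g x v.
Proof.
move=> x0; have xG := rm_vert g x0.
have Gx : rm_form g x *m x^T = 0.
  by rewrite -[rm_form g x](rm_sym g x0) -trmx_mul xG trmx0.
rewrite /qform mulmxDl -scalemxAl xG scaler0 addr0 linearD /= linearZ /= mulmxDr.
by rewrite -scalemxAr -(mulmxA v _ x^T) Gx mulmx0 scaler0 addr0.
Qed.

(* Both sides only depend on v modulo x, so v may be taken orthogonal to x;
   by homogeneity both vectors may then be normalized. *)
Lemma dvero_le_qform (R : realType) (d : nat) (g : riemannian_metric R d) :
  exists2 K : R, 0 < K & forall (x v : 'rV[R]_d.+1) i j, x != 0 ->
    `|dvero x v i j| <= K * Num.sqrt (qform g x v).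
Proof.
have [kap kap0 hkap] := qform_lower_bound g.
have sk0 : 0 < Num.sqrt kap by rewrite sqrtr_gt0.
exists (2 / Num.sqrt kap); first by rewrite divr_gt0.
move=> x v i j x0; have N0 := dotr_gt0 x0; set N := dotr x x in N0 *.
pose tau := dotr x v / N; pose w := v - tau *: x.
have xw : dotr x w = 0.
  rewrite dotrC /w -scaleNr dotrDl dotrZl -/N dotrC /tau mulNr divfK ?gt_eqF//.
  by rewrite subrr.
have vE : v = w + tau *: x by rewrite /w subrK.
have -> : dvero x v i j = (w ord0 i * x ord0 j + x ord0 i * w ord0 j) / N.
  rewrite /dvero -/N.
  have -> : dotr x v = tau * N by rewrite /tau divfK// gt_eqF.
  have -> : v ord0 i = w ord0 i + tau * x ord0 i by rewrite [in LHS]vE !mxE.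
  have -> : v ord0 j = w ord0 j + tau * x ord0 j by rewrite [in LHS]vE !mxE.
  by field; rewrite gt_eqF.
have -> : qform g x v = qform g x w by rewrite [in LHS]vE qform_vert.
have sN0 : 0 < Num.sqrt N by rewrite sqrtr_gt0.
have [w0|w0] := eqVneq w 0.
  by rewrite w0 !mxE !mul0r mulr0 addr0 mul0r normr0 mulr_ge0 ?sqrtr_ge0 ?divr_ge0.
have W0 := dotr_gt0 w0; set W := dotr w w in W0.
have sW0 : 0 < Num.sqrt W by rewrite sqrtr_gt0.
have sNN : Num.sqrt N ^+ 2 = N by rewrite sqr_sqrtr// ltW.
have sWW : Num.sqrt W ^+ 2 = W by rewrite sqr_sqrtr// ltW.
pose xh := (Num.sqrt N)^-1 *: x; pose wh := (Num.sqrt W)^-1 *: w.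
have key : kap <= qform g xh wh.
  apply: hkap; rewrite /xh /wh dotrZl dotrC dotrZl.
  - by rewrite -/N mulrA -expr2 exprVn sNN mulVf// gt_eqF.
  - by rewrite -/W mulrA -expr2 exprVn sWW mulVf// gt_eqF.
  - by rewrite dotrC xw !mulr0.
have qE : qform g x w = W / N * qform g xh wh.
  rewrite /wh qformZ exprVn sWW -(@qform_hom _ _ g x w (Num.sqrt N)^-1) ?invr_eq0 ?gt_eqF//.
  by rewrite exprVn sNN -/xh; field; rewrite !gt_eqF.
have qle : Num.sqrt kap * (Num.sqrt W / Num.sqrt N) <= Num.sqrt (qform g x w).
  rewrite -sqrtrV ?(ltW N0)// -sqrtrM ?(ltW W0)// -sqrtrM ?(ltW kap0)//.
  by rewrite ler_wsqrtr// qE mulrC ler_wpM2l// divr_ge0 ?(ltW W0) ?(ltW N0).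
rewrite normrM normfV (gtr0_norm N0) ler_pdivrMr//.
apply: (@le_trans _ _ (2 * (Num.sqrt W * Num.sqrt N))).
  rewrite (le_trans (ler_normD _ _))// !normrM mulr2n mulrDl mul1r; apply: lerD.
    by apply: ler_pM => //; exact: coord_le_sqrt_dotr.
  by rewrite mulrC; apply: ler_pM => //; exact: coord_le_sqrt_dotr.
rewrite -!mulrA ler_pM2l// ler_pdivlMl// -[X in _ <= _ * X]sNN.
apply: le_trans (ler_wpM2r (sqr_ge0 _) qle); rewrite le_eqVlt; apply/orP; left.
by apply/eqP; field; rewrite gt_eqF.
Qed.

Lemma cvg_derive_coord (R : realType) (n : nat) (c : R -> 'rV[R]_n) (s : R) i :
  derivable c s 1 -> is_derive s 1 (fun t => c t ord0 i) (derive1 c s ord0 i).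
Proof.
move=> dc; have /derivable_mxP/(_ ord0 i) dci := dc.
by apply: DeriveDef => //; rewrite derive1E derive_mx// mxE.
Qed.

Lemma is_derive_vero (R : realType) (n : nat) (c : R -> 'rV[R]_n) (s : R) i j :
  derivable c s 1 -> c s != 0 ->
  is_derive s 1 (fun t => vero (c t) i j) (dvero (c s) (derive1 c s) i j).
Proof.
move=> dc c0; have N0 := dotr_gt0 c0.
have dci l := cvg_derive_coord l dc.
pose N := \sum_(l < n) ((fun t => c t ord0 l) * (fun t => c t ord0 l)).
have NE t : N t = dotr (c t) (c t) by rewrite /N fct_sumE.
have Ns : N s != 0 by rewrite NE gt_eqF.
rewrite (_ : (fun t => _) = ((fun t => c t ord0 i) * (fun t => c t ord0 j)) * (fun t => (N t)^-1));
  last first.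
  by apply/funext => t; rewrite /vero -NE.
have dN : is_derive s 1 N (2 * dotr (c s) (derive1 c s)).
  apply: is_derive_eq; rewrite /dotr mulr_sumr; apply: eq_bigr => l _.
  by rewrite /GRing.scale /= mulr2n mulrDl mul1r.
have dV : is_derive s 1 (fun t => (N t)^-1) (- (N s) ^- 2 *: (2 * dotr (c s) (derive1 c s))).
  exact: is_deriveV.
apply: is_derive_eq; rewrite /dvero /GRing.scale /= !fctE NE.
by field; rewrite gt_eqF.
Qed.

Definition speed (R : realType) (d : nat) (g : riemannian_metric R d)
    (gam : R -> nzvec R d) (s : R) : R :=
  Num.sqrt (qform g (vec (gam s)) (derive1 (fun s => vec (gam s)) s)).

Lemma curve_lengthE (R : realType) (d : nat) (g : riemannian_metric R d) gam :
  curve_length g gam = \int[lebesgue_measure]_(s in `[0, 1]) speed g gam s.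
Proof. by []. Qed.

Lemma vec_neq0 (R : realType) (d : nat) (x : nzvec R d) : vec x != 0.
Proof. exact: (svalP x). Qed.

Lemma derivable_cvg (R : realType) (n : nat) (c : R -> 'rV[R]_n) (s : R) :
  derivable c s 1 -> c @ s --> c s.
Proof. by move=> /derivable1_diffP /differentiable_continuous. Qed.

Lemma speed_piece (R : realType) (d : nat) (g : riemannian_metric R d)
    (gam : R -> nzvec R d) (c : R -> 'rV[R]_d.+1) (a b : R) :
  (forall s, derivable c s 1) -> continuous (derive1 c) ->
  (forall s, a <= s <= b -> vec (gam s) = c s) ->
  {within `[a, b], continuous (fun s => Num.sqrt (qform g (c s) (derive1 c s)))} /\
  forall s, a < s < b -> speed g gam s = Num.sqrt (qform g (c s) (derive1 c s)).
Proof.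
move=> dc cdc gc; split.
  apply: continuous_in_subspaceT => s; rewrite inE/= in_itv/= => /gc gs.
  have c0 : c s != 0 by rewrite -gs vec_neq0.
  apply: (@continuous_cvg _ _ _ (nbhs s) (nbhs_filter s) _ Num.sqrt).
    exact: sqrt_continuous.
  by apply: (@cvg_qform _ _ g _ (nbhs s) (nbhs_filter s)) => //; [exact: derivable_cvg|exact: cdc].
move=> s /[dup] sab /andP[as_ sb]; have E : vec (gam s) = c s.
  by apply: gc; rewrite (ltW as_) (ltW sb).
rewrite /speed E; congr (Num.sqrt (qform g _ _)); rewrite !derive1E; apply: near_eq_derive.
near=> t; apply: gc; apply/andP; split; apply: ltW; near: t.
  exact: lt_nbhsr.
exact: lt_nbhsl.
Unshelve. all: by end_near. Qed.

Lemma vero_le_curve_length (R : realType) (d : nat) (g : riemannian_metric R d) :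
  exists2 K : R, 0 < K & forall gam i j, piecewise_C1 gam ->
    `|vero (vec (gam 1)) i j - vero (vec (gam 0)) i j| <= K * curve_length g gam.
Proof.
have [K K0 HK] := dvero_le_qform g; exists K => // gam i j [n [t [t0 tn tS pieces]]].
rewrite curve_lengthE -t0 -tn.
apply: (@piecewise_integral_bound _ (fun s => vero (vec (gam s)) i j)) => //.
- exact: ltW.
- move=> l ln; have [c [dc cdc gc]] := pieces l ln.
  have [h1 h2] := speed_piece g dc cdc gc.
  exists (fun s => Num.sqrt (qform g (c s) (derive1 c s))), (fun s => vero (c s) i j),
    (fun s => dvero (c s) (derive1 c s) i j); split => //.
  + apply: continuous_in_subspaceT => s; rewrite inE/= in_itv/= => /gc gs.
    have c0 : c s != 0 by rewrite -gs vec_neq0.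
    have cs := derivable_cvg (dc s).
    have dN : dotr (c s) (c s) != 0 by rewrite gt_eqF// dotr_gt0.
    have FF := nbhs_filter s.
    apply: cvgB; apply: cvgM; rewrite ?expf_neq0//.
    * by apply: cvgD; apply: cvgM; apply: cvg_coord => //; exact: cdc.
    * by apply: cvgV => //; apply: cvg_dotr.
    * apply: cvgM; first by apply: cvgM; exact: cvg_coord.
      by apply: cvgM; [exact: cvg_cst|apply: cvg_dotr => //; exact: cdc].
    * apply: cvgV; rewrite ?expf_neq0//; rewrite expr2.
      by under eq_fun do rewrite expr2; apply: cvgM; exact: cvg_dotr.
  + move=> s /gc gs; rewrite gs; split => //; apply: is_derive_vero => //.
    by rewrite -gs vec_neq0.
  + by move=> s /gc gs; apply: HK; rewrite -gs vec_neq0.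
- by apply: Rintegral_ge0 => s _; exact: sqrtr_ge0.
Qed.

Lemma vero_class (R : realType) (d : nat) (x y : nzvec R d) i j :
  class_pt x = class_pt y -> vero (vec x) i j = vero (vec y) i j.
Proof.
move=> /class_pt_eq[a a0 ->]; rewrite /vero dotrZl dotrC dotrZl !mxE.
have N0 := dotr_gt0 (vec_neq0 x).
by field; rewrite a0 gt_eqF.
Qed.

Lemma vec_inj (R : realType) (d : nat) : injective (@vec R d).
Proof. by move=> x y; exact: val_inj. Qed.

Definition chord (R : realType) (d : nat) (x y : nzvec R d) (s : R) : nzvec R d :=
  match pselect (vec x + s *: (vec y - vec x) != 0) with
  | left h => exist (fun v : 'rV[R]_d.+1 => is_true (v != 0)) _ h
  | right _ => x
  end.

Lemma chordE (R : realType) (d : nat) (x y : nzvec R d) (s : R) :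
  vec x + s *: (vec y - vec x) != 0 ->
  vec (chord x y s) = vec x + s *: (vec y - vec x).
Proof. by rewrite /chord; case: pselect. Qed.

Lemma chord0 (R : realType) (d : nat) (x y : nzvec R d) : chord x y 0 = x.
Proof.
by apply: vec_inj; rewrite chordE scale0r addr0// vec_neq0.
Qed.

Lemma chord1 (R : realType) (d : nat) (x y : nzvec R d) : chord x y 1 = y.
Proof.
by apply: vec_inj; rewrite chordE scale1r subrKC// vec_neq0.
Qed.

Lemma is_derive_affine (R : realType) (n : nat) (x w : 'rV[R]_n) (s : R) :
  is_derive s 1 (fun t : R => x + t *: w) w.
Proof.
have E : (fun h : R => h^-1 *: (x + (h *: 1 + s) *: w - (x + s *: w))) @ 0^' --> w.
  apply: (@cvg_near_cst _ _ w); near=> h.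
  have h0 : h != 0 by near: h; exact: nbhs_dnbhs_neq.
  by rewrite [h *: 1]mulr1 scalerDl opprD addrACA subrr add0r addrK scalerA mulVf// scale1r.
apply: DeriveDef; first by apply/cvg_ex; exists w.
by apply: cvg_lim => //.
Unshelve. all: by end_near. Qed.

Lemma derive1_affine (R : realType) (n : nat) (x w : 'rV[R]_n) :
  derive1 (fun t : R => x + t *: w) = cst w.
Proof. by apply/funext => s; rewrite derive1E; have [_ ->] := is_derive_affine x w s. Qed.

Lemma piecewise_C1_chord (R : realType) (d : nat) (x y : nzvec R d) :
  (forall s : R, 0 <= s <= 1 -> vec x + s *: (vec y - vec x) != 0) ->
  piecewise_C1 (chord x y).
Proof.
move=> nz; exists 1%N, (fun i => i%:R); split => // [i _|i].
  by rewrite ltr_nat.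
rewrite ltnS leqn0 => /eqP ->; exists (fun s => vec x + s *: (vec y - vec x)); split.
- by move=> s; case: (is_derive_affine (vec x) (vec y - vec x) s).
- by rewrite derive1_affine => s; exact: cvg_cst.
- by move=> s s01; rewrite chordE// nz.
Qed.

Definition lengths (R : realType) (d : nat) (g : riemannian_metric R d) (p q : RP R d) :=
  [set l | exists gam : R -> nzvec R d,
    [/\ piecewise_C1 gam, class_pt (gam 0) = p, class_pt (gam 1) = q
      & l = curve_length g gam] ].

Lemma lengths_ge0 (R : realType) (d : nat) (g : riemannian_metric R d) p q :
  lbound (lengths g p q) 0.
Proof.
move=> l [gam [_ _ _ ->]]; rewrite curve_lengthE.
by apply: Rintegral_ge0 => s _; exact: sqrtr_ge0.
Qed.

Lemma riem_dist_ge0 (R : realType) (d : nat) (g : riemannian_metric R d) p q :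
  0 <= riem_dist g p q.
Proof.
rewrite /riem_dist -/(lengths g p q).
have [->|/set0P ne] := eqVneq (lengths g p q) set0; first by rewrite inf0.
exact: lb_le_inf ne (@lengths_ge0 _ _ g p q).
Qed.

(** Since [inf] of the empty set is 0, the bound requires some curve to join distinct points. The
    chord does: it avoids 0 because the two lifts are not proportional. *)
Lemma vero_le_riem_dist (R : realType) (d : nat) (g : riemannian_metric R d) :
  exists2 K : R, 0 < K & forall (x y : nzvec R d) i j,
    `|vero (vec x) i j - vero (vec y) i j| <= K * riem_dist g (class_pt x) (class_pt y).
Proof.
have [K K0 HK] := vero_le_curve_length g; exists K => // x y i j.
have [xy|xy] := eqVneq (class_pt x) (class_pt y).
  by rewrite (vero_class i j xy) subrr normr0 mulr_ge0 ?riem_dist_ge0// ltW.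
rewrite mulrC -ler_pdivrMr//; apply: lb_le_inf.
  exists (curve_length g (chord x y)), (chord x y); split; rewrite ?chord0 ?chord1//.
  apply: piecewise_C1_chord => s /andP[s0 s1]; apply/eqP => E.
  have [s00|s00] := eqVneq s 0.
    by move: E; rewrite s00 scale0r addr0 => /eqP; rewrite (negbTE (vec_neq0 x)).
  have [s11|s11] := eqVneq s 1.
    by move: E; rewrite s11 scale1r subrKC => /eqP; rewrite (negbTE (vec_neq0 y)).
  move: xy => /eqP; apply; apply/class_pt_eq; exists ((s - 1) / s).
    by rewrite mulf_neq0 ?invr_eq0// subr_eq0.
  apply: (scalerI s00); rewrite scalerA mulrCA divff// mulr1 scalerBl scale1r.
  by move: E; rewrite scalerBr => E; rewrite -[RHS]addr0 -E; 
    apply/rowP => l; rewrite !mxE; ring.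
move=> l [gam [pw g0 g1 ->]]; rewrite ler_pdivrMr// mulrC.
by have := HK gam i j pw; rewrite (vero_class i j g0) (vero_class i j g1) distrC.
Qed.

Lemma Rintegral01_le (R : realType) (h : R -> R) (K : R) :
  {within `[0, 1], continuous h} -> (forall s, 0 <= s <= 1 -> h s <= K) ->
  \int[lebesgue_measure]_(s in `[0, 1]) h s <= K.
Proof.
move=> ch hK; apply: (@le_trans _ _ (\int[lebesgue_measure]_(s in `[0, 1]%classic) cst K s)).
  apply: le_Rintegral => //.
  - by apply: continuous_compact_integrable => //; exact: segment_compact.
  - apply: continuous_compact_integrable; first exact: segment_compact.
    by apply: continuous_subspaceT => s; exact: cvg_cst.
rewrite Rintegral_cst//.
have -> : fine (@lebesgue_measure R `[0, 1]%classic) = 1.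
  by rewrite lebesgue_measure_itv /= lte_fin ltr01 oppr0 adde0.
by rewrite mulr1.
Qed.

Lemma qform_le (R : realType) (d : nat) (g : riemannian_metric R d) x v (B : R) :
  `|rm_form g x| <= B -> qform g x v <= d.+1%:R ^+ 2 * B * `|v| ^+ 2.
Proof.
move=> GB; rewrite /qform.
have h1 : `|v *m rm_form g x| <= d.+1%:R * `|v| * B.
  have B0 : 0 <= B by rewrite (le_trans _ GB).
  apply: rV_norm_le => [|i]; first by rewrite !mulr_ge0.
  rewrite mxE (le_trans (ler_norm_sum _ _ _))//.
  have -> : d.+1%:R * `|v| * B = \sum_(i < d.+1) `|v| * B.
    by rewrite sumr_const card_ord -mulrA mulr_natl.
  apply: ler_sum => j _; rewrite normrM; apply: ler_pM => //; first exact: rV_coord_le.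
  apply: le_trans GB; rewrite [leRHS]/Num.norm/= mx_normrE.
  exact: (le_bigmax _ (fun ij => `|rm_form g x ij.1 ij.2|) (j, i)).
rewrite (le_trans (ler_norm _))// (le_trans (norm_mulmx_le _ h1))//.
have vT : `|v^T| <= `|v|.
  rewrite [leLHS]/Num.norm/= mx_normrE; apply: bigmax_le => // -[i j] _ /=.
  by rewrite mxE (ord1 j) rV_coord_le.
have -> : d.+1%:R ^+ 2 * B * `|v| ^+ 2 = d.+1%:R * (d.+1%:R * `|v| * B) * `|v|.
  by ring.
apply: ler_wpM2l vT; apply: mulr_ge0 => //; exact: le_trans (normr_ge0 _) h1.
Qed.

Lemma mul_sqrt_mul (R : realType) (n B w : R) : 0 <= n -> 0 <= B -> 0 <= w ->
  n * Num.sqrt B * w = Num.sqrt (n ^+ 2 * B * w ^+ 2).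
Proof.
move=> n0 B0 w0; rewrite sqrtrM; last by rewrite mulr_ge0 ?sqr_ge0.
by rewrite sqrtrM ?sqr_ge0// !sqrtr_sqr !ger0_norm.
Qed.

Lemma riem_dist_le (R : realType) (d : nat) (g : riemannian_metric R d) (x0 : 'rV[R]_d.+1) :
  x0 != 0 -> exists2 r : R, 0 < r <= 1 & exists2 K : R, 0 < K & forall x y : nzvec R d,
    `|vec x - x0| <= r -> `|vec y - x0| <= r ->
    riem_dist g (class_pt x) (class_pt y) <= K * `|vec x - vec y|.
Proof.
move=> x00; pose B := `|rm_form g x0| + 1.
have B0 : 0 < B by rewrite ltr_wpDl.
have : \forall x \near x0, x != 0 /\ `|rm_form g x| <= B.
  apply: filterI; last first.
    have [/cvgrPdist_le /(_ 1 ltr01) + _] := @rm_smooth _ _ g [::] x0 x00.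
  apply: filterS => v h; rewrite /B -lerBlDl (le_trans _ h)// distrC.
  exact: lerB_dist.
  have : \forall x \near x0, `|x0 - x| < `|x0|.
    by apply: (@cvgr_dist_lt _ _ _ (nbhs x0) (nbhs_filter x0) id); [exact: cvg_id|rewrite normr_gt0].
  by apply: filterS => x h; apply/eqP => xE; move: h; rewrite xE subr0 ltxx.
move=> /near_closed_ball[r r01 hr]; exists r => //.
pose n := d.+1%:R : R; exists (n * Num.sqrt B).
  by rewrite mulr_gt0// sqrtr_gt0.
move=> x y xr yr; pose w := vec y - vec x; pose c := fun s : R => vec x + s *: w.
have c_r (s : R) : 0 <= s <= 1 -> `|c s - x0| <= r.
  move=> /andP[s0 s1]; have -> : c s - x0 = (1 - s) *: (vec x - x0) + s *: (vec y - x0).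
    by apply/rowP => l; rewrite !mxE; ring.
  rewrite (le_trans (ler_normD _ _))// !normrZ !ger0_norm ?subr_ge0//.
  rewrite (@le_trans _ _ ((1 - s) * r + s * r))//; last by rewrite -mulrDl subrK mul1r.
  by rewrite lerD// ler_wpM2l// subr_ge0.
have pw : piecewise_C1 (chord x y).
  by apply: piecewise_C1_chord => s /c_r/hr[].
apply: (@le_trans _ _ (curve_length g (chord x y))).
  apply: ge_inf; first by exists 0; exact: lengths_ge0.
  by exists (chord x y); rewrite chord0 chord1.
have dc s : derivable c s 1 by case: (is_derive_affine (vec x) w s).
have cdc : continuous (derive1 c) by rewrite derive1_affine => s; exact: cvg_cst.
have gc (s : R) : 0 <= s <= 1 -> vec (chord x y s) = c s.
  by move=> /c_r/hr[h _]; rewrite chordE.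
have [h1 h2] := speed_piece g dc cdc gc.
have [i1 i2] := integrable_piece ltr01 h1 h2.
rewrite curve_lengthE i2.
apply: Rintegral01_le h1 _ => s s01.
have -> : derive1 c s = w by rewrite derive1_affine.
have [_ hB] := hr _ (c_r s s01).
by clear h2 i1 i2; rewrite distrC -/w mul_sqrt_mul ?ler_wsqrtr ?(ltW B0) ?qform_le.
Qed.

(** * Distances in charts *)

Lemma norm_vero_le1 (R : realType) (n : nat) (x : 'rV[R]_n) i j : `|vero x i j| <= 1.
Proof.
have [->|x0] := eqVneq x 0.
  by rewrite /vero !mxE mul0r mul0r normr0.
have N0 := dotr_gt0 x0; rewrite /vero normrM normfV (gtr0_norm N0) ler_pdivrMr// mul1r.
rewrite normrM -[leRHS]sqr_sqrtr ?dotr_ge0// expr2.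
by apply: ler_pM => //; exact: coord_le_sqrt_dotr.
Qed.

Lemma dotr_le (R : realType) (n : nat) (x : 'rV[R]_n) : dotr x x <= n%:R * `|x| ^+ 2.
Proof.
have -> : n%:R * `|x| ^+ 2 = \sum_(i < n) `|x| ^+ 2.
  by rewrite sumr_const card_ord mulr_natl.
apply: ler_sum => i _; rewrite -expr2 -real_normK ?num_real//.
by rewrite lerXn2r ?nnegrE// rV_coord_le.
Qed.

(** The quantity estimated is the numerator [b * a' - b' * a] of the difference of the quotients
    [b / a] and [b' / a']. *)
Lemma norm_cross_le (R : realType) (a a' b b' t : R) :
  `|a'| <= 1 -> `|b'| <= 1 -> `|a - a'| <= t -> `|b - b'| <= t ->
  `|(b - b') * a' - b' * (a - a')| <= t + t.
Proof.
move=> a1 b1 at_ bt; rewrite (le_trans (ler_normB _ _))// !normrM; apply: lerD.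
  by rewrite -[leRHS]mulr1; apply: ler_pM.
by rewrite -[leRHS]mul1r; apply: ler_pM.
Qed.

(** Close points have close [vero] matrices. The entry [(i0, i0)] is at least [al] for [y], hence at
    least [al / 2] for [x] when the distance is at most [al / (2 * K)]; so [x] can be rescaled to
    agree with [y] in coordinate [i0]. The ratios [x_j / x_i0] are quotients of entries of [vero],
    which controls the other coordinates. *)
Lemma riem_dist_near_rep (R : realType) (d : nat) (g : riemannian_metric R d)
    (x0 : 'rV[R]_d.+1) : x0 != 0 ->
  exists2 i0, x0 ord0 i0 != 0 & exists r eta C : R, [/\ 0 < r, 0 < eta, 0 < C &
    forall x y : nzvec R d, `|vec y - x0| <= r ->
      riem_dist g (class_pt x) (class_pt y) <= eta ->
      vec x ord0 i0 != 0 /\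
      `|(vec y ord0 i0 / vec x ord0 i0) *: vec x - vec y|
        <= C * riem_dist g (class_pt x) (class_pt y)].
Proof.
move=> x00; have [i0 xi0] : exists i0, x0 ord0 i0 != 0.
  by have /rV0Pn[i] := x00; exists i.
exists i0 => //; have [K K0 HK] := vero_le_riem_dist g.
pose dl := `|x0 ord0 i0| / 2; have dl0 : 0 < dl by rewrite divr_gt0// normr_gt0.
pose B := `|x0| + dl; have B0 : 0 < B by rewrite ltr_wpDl.
pose al := dl ^+ 2 / (d.+1%:R * B ^+ 2).
have al0 : 0 < al.
  by apply: divr_gt0; [exact: exprn_gt0|apply: mulr_gt0 => //; exact: exprn_gt0].
pose E := 2 * K / (al * (al / 2)).
have E0 : 0 < E.
  by apply: divr_gt0; [exact: mulr_gt0|apply: mulr_gt0 => //; exact: divr_gt0].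
exists dl, (al / (2 * K)), (B * E); split.
- by [].
- by rewrite divr_gt0// mulr_gt0.
- exact: mulr_gt0.
move=> x y yx0; set D := riem_dist _ _ _ => hD.
have yB : `|vec y| <= B.
  by rewrite -[vec y](subrK x0) addrC (le_trans (ler_normD _ _))// lerD2l.
have ydl : dl <= `|vec y ord0 i0|.
  have := le_trans (rV_coord_le (vec y - x0) i0) yx0.
  rewrite !mxE distrC => h; have := le_trans (lerB_dist _ _) h.
  by rewrite lerBlDl -lerBlDr /dl; lra.
have yN : 0 < dotr (vec y) (vec y) by rewrite dotr_gt0// vec_neq0.
have xN : 0 < dotr (vec x) (vec x) by rewrite dotr_gt0// vec_neq0.
have ay : al <= vero (vec y) i0 i0.
  rewrite /vero /al; apply: ler_pM; rewrite ?sqr_ge0 ?invr_ge0 ?mulr_ge0 ?sqr_ge0 ?(ltW B0)//.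
    by rewrite -expr2 -[leRHS]real_normK ?num_real// lerXn2r ?nnegrE// ltW.
  rewrite lef_pV2 ?posrE ?mulr_gt0 ?exprn_gt0//.
  by rewrite (le_trans (dotr_le _))// ler_wpM2l// lerXn2r ?nnegrE ?(ltW B0).
have hd i j : `|vero (vec x) i j - vero (vec y) i j| <= K * D by exact: HK.
have KD : K * D <= al / 2.
  move: hD; rewrite ler_pdivlMr ?mulr_gt0// => h; lra.
have ax : al / 2 <= vero (vec x) i0 i0.
  have := le_trans (hd i0 i0) KD; rewrite ler_norml => /andP[+ _]; lra.
have xi : vec x ord0 i0 != 0.
  apply/eqP => xi; move: ax; rewrite /vero xi mul0r mul0r; lra.
split => //; have yi : vec y ord0 i0 != 0.
  by rewrite -normr_gt0 (lt_le_trans dl0).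
have D0 : 0 <= D by exact: riem_dist_ge0.
apply: rV_norm_le => [|j].
  by apply: mulr_ge0 => //; apply: ltW; exact: mulr_gt0.
rewrite !mxE; set a := vero (vec x) i0 i0 in ax; set a' := vero (vec y) i0 i0 in ay.
pose b := vero (vec x) i0 j; pose b' := vero (vec y) i0 j.
have a0 : 0 < a by rewrite (lt_le_trans _ ax)// divr_gt0.
have a'0 : 0 < a' by rewrite (lt_le_trans _ ay).
have -> : vec y ord0 i0 / vec x ord0 i0 * vec x ord0 j - vec y ord0 j =
    vec y ord0 i0 * (((b - b') * a' - b' * (a - a')) / (a' * a)).
  rewrite /a /a' /b /b' /vero; field.
  by rewrite xi yi !gt_eqF.
rewrite normrM -(mulrA B); apply: ler_pM => //.
  by rewrite (le_trans (rV_coord_le _ _)).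
have aa0 : 0 < a' * a by exact: mulr_gt0.
rewrite normrM normfV (gtr0_norm aa0) ler_pdivrMr//.
have h1 : `|(b - b') * a' - b' * (a - a')| <= K * D + K * D.
  by apply: norm_cross_le; [exact: norm_vero_le1|exact: norm_vero_le1|exact: hd|exact: hd].
apply: (le_trans h1); have al2 : 0 < al * (al / 2) by apply: mulr_gt0 => //; exact: divr_gt0.
have -> : K * D + K * D = E * D * (al * (al / 2)).
  by rewrite /E; field; rewrite gt_eqF.
apply: ler_wpM2l; first by apply: mulr_ge0 => //; exact: ltW.
by apply: ler_pM => //; apply: ltW => //; exact: divr_gt0.
Qed.

Lemma line_increment (R : realType) (k p : nat) (F : 'rV[R]_k -> 'rV[R]_p)
    (v e : 'rV[R]_k) (c : 'rV[R]_p) (eps t : R) :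
  (forall x : R, `|x| <= `|t| -> derivable F (v + x *: e) e /\
     `|'D_e F (v + x *: e) - c| <= eps) ->
  `|F (v + t *: e) - F v - t *: c| <= eps * `|t|.
Proof.
move=> H; have eps0 : 0 <= eps by have [_ /(le_trans _)] := H t (lexx _); apply.
apply: rV_norm_le => [|j]; first by rewrite mulr_ge0.
pose h (x : R) := F (v + x *: e) ord0 j - x * c ord0 j.
pose dh (x : R) := 'D_e F (v + x *: e) ord0 j - c ord0 j.
have hd (x : R) : `|x| <= `|t| -> is_derive x 1 h (dh x).
  move=> /H[dF _]; apply: is_deriveB; first exact: is_derive_line.
  have -> : (fun x : R => x * c ord0 j) = c ord0 j \*: id.
    by apply/funext => y /=; rewrite mulrC.
  by apply: is_derive_eq; rewrite /GRing.scale /= mulr1.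
have [x xt E] := mean_value_between hd (lexx _).
have -> : (F (v + t *: e) - F v - t *: c) ord0 j = h t - h 0.
  by rewrite /h scale0r addr0 mul0r subr0 !mxE addrAC.
rewrite E normrM ler_wpM2r//; have [_ hx] := H x xt.
by rewrite (le_trans _ hx)// (le_trans _ (rV_coord_le _ j))// !mxE.
Qed.

Definition truncate (R : realType) (k m : nat) (h : 'rV[R]_k) : 'rV[R]_k :=
  \row_(i < k) (if (i < m)%N then h ord0 i else 0).

(** Both endpoints vary, while the derivative stays frozen at [v0]. The increment is made one
    coordinate at a time through the points [v + truncate m h], each step using that the partial
    derivatives are close to their values at [v0]. *)
Lemma strict_differentiability (R : realType) (k p : nat) (F : 'rV[R]_k -> 'rV[R]_p)
    (U : set 'rV[R]_k) (v0 : 'rV[R]_k) (eps : R) :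
  open U -> U v0 -> smooth_on U F -> 0 < eps ->
  exists2 r : R, 0 < r <= 1 & forall v h : 'rV[R]_k, `|v - v0| <= r -> `|h| <= r ->
    `|F (v + h) - F v - \sum_i h ord0 i *: 'D_(ebasis R i) F v0| <= eps * `|h|.
Proof.
move=> oU Uv0 sF eps0; pose e' := eps / k.+1%:R.
have e'0 : 0 < e' by rewrite divr_gt0.
have : \forall v \near v0, U v /\ forall i, `|'D_(ebasis R i) F v - 'D_(ebasis R i) F v0| <= e'.
  apply: filterI; first exact: open_nbhs_nbhs.
  apply: (@filter_forall _ _ (fun i v => `|'D_(ebasis R i) F v - 'D_(ebasis R i) F v0| <= e')
    (nbhs v0) (nbhs_filter v0)) => i.
  have [/cvgrPdist_le /(_ e' e'0) + _] := sF [:: i] v0 Uv0.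
  by apply: filterS => v h; rewrite distrC; exact: h.
move=> /near_closed_ball[r1 /andP[r10 r11] hr]; exists (r1 / 3).
  by rewrite divr_gt0//= ler_pdivrMr// mul1r (le_trans r11)// ler1n.
move=> v h vr hr3.
have trunc_le m : `|truncate m h| <= `|h|.
  by apply: rV_norm_le => // i; rewrite mxE; case: ifP; rewrite ?normr0// rV_coord_le.
have step m : (m <= k)%N -> `|F (v + truncate m h) - F v -
    \sum_(i < k | (i < m)%N) h ord0 i *: 'D_(ebasis R i) F v0| <= m%:R * (e' * `|h|).
  elim: m => [|m IH] mk.
    rewrite big1 ?subr0 ?mul0r; last by [].
    have -> : truncate 0 h = 0 by apply/rowP => i; rewrite !mxE.
    by rewrite addr0 subrr normr0.
  pose im := Ordinal mk.
  have tS : truncate m.+1 h = truncate m h + h ord0 im *: ebasis R im.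
    apply/rowP => i; rewrite !mxE eqxx /=.
    have [->|ne] := eqVneq i im; first by rewrite ltnSn ltnn add0r mulr1.
    have {}ne : (i == m :> nat) = false by apply: contra_neqF ne => /eqP h1; exact: val_inj.
    by rewrite mulr0 addr0 ltnS leq_eqVlt ne.
  rewrite (bigD1 im) ?ltnSn//= (eq_bigl (fun i : 'I_k => (i < m)%N)); last first.
    move=> i; rewrite ltnS leq_eqVlt -(inj_eq val_inj) /=.
    by have [->|_] := eqVneq (val i) m; rewrite ?ltnn ?andbT ?andbF.
  set S := \sum_(i < k | _) _; set t := h ord0 im.
  have -> : F (v + truncate m.+1 h) - F v - (t *: 'D_(ebasis R im) F v0 + S) =
    (F (v + truncate m h + t *: ebasis R im) - F (v + truncate m h) - t *: 'D_(ebasis R im) F v0) +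
    (F (v + truncate m h) - F v - S).
    by rewrite tS addrA; apply/rowP => j; rewrite !mxE; ring.
  rewrite (le_trans (ler_normD _ _))// -natr1 mulrDl mul1r addrC.
  apply: lerD; first exact: IH (ltnW mk).
  have th : `|t| <= `|h| by exact: rV_coord_le.
  apply: (@le_trans _ _ (e' * `|t|)); last by rewrite ler_wpM2l// ltW.
  apply: line_increment => x xt; have [|Ux hx] := hr (v + truncate m h + x *: ebasis R im).
    have -> : v + truncate m h + x *: ebasis R im - v0 = (v - v0) + truncate m h + x *: ebasis R im.
      by apply/rowP => j; rewrite !mxE; ring.
    have -> : r1 = r1 / 3 + r1 / 3 + r1 / 3 by field.
    rewrite (le_trans (ler_normD _ _))// lerD//.
      by rewrite (le_trans (ler_normD _ _))// lerD// (le_trans (trunc_le _)).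
    apply: rV_norm_le => [|i]; first by rewrite ltW// divr_gt0.
    rewrite !mxE eqxx /=; case: eqP => _; rewrite ?mulr1 ?mulr0 ?normr0.
      by rewrite (le_trans xt)// (le_trans th).
    by rewrite ltW// divr_gt0.
  by split; [case: (sF [::] _ Ux)|exact: hx].
have := step k (leqnn k).
have -> : truncate k h = h by apply/rowP => i; rewrite mxE ltn_ord.
rewrite (eq_bigl xpredT); last by move=> i; rewrite ltn_ord.
move=> /le_trans; apply; rewrite mulrA ler_wpM2r// /e' mulrCA ler_piMr ?(ltW eps0)//.
by rewrite ler_pdivrMr// mul1r ler_nat.
Qed.

Lemma lipschitz_near (R : realType) (k p : nat) (F : 'rV[R]_k -> 'rV[R]_p)
    (U : set 'rV[R]_k) (v0 : 'rV[R]_k) :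
  open U -> U v0 -> smooth_on U F ->
  exists2 r : R, 0 < r <= 1 & exists2 L : R, 0 < L & forall v w : 'rV[R]_k,
    `|v - v0| <= r -> `|w - v0| <= r -> `|F v - F w| <= L * `|v - w|.
Proof.
move=> oU Uv0 sF; have [r /andP[r0 r1] H] := strict_differentiability oU Uv0 sF ltr01.
exists (r / 2); first by rewrite divr_gt0//= ler_pdivrMr// mul1r (le_trans r1)// ler1n.
pose L := \sum_i `|'D_(ebasis R i) F v0|.
exists (L + 1); first by rewrite ltr_wpDl// sumr_ge0.
move=> v w vr wr; have vw : `|v - w| <= r.
  have -> : v - w = (v - v0) - (w - v0) by rewrite opprB addrA subrK.
  by rewrite (le_trans (ler_normB _ _))// (splitr r) lerD.
have := H w (v - w); rewrite subrKC mul1r => /(_ _ vw) hw.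
have {}hw := hw (le_trans wr (ler_piMr (ltW r0) _)).
set S := \sum_i _ in hw; rewrite -[F v - F w](subrK S) (le_trans (ler_normD _ _))//.
rewrite mulrDl mul1r addrC lerD//; last by apply: hw; rewrite invf_le1// ler1n.
rewrite /S (le_trans (ler_norm_sum _ _ _))// mulr_suml; apply: ler_sum => i _.
by rewrite normrZ mulrC ler_wpM2l// rV_coord_le.
Qed.

(* The coordinates of the bivector of x and z that involve i0: if x_i0 <> 0, they
   vanish only for z parallel to x. *)
Definition wedge (R : realType) (n : nat) (i0 : 'I_n) (x z : 'rV[R]_n) : 'rV[R]_n :=
  z ord0 i0 *: x - x ord0 i0 *: z.

Lemma norm_wedge_le (R : realType) (n : nat) (i0 : 'I_n) (x z : 'rV[R]_n) :
  `|wedge i0 x z| <= 2 * `|x| * `|z|.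
Proof.
rewrite (le_trans (ler_normB _ _))// !normrZ -mulrA mulr2n mulrDl mul1r.
by apply: lerD; [rewrite mulrC; apply: ler_pM|apply: ler_pM]; rewrite ?rV_coord_le.
Qed.

Lemma wedgeDl (R : realType) (n : nat) (i0 : 'I_n) (x y z : 'rV[R]_n) :
  wedge i0 (x + y) z = wedge i0 x z + wedge i0 y z.
Proof. by apply/rowP => j; rewrite !mxE; ring. Qed.

Lemma wedgeDr (R : realType) (n : nat) (i0 : 'I_n) (x y z : 'rV[R]_n) :
  wedge i0 x (y + z) = wedge i0 x y + wedge i0 x z.
Proof. by apply/rowP => j; rewrite !mxE; ring. Qed.

Lemma norm_rV_mulmx_le (R : realType) (m n : nat) (w : 'rV[R]_m) (B : 'M[R]_(m, n)) :
  `|w *m B| <= m%:R * `|B| * `|w|.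
Proof.
apply: rV_norm_le => [|j]; first by rewrite !mulr_ge0.
rewrite mxE (le_trans (ler_norm_sum _ _ _))//.
have -> : m%:R * `|B| * `|w| = \sum_(i < m) `|B| * `|w|.
  by rewrite sumr_const card_ord -mulrA mulr_natl.
apply: ler_sum => i _; rewrite normrM mulrC; apply: ler_pM => //.
  rewrite [leRHS]/Num.norm/= mx_normrE.
  exact: (le_bigmax _ (fun ij => `|B ij.1 ij.2|) (i, j)).
exact: rV_coord_le.
Qed.

Lemma class_pt_surj (R : realType) (d : nat) (p : RP R d) :
  exists x : nzvec R d, class_pt x = p.
Proof. by exists (repr (p : {eq_quot (@proportional R d)}%qT)); rewrite /class_pt reprK. Qed.

Section chart.
Variables (R : realType) (d k : nat) (g : riemannian_metric R d) (M : set (RP R d)).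
Variables (U : set 'rV[R]_k) (Phi : 'rV[R]_k -> nzvec R d) (v0 : 'rV[R]_k).
Hypotheses (lift : coordinate_lift M U Phi) (Uv0 : U v0).
Let F := @vec R d \o Phi.
Let oU : open U. Proof. by case: lift. Qed.
Let sF : smooth_on U F. Proof. by case: lift. Qed.
Let Fv0 : F v0 != 0. Proof. exact: vec_neq0. Qed.

Lemma chart_dist_le : exists2 r : R, 0 < r <= 1 & exists2 C : R, 0 < C &
  forall v w, `|v - v0| <= r -> `|w - v0| <= r ->
    riem_dist g (class_pt (Phi v)) (class_pt (Phi w)) <= C * `|v - w|.
Proof.
have [r1 /andP[r10 r11] [L L0 HL]] := lipschitz_near oU Uv0 sF.
have [r2 /andP[r20 r21] [K K0 HK]] := riem_dist_le g Fv0.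
exists (Num.min r1 (r2 / L)); first by rewrite lt_min r10 divr_gt0//= ge_min r11.
exists (K * L); first exact: mulr_gt0.
have near_F v : `|v - v0| <= Num.min r1 (r2 / L) -> `|v - v0| <= r1 /\ `|F v - F v0| <= r2.
  rewrite le_min => /andP[h1 h2]; split => //.
  rewrite (le_trans (HL v v0 h1 _))//; first by rewrite subrr normr0 ltW.
  by rewrite mulrC -ler_pdivlMr.
move=> v w /near_F[v1 v2] /near_F[w1 w2].
rewrite (le_trans (HK (Phi v) (Phi w) v2 w2))// -mulrA ler_pM2l//.
exact: HL.
Qed.

(** Smoothness is stated through partial derivatives and the immersion condition through directional
    ones; strict differentiability connects the two. *)
Lemma derive_dir (w : 'rV[R]_k) :
  'D_w F v0 = \sum_i w ord0 i *: 'D_(ebasis R i) F v0.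
Proof.
set T := \sum_i _; have cv : (fun t : R => t^-1 *: (F (t *: w + v0) - F v0)) @ 0^' --> T.
  apply/cvgrPdist_le => e e0; pose e' := e / (`|w| + 1).
  have w1 : 0 < `|w| + 1 by rewrite ltr_wpDl.
  have e'0 : 0 < e' by rewrite divr_gt0.
  have [r /andP[r0 r1] H] := strict_differentiability oU Uv0 sF e'0.
  near=> t; have t0 : t != 0 by near: t; exact: nbhs_dnbhs_neq.
  have tr : `|t| <= r / (`|w| + 1).
    by near: t; apply: dnbhs0_le; rewrite divr_gt0.
  have h1 := H v0 (t *: w).
  rewrite subrr normr0 normrZ in h1; have := h1 (ltW r0).
  have tw : `|t| * `|w| <= r.
    rewrite (@le_trans _ _ (`|t| * (`|w| + 1)))//; first by rewrite ler_wpM2l// lerDl.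
    by rewrite -ler_pdivlMr.
  move=> /(_ tw).
  have -> : \sum_i (t *: w) ord0 i *: 'D_(ebasis R i) F v0 = t *: T.
    by rewrite /T scaler_sumr; apply: eq_bigr => i _; rewrite mxE scalerA.
  rewrite [v0 + _]addrC => h2.
  have -> : T - t^-1 *: (F (t *: w + v0) - F v0) =
     - (t^-1 *: (F (t *: w + v0) - F v0 - t *: T)).
    by rewrite [in RHS]scalerBr scalerA mulVf// scale1r opprB.
  rewrite normrN normrZ normfV ler_pdivrMl ?normr_gt0// (le_trans h2)//.
  rewrite mulrCA ler_wpM2l// /e' mulrAC ler_pdivrMr// ler_wpM2l ?(ltW e0)// lerDl//.
exact: cvg_lim cv.
Unshelve. all: by end_near. Qed.

(** As [F v0] has nonzero coordinate [i0], its wedge with [z] vanishes only for [z] on the line of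
    [F v0]. The immersion condition thus makes the linear map with matrix [T] injective, and a right
    inverse of [T] bounds [w]. *)
Lemma immersion_wedge i0 : F v0 ord0 i0 != 0 ->
  exists2 A : R, 0 < A & forall w : 'rV[R]_k,
    `|w| <= A * `|wedge i0 (F v0) (\sum_i w ord0 i *: 'D_(ebasis R i) F v0)|.
Proof.
move=> Fi0; pose c i := 'D_(ebasis R i) F v0.
pose T : 'M[R]_(k, d.+1) := \matrix_(i, j) wedge i0 (F v0) (c i) ord0 j.
have wT (w : 'rV[R]_k) : w *m T = wedge i0 (F v0) (\sum_i w ord0 i *: c i).
  apply/rowP => j; rewrite mxE.
  rewrite [wedge _ _ _]/wedge !mxE !summxE mulr_suml mulr_sumr -sumrB.
  by apply: eq_bigr => i _; rewrite !mxE; ring.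
have /row_freeP[B TB] : row_free T.
  apply: inj_row_free => w; rewrite wT => w0.
  case: lift => _ _ /(_ v0 w Uv0) + _ _; apply.
  rewrite -/F derive_dir -/c; set z := \sum_i _ in w0 *; apply/vlineP.
  exists (z ord0 i0 / F v0 ord0 i0); apply: (scalerI Fi0).
  rewrite scalerA mulrCA divff// mulr1; apply/esym/eqP.
  by rewrite -subr_eq0; apply/eqP.
exists (d.+1%:R * `|B| + 1); first by rewrite ltr_wpDl// mulr_ge0.
move=> w; rewrite -{1}[w]mulmx1 -TB mulmxA (le_trans (norm_rV_mulmx_le _ _))//.
by rewrite wT ler_wpM2r// lerDl.
Qed.

(** The wedge of [F v] with [F w - F v] is small when the points are close in the metric, since up
    to a factor it is the difference of matched representatives. It also approximates the wedge of
    [F v0] with the linear part, which bounds [w - v]. *)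
Lemma chart_dist_ge : exists2 r : R, 0 < r <= 1 & exists2 C : R, 0 < C &
  forall v w, `|v - v0| <= r -> `|w - v0| <= r ->
    `|v - w| <= C * riem_dist g (class_pt (Phi v)) (class_pt (Phi w)).
Proof.
have [i0 Fi0 [rx [eta [C [rx0 eta0 C0 near_rep]]]]] := riem_dist_near_rep g Fv0.
have [A A0 HA] := immersion_wedge Fi0.
pose c i := 'D_(ebasis R i) F v0.
pose Cc := \sum_i `|c i| + 1.
have Cc0 : 0 < Cc by rewrite ltr_wpDl// sumr_ge0.
pose B0 := `|F v0| + 1; have B00 : 0 < B0 by rewrite ltr_wpDl.
(* [eps] and [dl] make the two errors, from linearization and from replacing [F v] by [F v0], at
   most [|h| / 4] each, so that half of [|h|] survives. *)
pose eps := (8 * A * B0)^-1; have eps0 : 0 < eps by rewrite invr_gt0 !mulr_gt0.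
pose dl := Num.min 1 (Num.min rx (8 * A * Cc)^-1).
have dl0 : 0 < dl by rewrite !lt_min ltr01 rx0 invr_gt0 !mulr_gt0.
have [r1 /andP[r10 r11] H1] := strict_differentiability oU Uv0 sF eps0.
have [r2 /andP[r20 r21] [L L0 HL]] := lipschitz_near oU Uv0 sF.
pose r := Num.min (r1 / 2) (Num.min r2 (dl / L)).
have r0 : 0 < r by rewrite !lt_min r20 !divr_gt0.
have rr1 : r <= r1 / 2 by rewrite ge_min lexx.
have rr2 : r <= r2 by rewrite !ge_min lexx orbT.
have rr3 : r <= dl / L by rewrite !ge_min lexx !orbT.
exists r; first by rewrite r0 (le_trans rr2).
exists (Num.max (2 * (A * (B0 * C))) (2 / eta)).
  by rewrite lt_max; apply/orP; right; exact: divr_gt0.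
have near_F v : `|v - v0| <= r -> `|F v - F v0| <= dl.
  move=> vr; rewrite (le_trans (HL v v0 (le_trans vr rr2) _))//.
    by rewrite subrr normr0 ltW.
  by rewrite mulrC -ler_pdivlMr// (le_trans vr).
move=> v w vr wr; set D := riem_dist _ _ _; have D0 : 0 <= D by exact: riem_dist_ge0.
(* Beyond [eta] the bound is trivial, as [v] and [w] are at distance at most 2. *)
have [Deta|etaD] := leP D eta; last first.
  rewrite (@le_trans _ _ (2 / eta * D))//; last by rewrite ler_wpM2r// le_max lexx orbT.
  rewrite mulrAC ler_pdivlMr//.
  have -> : v - w = (v - v0) - (w - v0) by rewrite opprB addrA subrK.
  have vw2 : `|v - v0 - (w - v0)| <= 2.
    rewrite (le_trans (ler_normB _ _))// mulr2n lerD//.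
      by rewrite (le_trans vr)// (le_trans rr2).
    by rewrite (le_trans wr)// (le_trans rr2).
  by apply: ler_pM => //; exact: ltW.
rewrite (@le_trans _ _ (2 * (A * (B0 * C)) * D))//; last by rewrite ler_wpM2r// le_max lexx.
have dl_rx : dl <= rx by rewrite !ge_min lexx orbT.
have dl1 : dl <= 1 by rewrite ge_min lexx.
have dlC : dl <= (8 * A * Cc)^-1 by rewrite !ge_min lexx !orbT.
have Fw := near_F w wr; have Fv := near_F v vr.
have [xi hx] := near_rep (Phi v) (Phi w) (le_trans Fw dl_rx) Deta.
have FvB : `|F v| <= B0.
  by rewrite -[F v](subrK (F v0)) addrC (le_trans (ler_normD _ _))// lerD2l (le_trans Fv).
pose h := w - v; have hh : `|v - w| = `|h| by rewrite distrC.
have hr : `|h| <= r1.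
  have -> : h = (w - v0) - (v - v0) by rewrite /h opprB addrA subrK.
  by rewrite (le_trans (ler_normB _ _))// (splitr r1) lerD// ?(le_trans wr)// (le_trans vr).
have vr1 : `|v - v0| <= r1.
  by rewrite (le_trans vr)// (le_trans rr1)// ler_pdivrMr// ler_peMr ?ler1n// ltW.
pose S := \sum_i h ord0 i *: c i; pose e := F w - F v - S.
have he : `|e| <= eps * `|h| by have := H1 v h vr1 hr; rewrite /h subrKC.
have hS : `|S| <= Cc * `|h|.
  rewrite (le_trans (ler_norm_sum _ _ _))// /Cc mulrDl mul1r -[leLHS]addr0 lerD//.
  by rewrite mulr_suml; apply: ler_sum => i _; rewrite normrZ mulrC ler_wpM2l// rV_coord_le.
have wzE : wedge i0 (F v) (F w - F v) = wedge i0 (F v0) S + wedge i0 (F v - F v0) S + wedge i0 (F v) e.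
  rewrite -wedgeDl subrKC -wedgeDr; congr wedge.
  by rewrite /e subrKC.
have wz : `|wedge i0 (F v) (F w - F v)| <= B0 * (C * D).
  have -> : wedge i0 (F v) (F w - F v) =
      F v ord0 i0 *: ((F w ord0 i0 / F v ord0 i0) *: F v - F w).
    apply/rowP => j; rewrite !mxE; field; exact: xi.
  rewrite normrZ; apply: ler_pM => //; first exact: le_trans (rV_coord_le _ _) FvB.
have := HA h; rewrite -/c -/S.
have -> : wedge i0 (F v0) S = wedge i0 (F v) (F w - F v) - wedge i0 (F v - F v0) S - wedge i0 (F v) e.
  by rewrite wzE [RHS]addrAC !addrK.
move=> h1; have {}h1 : `|h| <= A * (B0 * (C * D) + 2 * dl * (Cc * `|h|) + 2 * B0 * (eps * `|h|)).
  apply: (le_trans h1); rewrite ler_wpM2l ?(ltW A0)// (le_trans (ler_normB _ _))// lerD//.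
    rewrite (le_trans (ler_normB _ _))// lerD// (le_trans (norm_wedge_le _ _ _))//.
    by apply: ler_pM => //; rewrite ?mulr_ge0// ler_wpM2l.
  rewrite (le_trans (norm_wedge_le _ _ _))//.
  by apply: ler_pM => //; rewrite ?mulr_ge0// ler_wpM2l.
have h2 : A * (2 * B0 * (eps * `|h|)) = `|h| / 4.
  by rewrite /eps; field; rewrite !gt_eqF.
have h3 : A * (2 * dl * (Cc * `|h|)) <= `|h| / 4.
  have -> : A * (2 * dl * (Cc * `|h|)) = dl * (2 * (A * Cc * `|h|)) by ring.
  apply: (@le_trans _ _ ((8 * A * Cc)^-1 * (2 * (A * Cc * `|h|)))).
    by rewrite ler_wpM2r// !mulr_ge0// ltW.
  by rewrite le_eqVlt; apply/orP; left; apply/eqP; field; rewrite !gt_eqF.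
rewrite hh; have -> : 2 * (A * (B0 * C)) * D = 2 * (A * (B0 * (C * D))) by ring.
have E (X Y Z : R) : A * (X + Y + Z) = A * X + A * Y + A * Z by ring.
move: h1; rewrite E h2; move: h3; generalize (A * (2 * dl * (Cc * `|h|))) (A * (B0 * (C * D))).
by move=> X Y; lra.
Qed.

(** This is where embeddedness enters: the chart image of a small ball is [M] intersected with an
    open [W], so no other part of [M] comes close. A nearby point of [M] has a representative close
    to [F v0], hence lies in [W]. *)
Lemma chart_capture (rho : R) : 0 < rho ->
  exists r eta : R, [/\ 0 < r, 0 < eta & forall v p, `|v - v0| <= r -> M p ->
    riem_dist g p (class_pt (Phi v)) <= eta ->
    exists w, [/\ `|w - v0| <= rho, U w & class_pt (Phi w) = p]].
Proof.
move=> rho0; have [i0 Fi0 [rx [eta [C [rx0 eta0 C0 near_rep]]]]] := riem_dist_near_rep g Fv0.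
pose V := U `&` ball v0 rho.
have oV : open V by apply: openI => //; exact: ball_open.
have [W oW VW] : exists2 W, open W & (fun v => class_pt (Phi v)) @` V = M `&` W.
  by case: lift => _ _ _ _; apply=> // v [].
have [Mv0 Wv0] : (M `&` W) (class_pt (Phi v0)).
  by rewrite -VW; exists v0 => //; split => //; exact: ballxx.
have /RP_openE oO := oW.
have Ov0 : (@vec R d @` (@class_pt R d @^-1` W)) (F v0) by exists (Phi v0).
have [e /andP[e0 _] he] := near_closed_ball (open_nbhs_nbhs (conj oO Ov0)).
have [r2 /andP[r20 r21] [L L0 HL]] := lipschitz_near oU Uv0 sF.
exists (Num.min r2 (Num.min rx (e / 2) / L)), (Num.min eta (e / (2 * C))); split.
- by rewrite lt_min r20 divr_gt0// lt_min rx0 divr_gt0.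
- by rewrite lt_min eta0 divr_gt0// mulr_gt0.
move=> v p; rewrite !le_min => /andP[vr2 vL] Mp /andP[D1 D2].
have {vL} : `|F v - F v0| <= Num.min rx (e / 2).
  by rewrite (le_trans (HL v v0 vr2 _)) ?subrr ?normr0 ?(ltW r20)// mulrC -ler_pdivlMr.
rewrite le_min => /andP[F1 F2].
have [x xp] : exists x : nzvec R d, class_pt x = p by exact: class_pt_surj.
rewrite -xp in D1 D2 Mp *.
have [xi hx] := near_rep x (Phi v) F1 D1.
set a := _ / _ in hx.
have [z Wz zx] : (@vec R d @` (@class_pt R d @^-1` W)) (a *: vec x).
  apply: he; rewrite -[_ *: _](subrK (F v)) -addrA (le_trans (ler_normD _ _))// (splitr e) lerD//.
  rewrite (le_trans hx)//; move: D2; rewrite ler_pdivlMr ?mulr_gt0// => D2.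
  by rewrite ler_pdivlMr// mulrC mulrA mulrC.
have a0 : a != 0.
  by apply/eqP => a0; have := vec_neq0 z; rewrite zx a0 scale0r eqxx.
have zE : class_pt x = class_pt z by apply/class_pt_eq; exists a.
have : (M `&` W) (class_pt x) by split => //; rewrite zE.
rewrite -VW => -[w [Uw wr] wx]; exists w; split => //.
by rewrite distrC ltW//; move: wr; rewrite -ball_normE.
Qed.
End chart.

(** * Rational points *)

Lemma biggcdn_mul (n g : nat) (F : 'I_n -> nat) :
  (\big[gcdn/0]_(i < n) (g * F i) = g * \big[gcdn/0]_(i < n) F i)%N.
Proof. by rewrite (big_morph (muln g) (muln_gcdr g) (muln0 g)). Qed.

Lemma dvdn_biggcdn (n : nat) (F : 'I_n -> nat) i : (\big[gcdn/0]_(j < n) F j %| F i)%N.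
Proof. by rewrite (bigD1 i)//= dvdn_gcdl. Qed.

Lemma primitive_multiple (d : nat) (P : 'rV[int]_d.+1) : P != 0 ->
  exists2 p : 'rV[int]_d.+1, primitive p & exists2 g : int, g != 0 & P = g *: p.
Proof.
move=> P0; pose g := \big[gcdn/0%N]_(i < d.+1) `|P ord0 i|%N.
have g0 : g != 0%N.
  have /rV0Pn[i Pi] := P0; apply: contra_neq Pi => g0.
  have := dvdn_biggcdn (fun i => `|P ord0 i|%N) i; rewrite -/g g0 dvd0n absz_eq0.
  by move=> /eqP.
have gP i : (g%:Z %| P ord0 i)%Z by rewrite /dvdz /=; exact: dvdn_biggcdn.
pose p : 'rV[int]_d.+1 := \row_i (P ord0 i %/ g%:Z)%Z.
have pE : P = g%:Z *: p.
  by apply/rowP => i; rewrite !mxE mulrC divzK.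
exists p; last by exists g%:Z.
rewrite /primitive; apply/eqP; rewrite -(eqn_pmul2l (m := g)) ?lt0n// -biggcdn_mul muln1.
apply/eqP; rewrite -[RHS]/(\big[gcdn/0%N]_(i < d.+1) `|P ord0 i|%N).
by apply: eq_bigr => i _; rewrite [in RHS]pE [in RHS]mxE abszM.
Qed.

Lemma rational_common_denominator (d : nat) (q : 'rV[rat]_d.+1) :
  exists (P : 'rV[int]_d.+1) (D : int), D != 0 /\ map_mx intr P = D%:~R *: q.
Proof.
pose D := \prod_(i < d.+1) denq (q ord0 i).
exists (\row_i (numq (q ord0 i) * \prod_(j < d.+1 | j != i) denq (q ord0 j))).
exists D; split; first by apply/prodf_neq0 => i _; exact: denq_neq0.
apply/rowP => i; rewrite !mxE.
have -> : D = denq (q ord0 i) * \prod_(j < d.+1 | j != i) denq (q ord0 j) by rewrite /D (bigD1 i).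
set E := \prod_(j < d.+1 | j != i) _.
rewrite !intrM -[X in _ = _ * X](divq_num_den (q ord0 i)).
rewrite mulrAC; congr (_ * _).
by rewrite mulrCA divff ?mulr1// intr_eq0 denq_neq0.
Qed.

(** The height is selected by [xget], so a primitive representative is extracted together with the
    equation for its norm. The work is to show that one exists, which excludes the default 0. *)
Lemma rational_primitive (R : realType) (d : nat) (r : RP R d) : rational_points r ->
  exists p : 'rV[int]_d.+1, [/\ primitive p, represents (map_mx intr p) r
    & std_height r = `|map_mx intr p : 'rV[R]_d.+1|].
Proof.
move=> [q [x xq xr]].
suff [p [p1 p2]] : exists p : 'rV[int]_d.+1, primitive p /\ represents (map_mx intr p) r.
  have : [set h : R | exists p : 'rV[int]_d.+1, [/\ primitive p,
      represents (map_mx intr p) r & h = `|map_mx intr p : 'rV[R]_d.+1|]] (std_height r).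
    by apply: (xgetPex 0); exists `|map_mx intr p : 'rV[R]_d.+1|; exists p.
  by [].
have [P [D [D0 PD]]] := rational_common_denominator q.
have PR : map_mx intr P = D%:~R *: vec x.
  have -> : map_mx intr P = map_mx (ratr : rat -> R) (map_mx intr P).
    by apply/rowP => i; rewrite !mxE ratr_int.
  by rewrite PD xq; apply/rowP => i; rewrite !mxE rmorphM /= ratr_int.
have P0 : P != 0.
  apply/eqP => P0; move: PR; rewrite P0 map_mx0 => /esym/eqP.
  by rewrite scaler_eq0 intr_eq0 (negbTE D0) (negbTE (vec_neq0 x)).
have [p pp [g g0 PE]] := primitive_multiple P0; exists p; split => //.
have pR : map_mx intr p = (D%:~R / g%:~R) *: vec x.
  apply: (@scalerI _ _ (g%:~R)); first by rewrite intr_eq0.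
  rewrite scalerA mulrCA divff ?mulr1 ?intr_eq0// -PR PE.
  by apply/rowP => i; rewrite !mxE intrM.
have a0 : D%:~R / g%:~R != 0 :> R by rewrite mulf_neq0 ?invr_eq0 ?intr_eq0.
have nz : map_mx intr p != 0 :> 'rV[R]_d.+1.
  by rewrite pR scaler_eq0 (negbTE a0) (negbTE (vec_neq0 x)).
exists (exist (fun v : 'rV[R]_d.+1 => is_true (v != 0)) _ nz) => //.
rewrite -xr; apply/esym/class_pt_eq; by exists (D%:~R / g%:~R).
Qed.

Lemma primitive_norm_ge1 (R : realType) (d : nat) (p : 'rV[int]_d.+1) :
  primitive p -> 1 <= `|map_mx intr p : 'rV[R]_d.+1|.
Proof.
move=> pp; have [i pi] : exists i, p ord0 i != 0.
  apply/rV0Pn/eqP => p0; move: pp; rewrite /primitive p0 big1 => [//|i _].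
  by rewrite mxE.
rewrite (le_trans _ (rV_coord_le _ i))// mxE -intr_norm -[1]/(1%:~R) ler_int.
by rewrite -gtz0_ge1 normr_gt0.
Qed.

Lemma norm_int_det_ge1 (R : realType) (n : nat) (A : 'M[int]_n) :
  \det (map_mx intr A : 'M[R]_n) != 0 -> 1 <= `|\det (map_mx intr A : 'M[R]_n)|.
Proof.
rewrite det_map_mx intr_eq0 -intr_norm -[X in X <= _]/(1%:~R) ler_int => h.
by rewrite -gtz0_ge1 normr_gt0.
Qed.

(** * Null sets for Hausdorff measures *)

Section null_sets.
Local Open Scope ereal_scope.
Variables (R : realType) (T : Type) (dist : T -> T -> R) (s : R).

(** Vanishing of the Hausdorff measure in terms of covers, a form that passes directly to subsets
    and countable unions. *)
Definition fine_covers (A : set T) := forall delta eps : R, (0 < delta)%R -> (0 < eps)%R ->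
  exists U : nat -> set T, [/\ A `<=` \bigcup_i U i, forall i, diam dist (U i) <= delta%:E
    & \sum_(0 <= i <oo) hausdorff_gauge dist s (U i) <= eps%:E].

Lemma hausdorff_gauge_ge0 (U : set T) : 0 <= hausdorff_gauge dist s U.
Proof. by rewrite /hausdorff_gauge; case: asboolP => // _; exact: poweR_ge0. Qed.

Lemma hausdorff_null_covers (A : set T) : hausdorff_measure dist s A = 0 <-> fine_covers A.
Proof.
split=> [A0 delta eps delta0 eps0|cov].
  have : hausdorff_content dist s delta A < eps%:E.
    apply: (@le_lt_trans _ _ 0); last by rewrite lte_fin.
    by rewrite -A0; apply: ereal_sup_ubound; exists delta.
  move=> /ereal_inf_lt[z [U [U1 U2 ->]] /ltW U3].
  by exists U.
have ge0 delta : 0 <= hausdorff_content dist s delta A.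
  apply: le_ereal_inf_tmp => _ [U [_ _ ->]]; apply: nneseries_ge0 => i _ _.
  exact: hausdorff_gauge_ge0.
apply/eqP; rewrite eq_le; apply/andP; split; last first.
  apply: le_trans (ge0 1%R) _; apply: ereal_sup_ubound; by exists 1%R => //=.
apply: ge_ereal_sup => _ [delta /= delta0 <-].
apply/lee_addgt0Pr => eps eps0; rewrite add0e.
have [U [U1 U2 U3]] := cov _ _ delta0 eps0.
by apply: le_trans U3; apply: ereal_inf_lbound; exists U.
Qed.

Lemma fine_covers_subset (A B : set T) : A `<=` B -> fine_covers B -> fine_covers A.
Proof.
move=> AB cov delta eps delta0 eps0; have [U [U1 U2 U3]] := cov _ _ delta0 eps0.
by exists U; split => //; exact: subset_trans U1.
Qed.

Lemma fine_covers_set0 : fine_covers set0.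
Proof.
move=> delta eps delta0 eps0; exists (fun=> set0); split => //.
- move=> _; apply: ge_ereal_sup => _ [x [y [[]]]].
- rewrite eseries0; first by rewrite lee_fin ltW.
  by move=> i _ _; rewrite /hausdorff_gauge asboolT.
Qed.

Lemma fine_covers_bigcup (A : nat -> set T) :
  (forall n, fine_covers (A n)) -> fine_covers (\bigcup_n A n).
Proof.
move=> cov delta eps delta0 eps0.
have eps_n n : (0 < eps / (2 ^ n.+1)%:R)%R by rewrite divr_gt0// ltr0n expn_gt0.
have [V VP] := @choice _ _ (fun n (U : nat -> set T) =>
  [/\ A n `<=` \bigcup_i U i, forall i, diam dist (U i) <= delta%:E
    & \sum_(0 <= i <oo) hausdorff_gauge dist s (U i) <= (eps / (2 ^ n.+1)%:R)%:E])
  (fun n => cov n _ _ delta0 (eps_n n)).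
have /ppcard_eqP[f] : ([set: nat] #= [set: nat * nat])%card.
  by rewrite card_eq_sym; exact: card_nat2.
exists (fun i => V (f i).1 (f i).2); split.
- move=> x [n _ /(let: And3 h _ _ := VP n in h)[j _ Vx]].
  exists (f^-1%FUN (n, j)) => //=; by rewrite invK ?inE.
- by move=> i; have [_ + _] := VP (f i).1; exact.
rewrite nneseries_esumT; last by move=> n; exact: hausdorff_gauge_ge0.
rewrite -(reindex_esum [set: nat] [set: nat * nat] f
  (fun l => hausdorff_gauge dist s (V l.1 l.2))); last first.
  have := @bijTT _ _ f.
  by rewrite -setTT_bijective.
rewrite (_ : [set: nat * nat] = setT `*`` (fun=> setT)); last by apply/seteqP; split.
rewrite -(@esum_esum _ _ _ _ _ (fun i j => hausdorff_gauge dist s (V i j))); last first.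
  by move=> i j _ _; exact: hausdorff_gauge_ge0.
rewrite -nneseries_esumT; last first.
  by move=> n; apply: esum_ge0 => j _; exact: hausdorff_gauge_ge0.
apply: le_trans (epsilon_trick0 xpredT (ltW eps0)).
apply: lee_nneseries => n _.
  by move=> _; apply: esum_ge0 => j _; exact: hausdorff_gauge_ge0.
rewrite -nneseries_esumT; last by move=> j; exact: hausdorff_gauge_ge0.
by have [_ _] := VP n.
Qed.

Lemma diam_le (U : set T) (D : R) :
  (forall x y, U x -> U y -> (dist x y <= D)%R) -> diam dist U <= D%:E.
Proof. by move=> UD; apply: ge_ereal_sup => _ [x [y [Ux Uy ->]]]; rewrite lee_fin UD. Qed.

Lemma hausdorff_gauge_le (U : set T) (D : R) : (forall x y, (0 <= dist x y)%R) -> (0 <= s)%R ->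
  (forall x y, U x -> U y -> (dist x y <= D)%R) -> hausdorff_gauge dist s U <= (D `^ s)%:E.
Proof.
move=> d0 s0 UD; rewrite /hausdorff_gauge; case: asboolP => [_|/eqP/set0P[x Ux]].
  by rewrite lee_fin powR_ge0.
rewrite -poweR_EFin; have diam0 : 0 <= diam dist U.
  apply: (@le_trans _ _ (dist x x)%:E); first by rewrite lee_fin.
  by apply: ereal_sup_ubound; exists x, x.
by apply: gt0_ler_poweR => //; rewrite ?in_itv /= ?diam0 ?leey ?diam_le// lee_fin (le_trans _ (UD x x Ux Ux)).
Qed.

Lemma fine_covers_finite (A : set T) : (forall x y, (0 <= dist x y)%R) -> (0 <= s)%R ->
  (forall eps : R, (0 < eps)%R -> exists (I : finType) (U : I -> set T) (D : R),
    [/\ A `<=` \bigcup_i U i, forall i x y, U i x -> U i y -> (dist x y <= D)%R, (D <= eps)%R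
      & (#|I|%:R * D `^ s <= eps)%R]) -> fine_covers A.
Proof.
move=> d0 s0 cov delta eps delta0 eps0.
have min0 : (0 < Num.min delta eps)%R by rewrite lt_min delta0.
have [I [U [D [AU UD Dm sm]]]] := cov _ min0.
(* The finite cover is padded with empty sets, whose gauge is 0 by definition, even for [s = 0]. *)
pose V (n : nat) := if insub n : option 'I_#|I| is Some i then U (enum_val i) else set0.
exists V; split.
- move=> x /AU[i _ Uix]; exists (enum_rank i) => //; by rewrite /V valK enum_rankK.
- move=> n; apply: diam_le => x y; rewrite /V; case: insubP => [i _ _|_ []].
  move=> /UD /[apply] h; apply: le_trans h _; apply: le_trans Dm _.
  by rewrite ge_min lexx.
rewrite (nneseries_split 0 #|I|); last by move=> *; exact: hausdorff_gauge_ge0.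
rewrite [X in _ + X]eseries0; last first.
  move=> i /= Ii _; rewrite /hausdorff_gauge /V insubN ?asboolT//.
  by rewrite -leqNgt; rewrite add0n in Ii.
rewrite adde0 add0n; apply: (@le_trans _ _ (\sum_(0 <= i < #|I|) (D `^ s)%:E)).
  apply: lee_sum => i _; apply: hausdorff_gauge_le => // x y.
  by rewrite /V; case: insubP => [j _ _|_ []]; exact: UD.
rewrite big_mkord sumEFin big_const_ord iter_addr addr0 lee_fin -mulr_natl (le_trans sm)//.
by rewrite ge_min lexx orbT.
Qed.

End null_sets.

(** * Covers of submanifolds in dimension above [k] *)

Lemma grid_index (R : realType) (m : nat) (t : R) : 0 <= t <= 1 ->
  exists e : 'I_m.+1, `|t - e%:R / m.+1%:R| <= m.+1%:R^-1.
Proof.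
move=> /andP[t0 t1]; have m0 : 0 < m.+1%:R :> R by rewrite ltr0n.
suff [e he] : exists e : 'I_m.+1, `|t * m.+1%:R - e%:R| <= 1.
  exists e; rewrite (_ : t - _ = (t * m.+1%:R - e%:R) / m.+1%:R).
    by rewrite normrM normfV (gtr0_norm m0) ler_piMl// invr_ge0 ltW.
  by rewrite mulrBl mulfK// lt0r_neq0.
have tm0 : 0 <= t * m.+1%:R by rewrite mulr_ge0// ltW.
have /andP[a b] := trunc_itv tm0; set e := Num.trunc _ in a b.
have [em|em] := ltnP e m.+1.
  exists (Ordinal em) => /=; rewrite ler_norml; move: a b; rewrite -natr1; lra.
exists ord_max; rewrite /= ler_norml.
have : m.+1%:R <= e%:R :> R by rewrite ler_nat.
have : t * m.+1%:R <= m.+1%:R by rewrite ler_piMl// ltW.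
move: a; rewrite -[in m.+1%:R]natr1; lra.
Qed.

(** The product is [B ^+ k] times [D] to the power [s - k]. It is the cost of covering a
    [k]-dimensional cube by [(B / D) ^+ k] sets of diameter [D]. *)
Lemma powR_vanishing (R : realType) (k : nat) (s B eps : R) : 0 < B -> k%:R < s -> 0 < eps ->
  exists2 eta, 0 < eta & forall D, 0 < D -> D <= eta -> (B / D) ^+ k * D `^ s <= eps.
Proof.
move=> B0 ks eps0; have sk : 0 < s - k%:R by rewrite subr_gt0.
have Bk : 0 < B ^+ k by rewrite exprn_gt0.
exists ((eps / B ^+ k) `^ (s - k%:R)^-1); first by rewrite powR_gt0// divr_gt0.
move=> D D0 /(ge0_ler_powR (ltW sk)) h.
have -> : D `^ s = D `^ (s - k%:R) * D ^+ k.
  by rewrite -powR_mulrn ?(ltW D0)// -powRD ?subrK// (gt_eqF D0) implybT.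
rewrite mulrCA -exprMn divfK ?gt_eqF// -ler_pdivlMr//.
apply: le_trans (h _ _) _; rewrite ?nnegrE ?(ltW D0) ?powR_ge0//.
by rewrite -powRrM mulVf ?gt_eqF// powRr1// divr_ge0 ?(ltW eps0) ?(ltW Bk).
Qed.

Lemma fine_covers_lipschitz (R : realType) (T : Type) (dist : T -> T -> R) (k : nat)
    (f : 'rV[R]_k -> T) (v0 : 'rV[R]_k) (r C s : R) :
  (forall x y, 0 <= dist x y) -> 0 < r -> 0 < C -> k%:R < s ->
  (forall v w : 'rV[R]_k, `|v - v0| <= r -> `|w - v0| <= r -> dist (f v) (f w) <= C * `|v - w|) ->
  fine_covers dist s (f @` [set v | `|v - v0| <= r]).
Proof.
move=> d0 r0 C0 ks fC; have s0 : 0 <= s by rewrite (le_trans _ (ltW ks)).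
apply: fine_covers_finite => // eps eps0.
pose B := C * (4 * r); have B0 : 0 < B by rewrite !mulr_gt0.
have [eta eta0 h] := powR_vanishing B0 ks eps0.
have min0 : 0 < Num.min eps eta by rewrite lt_min eps0.
pose m := (Num.trunc (B / Num.min eps eta)).
have Bm : B / m.+1%:R <= Num.min eps eta.
  rewrite ler_pdivrMr// mulrC -ler_pdivrMr//.
  by rewrite (le_trans (ltW (truncnS_gt _)))// .
pose cell (e : k.-tuple 'I_m.+1) : set 'rV[R]_k := [set v | `|v - v0| <= r /\
  forall i, `|v ord0 i - (v0 ord0 i - r + 2 * r * ((tnth e i)%:R / m.+1%:R))| <= 2 * r / m.+1%:R].
have D0 : 0 < B / m.+1%:R by rewrite divr_gt0.
exists {: k.-tuple 'I_m.+1}, (fun e => f @` cell e), (B / m.+1%:R); split.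
- move=> _ [v vr <-].
  have /choice[e eP] : forall i : 'I_k, exists e : 'I_m.+1,
      `|(v ord0 i - v0 ord0 i + r) / (2 * r) - e%:R / m.+1%:R| <= m.+1%:R^-1.
    move=> i; apply: grid_index.
    have := le_trans (rV_coord_le (v - v0) i) vr; rewrite !mxE ler_norml => /andP[a b].
    rewrite divr_ge0 ?ler_pdivrMr ?mul1r ?mulr_ge0 ?(ltW r0)//; lra.
  exists [tuple e i | i < k] => //; exists v => //; split => // i.
  rewrite tnth_mktuple.
  rewrite (_ : _ - _ = (2 * r) * ((v ord0 i - v0 ord0 i + r) / (2 * r) - (e i)%:R / m.+1%:R)).
    by rewrite normrM ger0_norm ?mulr_ge0 ?(ltW r0)// ler_wpM2l// mulr_ge0// ltW.
  by field; rewrite gt_eqF//= lt0r_neq0// ltr0n.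
- move=> e _ _ [v [v1 v2] <-] [w [w1 w2] <-]; apply: le_trans (fC _ _ v1 w1) _.
  rewrite /B -mulrA ler_wpM2l ?(ltW C0)//; apply: rV_norm_le.
    by rewrite divr_ge0// mulr_ge0// ltW.
  move=> i; have := v2 i; have := w2 i; rewrite !mxE !ler_norml.
  rewrite (_ : 4 * r / _ = 2 * r / m.+1%:R + 2 * r / m.+1%:R); last by rewrite -!mulrDl; congr (_ / _); ring.
  move: (2 * r * (_ / _)) (2 * r / _) => a b.
  move=> /andP[? ?] /andP[? ?]; apply/andP; split; lra.
- by apply: le_trans Bm _; rewrite ge_min lexx.
rewrite card_tuple card_ord natrX.
have := h _ D0; rewrite invf_div mulrCA divff ?gt_eqF// mulr1; apply.
by apply: le_trans Bm _; rewrite ge_min lexx orbT.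
Qed.


Lemma rational_approx (R : realType) (n : nat) (x : 'rV[R]_n) (e : R) : 0 < e ->
  exists q : 'rV[rat]_n, `|x - map_mx ratr q| <= e.
Proof.
move=> e0; have /choice[q qP] : forall i : 'I_n, exists q : rat, `|x ord0 i - ratr q| <= e.
  move=> i; have [|q] := @rat_in_itvoo R (x ord0 i - e) (x ord0 i + e); first by lra.
  rewrite in_itv /= => /andP[a b]; exists q; rewrite ler_norml; lra.
exists (\row_i q i); apply: rV_norm_le => [|i]; first exact: ltW.
by rewrite !mxE.
Qed.

(** A Lindelof argument: the images [V c] of balls with rational centre and radius are countably
    many, and each point of [A] lies in one contained in its good neighbourhood [W]. Codes [c]
    without fine covers are replaced by the empty set. *)
Lemma fine_covers_local (R : realType) (d : nat) (dist : RP R d -> RP R d -> R) (s : R)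
    (A : set (RP R d)) :
  (forall p, A p -> exists W, [/\ open W, W p & fine_covers dist s (A `&` W)]) ->
  fine_covers dist s A.
Proof.
move=> loc.
pose V (c : 'rV[rat]_d.+1 * rat) : set (RP R d) :=
  [set p | exists2 x : nzvec R d, class_pt x = p & `|vec x - map_mx ratr c.1| <= ratr c.2].
pose B n := if unpickle n is Some c then
  if `[< fine_covers dist s (A `&` V c) >] then A `&` V c else set0 else set0.
apply: (@fine_covers_subset _ _ _ _ _ (\bigcup_n B n)); last first.
  apply: fine_covers_bigcup => n; rewrite /B; case: unpickle => [c|]; last exact: fine_covers_set0.
  by case: asboolP => // _; exact: fine_covers_set0.
move=> p Ap; have [W [/RP_openE oW Wp covW]] := loc _ Ap.
have [x xp] := class_pt_surj p.
have [|e /= e0 eW] := (@nbhs_ballP _ _ _ _).1 (open_nbhs_nbhs (conj oW _) : nbhs (vec x) _).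
  by exists x => //=; rewrite xp.
have [|rho] := @rat_in_itvoo R 0 (e / 2); first by rewrite divr_gt0.
rewrite in_itv /= => /andP[rho0 rhoe].
have [q qx] := rational_approx (vec x) rho0.
have VW : V (q, rho) `<=` W.
  move=> _ [y <- yq]; have : ball (vec x) e (vec y).
    rewrite -ball_normE /ball_ /= -(subrK (map_mx ratr q) (vec x)) -addrA.
    apply: le_lt_trans (ler_normD _ _) _; rewrite [`|map_mx _ _ - _|]distrC.
    by move: qx yq rhoe => /=; lra.
  by move=> /eW[z /= Wz /val_inj <-].
exists (pickle (q, rho)) => //; rewrite /B pickleK asboolT; last first.
  by apply: fine_covers_subset covW; exact: setIS.
by split => //; exists x.
Qed.

Lemma fine_covers_submanifold (R : realType) (k d : nat) (g : riemannian_metric R d)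
    (M : set (RP R d)) (s : R) : submanifold k M -> k%:R < s -> fine_covers (riem_dist g) s M.
Proof.
move=> sub ks; apply: fine_covers_local => p Mp.
have [U [Phi [v [lift Uv vp]]]] := sub _ Mp.
have [r /andP[r0 r1] [C C0 rC]] := chart_dist_le g lift Uv.
have [oU _ _ _ openU] := lift.
have [W oW WE] := openU (U `&` ball v r) (openI oU (ball_open _ _)) (@subIsetl _ _ _).
exists W; split => //.
  have : (M `&` W) p by rewrite -WE; exists v => //; split => //; exact: ballxx.
  by case.
rewrite -WE; apply: fine_covers_subset (fine_covers_lipschitz _ r0 C0 ks rC); last first.
  by move=> x y; exact: riem_dist_ge0.
move=> _ [w [_ vw] <-]; exists w => //=.
by move: vw; rewrite -ball_normE /ball_ /= distrC => /ltW.
Qed.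

(** * The Cantor set of badly approximable points *)

Lemma le_expn (R : realType) (m : nat) (x : R) : (1 < m)%N -> exists j, x <= m%:R ^+ j.
Proof.
move=> m1; exists (Num.trunc x).+1.
apply: (le_trans (ltW (truncnS_gt x))); rewrite -natrX ler_nat.
exact/ltnW/ltn_expl.
Qed.

(** The level is the least [j] satisfying the first inequality. Its failure at the preceding level
    bounds that side below by a constant times [H] to the power [- e / N]; the conclusion concerns
    two levels further down, whence [m ^ 2]. *)
Lemma scale_selection (R : realType) (rho kap : R) (m N e : nat) :
  0 < rho -> 0 < kap -> (1 < m)%N -> (0 < N)%N ->
  exists2 eps, 0 < eps & forall H : R, 1 <= H -> exists2 j,
    H ^+ e * (rho / m%:R ^+ j) ^+ N <= kap &
    eps * H `^ (- (e%:R / N%:R)) <= rho / m%:R ^+ j.+1.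
Proof.
move=> rho0 kap0 m1 N0; have m0 : 0 < m%:R :> R by rewrite ltr0n ltnW.
have mj0 j : 0 < m%:R ^+ j :> R by rewrite exprn_gt0.
have kN0 : 0 < kap `^ N%:R^-1 by rewrite powR_gt0.
exists (Num.min (rho / m%:R) (kap `^ N%:R^-1 / m%:R ^+ 2)).
  by rewrite lt_min !divr_gt0.
move=> H H1; have H0 : 0 < H by rewrite (lt_le_trans ltr01).
have He : 0 < H ^+ e by rewrite exprn_gt0.
have exj : exists j, H ^+ e * (rho / m%:R ^+ j) ^+ N <= kap.
  have [j jP] := le_expn (H ^+ e * rho ^+ N / kap) m1; exists j.
  rewrite expr_div_n mulrA ler_pdivrMr ?exprn_gt0// [X in _ <= X]mulrC -ler_pdivrMr//.
  by apply: le_trans jP _; apply: ler_eXnr => //; rewrite exprn_ege1// ler1n ltnW.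
case: (ex_minnP exj) => j jP jmin; exists j => //; case: j jP jmin => [|j] _ jmin.
  (* At [j = 0] there is no preceding level, and [H >= 1] suffices. *)
  rewrite expr1 -[X in _ <= X]mulr1 ler_pM ?ge_min ?lexx ?powR_ge0//.
    by rewrite le_min !divr_ge0 ?(ltW rho0) ?(ltW m0) ?(ltW kN0) ?(ltW (mj0 2%N)).
  by rewrite -[X in _ <= X](powRr0 H) ler_powR// oppr_le0 divr_ge0.
have : ~~ (H ^+ e * (rho / m%:R ^+ j) ^+ N <= kap).
  by apply/negP => /jmin; rewrite ltnn.
rewrite -ltNge => /ltW kl.
have N0' : N%:R != 0 :> R by rewrite pnatr_eq0 -lt0n.
have : kap `^ N%:R^-1 <= H `^ (e%:R / N%:R) * (rho / m%:R ^+ j).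
  have -> : H `^ (e%:R / N%:R) * (rho / m%:R ^+ j) = (H ^+ e * (rho / m%:R ^+ j) ^+ N) `^ N%:R^-1.
    rewrite powRM ?exprn_ge0 ?divr_ge0 ?(ltW H0) ?(ltW rho0) ?(ltW (mj0 j))//.
    congr (_ * _); first by rewrite powRrM powR_mulrn// ltW.
    by rewrite -powR_mulrn ?divr_ge0 ?(ltW rho0) ?(ltW (mj0 j))// -powRrM mulfV// powRr1 ?divr_ge0 ?(ltW rho0) ?(ltW (mj0 j)).
  apply: ge0_ler_powR => //; rewrite ?nnegrE ?invr_ge0 ?ler0n ?(ltW kap0)//.
  by rewrite mulr_ge0 ?exprn_ge0 ?divr_ge0 ?(ltW H0) ?(ltW rho0) ?(ltW (mj0 j)).
move=> h; apply: (@le_trans _ _ (kap `^ N%:R^-1 / m%:R ^+ 2 * H `^ (- (e%:R / N%:R)))).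
  by rewrite ler_wpM2r ?powR_ge0// ge_min lexx orbT.
have -> : rho / m%:R ^+ j.+2 = rho / m%:R ^+ j / m%:R ^+ 2.
  by rewrite -mulrA -invfM -exprD addnC.
rewrite powRN mulrAC; apply: ler_wpM2r; first by rewrite invr_ge0 ltW.
by rewrite ler_pdivrMr ?powR_gt0// mulrC.
Qed.

(* The term t pays for sets of diameter 0, where any level may be chosen. *)
Lemma level_selection (R : realType) (rho C s N : R) (m : nat) :
  0 < rho -> 0 < C -> 0 <= s -> (1 < m)%N -> 2 <= N -> m%:R `^ s <= N ->
  exists2 K, 0 < K & forall D t : R, 0 <= D -> C * D <= rho -> 0 < t ->
    exists2 l, C * D <= rho / m%:R ^+ l & N ^- l <= K * D `^ s + t.
Proof.
move=> rho0 C0 s0 m1 N2 mN; have m0 : 0 < m%:R :> R by rewrite ltr0n ltnW.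
have mj0 j : 0 < m%:R ^+ j :> R by rewrite exprn_gt0.
have N0 : 0 < N by rewrite (lt_le_trans _ N2).
have mC0 : 0 < m%:R * C / rho by rewrite divr_gt0// mulr_gt0.
exists ((m%:R * C / rho) `^ s); first by rewrite powR_gt0.
move=> D t; rewrite le_eqVlt => /predU1P[<- _ t0|D0 CD t0].
  have [l lP] := le_expn t^-1 (isT : (1 < 2)%N); exists l.
    by rewrite mulr0 divr_ge0 ?(ltW rho0) ?(ltW (mj0 l)).
  apply: (@le_trans _ _ t); last by rewrite lerDr mulr_ge0 ?powR_ge0.
  rewrite -[X in _ <= X]invrK lef_pV2 ?posrE ?invr_gt0 ?exprn_gt0//.
  by apply: le_trans lP _; rewrite lerXn2r// ?nnegrE// (le_trans _ N2).
have [n nP] := le_expn (rho / (C * D)) m1.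
have ex : exists l, rho < m%:R ^+ l.+1 * (C * D).
  exists n; rewrite -ltr_pdivrMr ?mulr_gt0//; apply: (le_lt_trans nP).
  by rewrite exprS ltr_pMl// ltr1n.
case: (ex_minnP ex) => l lP lmin; exists l.
  case: l lP lmin => [|l] _ lmin; first by rewrite expr0 divr1.
  rewrite ler_pdivlMr// mulrC leNgt; apply/negP => /lmin; by rewrite ltnn.
apply: (@le_trans _ _ ((m%:R ^- l) `^ s)).
  rewrite -(powR_invn l (ltW m0)) -powRrM mulrC powRrM powR_invn ?powR_ge0//.
  by rewrite lef_pV2 ?posrE ?exprn_gt0 ?powR_gt0// lerXn2r// ?nnegrE ?powR_ge0// ltW.
have -> : (m%:R * C / rho) `^ s * D `^ s = (m%:R * C / rho * D) `^ s.
  by rewrite -powRM// ltW.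
apply: (@le_trans _ _ ((m%:R * C / rho * D) `^ s)); last by rewrite lerDl ltW.
apply: ge0_ler_powR => //; rewrite ?nnegrE ?invr_ge0 ?(ltW (mj0 _))//; first by rewrite ltW// mulr_gt0.
rewrite -div1r ler_pdivrMr// (_ : _ * m%:R ^+ l = m%:R ^+ l.+1 * (C * D) / rho).
  by rewrite ler_pdivlMr// mul1r ltW.
by rewrite exprS; ring.
Qed.

Lemma nested_intervals (R : realType) (rho : R) (m : nat) (b : nat -> nat) : 0 < rho -> (0 < m)%N ->
  (forall j, (m * b j <= b j.+1 < m * b j + m)%N) ->
  exists t, forall j, rho / m%:R ^+ j * (b j)%:R <= t <= rho / m%:R ^+ j * (b j).+1%:R.
Proof.
move=> rho0 m0 bP; have m0' : 0 < m%:R :> R by rewrite ltr0n.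
have scale j (n : nat) : rho / m%:R ^+ j * n%:R = rho / m%:R ^+ j.+1 * (m * n)%N%:R.
  by rewrite exprS natrM; field; rewrite expf_neq0 gt_eqF.
have r0 j : 0 < rho / m%:R ^+ j by rewrite divr_gt0// exprn_gt0.
pose x j := rho / m%:R ^+ j * (b j)%:R; pose y j := rho / m%:R ^+ j * (b j).+1%:R.
have xS j : x j <= x j.+1.
  by rewrite /x scale ler_wpM2l ?(ltW (r0 _))// ler_nat; have /andP[] := bP j.
have yS j : y j.+1 <= y j.
  rewrite /y [X in _ <= X]scale ler_wpM2l ?(ltW (r0 _))// ler_nat.
  by have /andP[_] := bP j; rewrite mulnS addnC.
have xmono : nondecreasing_seq x by apply/nondecreasing_seqP.
have ymono : nonincreasing_seq y by apply/nonincreasing_seqP.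
have xy i j : x i <= y j.
  apply: (@le_trans _ _ (x (maxn i j))); first by apply: xmono; exact: leq_maxl.
  apply: (@le_trans _ _ (y (maxn i j))); last by apply: ymono; exact: leq_maxr.
  by rewrite /x /y ler_wpM2l ?(ltW (r0 _))// ler_nat.
have sx : has_sup (range x).
  split; first by exists (x 0%N), 0%N.
  by exists (y 0%N) => _ [i _ <-].
exists (sup (range x)) => j; apply/andP; split.
  by apply: ub_le_sup; [exact: sx.2|exists j].
apply: ge_sup; first exact: sx.1.
by move=> _ [i _ <-]; exact: xy.
Qed.

(** Cells are closed, so that every branch has a limit point; adjacent cells share a face. *)
Definition cell (R : realType) (k : nat) (v0 : 'rV[R]_k) (rho : R) (m j : nat)
    (a : k.-tuple nat) : set 'rV[R]_k :=
  [set v | forall i, rho / m%:R ^+ j * (tnth a i)%:R <= v ord0 i - v0 ord0 i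
    <= rho / m%:R ^+ j * (tnth a i).+1%:R].

Lemma nested_cells (R : realType) (k : nat) (v0 : 'rV[R]_k) (rho : R) (m : nat)
    (a : nat -> k.-tuple nat) : 0 < rho -> (0 < m)%N ->
  (forall j i, (m * tnth (a j) i <= tnth (a j.+1) i < m * tnth (a j) i + m)%N) ->
  exists v, forall j, cell v0 rho m j (a j) v.
Proof.
move=> rho0 m0 aP.
have /choice[t tP] : forall i, exists t, forall j,
    rho / m%:R ^+ j * (tnth (a j) i)%:R <= t <= rho / m%:R ^+ j * (tnth (a j) i).+1%:R.
  by move=> i; apply: nested_intervals.
by exists (v0 + \row_i t i) => j i; rewrite !mxE addrAC subrr add0r.
Qed.

(* The determinant of d+1 such primitive integer vectors is an integer, and
   simplex_det makes it smaller than 1. *)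
Lemma rationals_on_hyperplane (R : realType) (k d : nat) (Phi : 'rV[R]_k -> nzvec R d)
    (U : set 'rV[R]_k) (v0 : 'rV[R]_k) : (0 < k <= d)%N -> open U -> U v0 ->
  smooth_on U (@vec R d \o Phi) ->
  exists2 r, 0 < r <= 1 & exists2 kap : R, 0 < kap & forall (v : 'rV[R]_k) (rho : R),
    `|v - v0| <= r -> 0 < rho -> rho <= r ->
    exists2 l : 'cV[R]_d.+1, l != 0 & forall w : 'rV[R]_k,
      `|w - v| <= rho -> rational_points (class_pt (Phi w)) ->
      std_height (class_pt (Phi w)) ^+ d.+1 * rho ^+ N_kd k d <= kap ->
      vec (Phi w) *m l = 0.
Proof.
move=> kd oU Uv0 sm.
have [r1 /andP[r1_gt0 r1_le1] [C C0 detC]] := simplex_det kd oU Uv0 sm.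
pose c := `|vec (Phi v0)| / 2.
have c0 : 0 < c by rewrite divr_gt0// normr_gt0 vec_neq0.
have [r2 /andP[r2_gt0 r2_le1] r2c] : exists2 r, 0 < r <= 1 &
    forall v : 'rV[R]_k, `|v - v0| <= r -> c <= `|vec (Phi v)|.
  apply: near_closed_ball; have [cF _] := sm [::] _ Uv0.
  move: cF => /cvgrPdist_le/(_ _ c0); apply: filterS => v /= h.
  have := le_trans (lerB_dist (vec (Phi v0)) (vec (Phi v))) h.
  by rewrite /c; lra.
exists (Num.min r1 r2 / 2).
  have m0 : 0 < Num.min r1 r2 by rewrite lt_min r1_gt0.
  have : Num.min r1 r2 <= r1 by rewrite ge_min lexx.
  by rewrite divr_gt0//=; lra.
have C1 : 0 < C + 1 by lra.
(* With this value the determinant below is at most [C / (C + 1)], hence less than 1. *)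
pose kap := c ^+ d.+1 / (C + 1); have kap0 : 0 < kap by rewrite divr_gt0// exprn_gt0.
exists kap => // v rho vr rho0 rhor.
have rr1 : Num.min r1 r2 <= r1 by rewrite ge_min lexx.
pose S : set 'rV[R]_d.+1 := [set q | exists w : 'rV[R]_k, exists p : 'rV[int]_d.+1,
  exists a : R, [/\ `|w - v| <= rho, q = map_mx intr p, q = a *: vec (Phi w)
    & `|q| ^+ d.+1 * rho ^+ N_kd k d <= kap]].
have rr2 : Num.min r1 r2 <= r2 by rewrite ge_min lexx orbT.
have cF (w : 'rV[R]_k) : `|w - v| <= rho -> c <= `|vec (Phi w)|.
  move=> wv; apply: r2c; rewrite -(subrK v w) -addrA.
  by apply: le_trans (ler_normD _ _) _; lra.
have SP A : (forall i, S (row i A)) -> \det A = 0.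
  move=> SA; have [w wP] := choice SA; have [p pP] := choice wP; have [a aP] := choice pP.
  pose G := \matrix_(i, j) (@vec R d \o Phi) (w i) ord0 j.
  have AG : A = diag_mx (\row_i a i) *m G.
    apply/row_matrixP => i; have [_ _ -> _] := aP i.
    by apply/rowP => j; rewrite mul_diag_mx !mxE.
  have AP : A = map_mx intr (\matrix_(i, j) p i ord0 j).
    apply/row_matrixP => i; have [_ -> _ _] := aP i.
    by apply/rowP => j; rewrite !mxE.
  have detG : `|\det G| <= C * rho ^+ N_kd k d.
    by apply: (detC v); [lra|lra|move=> i; have [] := aP i].
  have prod_le : (\prod_i `|row i A|) * rho ^+ N_kd k d <= kap.
    have rhoN : 0 <= rho ^+ N_kd k d by rewrite exprn_ge0 ?(ltW rho0).
    (* The hypothesis bounds the power [d + 1] of a single height, so the product of the [d + 1]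
       heights is compared with [kap] after raising to that power. *)
    rewrite -(@ler_pXn2r _ d.+1) ?nnegrE ?(ltW kap0) ?mulr_ge0 ?prodr_ge0//.
    rewrite exprMn -prodrXl -[X in _ * X ^+ _]/(rho ^+ N_kd k d).
    have -> : (rho ^+ N_kd k d) ^+ d.+1 = \prod_(i < d.+1) rho ^+ N_kd k d.
      by rewrite prodr_const card_ord.
    have -> : kap ^+ d.+1 = \prod_(i < d.+1) kap by rewrite prodr_const card_ord.
    rewrite -big_split /=; apply: ler_prod => i _.
    have [_ _ _ ->] := aP i; by rewrite mulr_ge0// exprn_ge0.
  apply/eqP/negP => /negP det0.
  have := norm_int_det_ge1 (_ : \det (map_mx intr (\matrix_(i, j) p i ord0 j) : 'M[R]_d.+1) != 0).
  rewrite -AP => /(_ det0); apply/negP; rewrite -ltNge.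
  rewrite AG det_mulmx det_diag normrM normr_prod.
  apply: (@le_lt_trans _ _ (\prod_i (`|row i A| / c) * (C * rho ^+ N_kd k d))).
    apply: ler_pM => //; first by apply: prodr_ge0.
    apply: ler_prod => i _; rewrite normr_ge0 mxE/= ler_pdivlMr//.
    have [wi _ -> _] := aP i; by rewrite normrZ ler_wpM2l// cF.
  rewrite big_split /= prodr_const card_ord.
  apply: (@le_lt_trans _ _ (kap * (C * c^-1 ^+ d.+1))).
    rewrite (_ : _ * (C * _) = (\prod_i `|row i A|) * rho ^+ N_kd k d * (C * c^-1 ^+ d.+1)).
      by rewrite ler_wpM2r// mulr_ge0// exprn_ge0// invr_ge0 ltW.
    by ring.
  have -> : kap * (C * c^-1 ^+ d.+1) = C / (C + 1).
    by rewrite /kap exprVn; move: (c ^+ d.+1) (exprn_gt0 d.+1 c0) => x x0; field; rewrite !gt_eqF.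
  by rewrite ltr_pdivrMr// mul1r ltrDl.
have [l l0 lP] := hyperplane_of_det0 SP; exists l => // w wv rw Hw.
have [p [_ [x px xw] Hp]] := rational_primitive rw.
have /class_pt_eq[a a0 aE] := xw.
rewrite aE px -scalemxAl lP ?scaler0//.
exists w, p, a^-1; split => //; last by rewrite -Hp.
by rewrite aE scalerA mulVf// scale1r.
Qed.

Definition child (m k : nat) (a : k.-tuple nat) (e : k.-tuple 'I_m) : k.-tuple nat :=
  [tuple (m * tnth a i + tnth e i)%N | i < k].

Definition parent (m k : nat) (c : k.-tuple nat) : k.-tuple nat :=
  [tuple (tnth c i %/ m)%N | i < k].

Lemma child_inj (m k : nat) (a : k.-tuple nat) : injective (@child m k a).
Proof.
move=> e f /(congr1 (@tnth _ _)) ef; apply: eq_from_tnth => i.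
by apply/val_inj; have := congr1 (fun t => t i) ef; rewrite !tnth_mktuple => /addnI.
Qed.

Lemma parent_child (m k : nat) (a : k.-tuple nat) (e : k.-tuple 'I_m) :
  parent m (child a e) = a.
Proof.
apply: eq_from_tnth => i; rewrite !tnth_mktuple.
by have im := ltn_ord (tnth e i); rewrite mulnC divnMDl ?(leq_trans _ im)// divn_small ?addn0.
Qed.

Lemma parent_bounds (m k : nat) (c : k.-tuple nat) (i : 'I_k) : (0 < m)%N ->
  (m * tnth (parent m c) i <= tnth c i < m * tnth (parent m c) i + m)%N.
Proof.
move=> m0; rewrite tnth_mktuple; apply/andP; split.
  by rewrite mulnC leq_trunc_div.
by rewrite [(m * _)%N]mulnC -mulSnr -ltn_divLR.
Qed.

Lemma N_kd_gt0 (k d : nat) : (0 < k)%N -> (0 < N_kd k d)%N.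
Proof. by move=> k0; rewrite /N_kd -addnA addn_gt0 k0. Qed.

Lemma norm_cell_root (R : realType) (k : nat) (v0 v : 'rV[R]_k) (rho : R) (m : nat) :
  0 <= rho -> cell v0 rho m 0 [tuple 0%N | _ < k] v -> `|v - v0| <= rho.
Proof.
move=> rho0 cv; apply: rV_norm_le => [//|i].
have := cv i; rewrite tnth_mktuple expr0 divr1 mulr0 mulr1 !mxE => /andP[h1 h2].
by rewrite ger0_norm.
Qed.

(** Each node carries the hyperplane containing the low-height rational points near its cube, and
    [good] drops the children close to that hyperplane. A branch thus keeps away from those points
    by one subcube side, at every level. *)
Lemma badly_approximable_branches (R : realType) (k d D : nat) (g : riemannian_metric R d)
    (M : set (RP R d)) (U : set 'rV[R]_k) (Phi : 'rV[R]_k -> nzvec R d) (v0 : 'rV[R]_k) :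
  (0 < k <= d)%N -> coordinate_lift M U Phi -> U v0 -> osculating_space Phi D v0 = fullv ->
  exists m0, forall m, (m0 <= m)%N -> (1 < m)%N -> forall r : R, 0 < r ->
  exists2 rho : R, 0 < rho <= r & exists good : nat -> k.-tuple nat -> seq (k.-tuple nat),
  (forall j a, (forall i, tnth a i < m ^ j)%N -> [/\ uniq (good j a),
    2^-1 * m%:R ^+ k <= (size (good j a))%:R :> R &
    forall c, c \in good j a -> parent m c = a /\ forall i, (tnth c i < m ^ j.+1)%N]) /\
  forall a v, a 0%N = [tuple 0%N | _ < k] -> (forall j, a j.+1 \in good j (a j)) ->
    (forall j, cell v0 rho m j (a j) v) ->
    BA (riem_dist g) M (psi_pow (c_kd R k d)) (class_pt (Phi v)).
Proof.
move=> kd lift Uv0 osc; have [oU sm _ _ openU] := lift.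
have [k0 _] := andP kd.
have [m0 few] := few_cells_near_hyperplane oU Uv0 sm osc.
exists m0 => m mm0 m1 r r0; have m0' : 0 < m%:R :> R by rewrite ltr0n ltnW.
have mj0 j : 0 < m%:R ^+ j :> R by rewrite exprn_gt0.
have [r1 /andP[r1_gt0 _] fewP] := few _ mm0.
have [r2 /andP[r2_gt0 _] [kap kap0 hyp]] := rationals_on_hyperplane kd oU Uv0 sm.
have [r3 /andP[r3_gt0 _] [C C0 distP]] := chart_dist_ge g lift Uv0.
have [r4 [eta [r4_gt0 eta0 capt]]] := chart_capture g lift Uv0 r3_gt0.
have [r5 /andP[r5_gt0 _] ballU] : exists2 r, 0 < r <= 1 & forall v : 'rV[R]_k, `|v - v0| <= r -> U v.
  by apply: near_closed_ball; exact: open_nbhs_nbhs.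
have [rho rho0 [rhor rho1 rho2 rho3 [rho4 rho5]]] : exists2 rho, 0 < rho &
    [/\ rho <= r, 2 * rho <= r1, 2 * rho <= r2, rho <= r3 & rho <= r4 /\ rho <= r5].
  pose mn := Num.min (Num.min (Num.min r r1) (Num.min r2 r3)) (Num.min r4 r5).
  have mn0 : 0 < mn by rewrite !lt_min r0 r1_gt0 r2_gt0 r3_gt0 r4_gt0.
  have [h1 h2 h3 [h4 h5 h6]] : [/\ mn <= r, mn <= r1, mn <= r2 & [/\ mn <= r3, mn <= r4 & mn <= r5]].
    by split; rewrite ?ge_min ?lexx ?orbT//; split; rewrite ?ge_min ?lexx ?orbT.
  by exists (mn / 2); [rewrite divr_gt0|split; try split; lra].
exists rho; first by rewrite rho0.
pose sc j := rho / m%:R ^+ j.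
have sc0 j : 0 < sc j by rewrite divr_gt0.
have scS j : sc j = sc j.+1 * m%:R by rewrite /sc exprS; field; rewrite !gt_eqF.
have sc_le j : sc j <= rho by rewrite ler_pdivrMr// ler_peMr ?(ltW rho0)// exprn_ege1// ler1n ltnW.
have scS_le j : sc j.+1 <= sc j by rewrite (scS j) ler_peMr ?(ltW (sc0 _))// ler1n ltnW.
pose inv j (a : k.-tuple nat) := (forall i, tnth a i < m ^ j)%N.
pose corner j (a : k.-tuple nat) : 'rV[R]_k := v0 + \row_i (sc j * (tnth a i)%:R).
have cornerP j a : inv j a -> `|corner j a - v0| <= rho.
  move=> ia; rewrite addrAC subrr add0r; apply: rV_norm_le => [|i]; first exact: ltW.
  rewrite mxE ger0_norm; last by apply: mulr_ge0 => //; exact: ltW.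
  rewrite mulrAC ler_pdivrMr//; apply: ler_wpM2l; first exact: ltW.
  by rewrite -natrX ler_nat ltnW.
(* The radius is doubled because a limit point lies within [sc j] of the corner and the rational
   points of concern lie within [sc j.+1] of it. *)
pose on_plane j a (l : 'cV[R]_d.+1) := forall w : 'rV[R]_k, `|w - corner j a| <= 2 * sc j ->
  rational_points (class_pt (Phi w)) ->
  std_height (class_pt (Phi w)) ^+ d.+1 * (2 * sc j) ^+ N_kd k d <= kap -> vec (Phi w) *m l = 0.
have /choice[L LP] : forall p : nat * k.-tuple nat, exists l,
    l != 0 /\ (inv p.1 p.2 -> on_plane p.1 p.2 l).
  move=> [j a] /=; have [ia|nia] := pselect (inv j a); last first.
    exists (const_mx 1); split => //; apply/negP => /eqP/colP/(_ ord0).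
    by rewrite !mxE => /eqP; rewrite oner_eq0.
  have [||| l l0 lP] := hyp (corner j a) (2 * sc j).
  - by apply: le_trans (cornerP _ _ ia) _; lra.
  - by rewrite mulr_gt0.
  - by have := sc_le j; lra.
  by exists l; split.
pose bad j a := [set e : k.-tuple 'I_m | `[< exists h : 'rV[R]_k, [/\ `|h| <= 2 * sc j,
  forall i, `|(tnth e i)%:R / m%:R * sc j - h ord0 i| <= 2 / m%:R * sc j
  & (@vec R d \o Phi) (corner j a + h) *m L (j, a) = 0] >]]%SET.
pose good j a := [seq child a e | e <- enum (finset.setC (bad j a))].
have goodP j a : inv j a -> [/\ uniq (good j a), 2^-1 * m%:R ^+ k <= (size (good j a))%:R :> R
    & forall c, c \in good j a -> parent m c = a /\ inv j.+1 c].
  move=> ia; split.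
  - by rewrite map_inj_uniq ?enum_uniq//; exact: child_inj.
  - rewrite size_map -cardE.
    have : #|bad j a|%:R <= 2^-1 * m%:R ^+ k :> R.
      apply: fewP; [|by rewrite sc0; have := sc_le j; lra|by case: (LP (j, a))].
      by apply: le_trans (cornerP _ _ ia) _; lra.
    have : (#|bad j a| + #|finset.setC (bad j a)|)%N%:R = m%:R ^+ k :> R.
      by rewrite cardsC card_tuple card_ord natrX.
    rewrite natrD; lra.
  - move=> _ /mapP[e _ ->]; split; first exact: parent_child.
    move=> i; rewrite tnth_mktuple; have := ltn_ord (tnth e i); have := ia i.
    rewrite expnS => ai ei; apply: (@leq_trans (m * (tnth a i).+1)).
      by rewrite mulnS addnC ltn_add2r.
    by rewrite leq_mul2l ai orbT.
exists good; split => // a v a0 abr av.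
have inva j : inv j (a j).
  elim: j => [|j IH]; first by move=> i; rewrite a0 tnth_mktuple.
  by have [_ _ /(_ _ (abr j))[]] := goodP _ _ IH.
have vcorner j : `|v - corner j (a j)| <= sc j.
  apply: rV_norm_le => [|i]; first exact: ltW.
  have := av j i; rewrite !mxE -/(sc j) -natr1 => /andP[h1 h2].
  rewrite ler_norml; apply/andP; split; have := sc0 j; lra.
have vv0 : `|v - v0| <= rho.
  by apply: (norm_cell_root (m := m)); rewrite -?a0//; exact: ltW.
split.
  have [W _ WE] := openU U oU (@subset_refl _ _).
  have : (M `&` W) (class_pt (Phi v)) by rewrite -WE; exists v => //; apply: ballU; lra.
  by case.
have [|eps1 eps1_gt0 scale] := @scale_selection R (2 * rho) kap m (N_kd k d) d.+1 _ kap0 m1 (N_kd_gt0 d k0).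
  by rewrite mulr_gt0.
(* Were [w] closer than [sc j.+1] to [v], it would be within [2 * sc j.+1] of the corner of the next
   cell in each coordinate and on the hyperplane, so this cell would have been bad. *)
have far w j : rational_points (class_pt (Phi w)) ->
    std_height (class_pt (Phi w)) ^+ d.+1 * (2 * sc j) ^+ N_kd k d <= kap ->
    sc j.+1 <= `|w - v|.
  move=> rw Hw; rewrite leNgt; apply/negP => wv.
  have wc : `|w - corner j (a j)| <= 2 * sc j.
    rewrite -(subrK v w) -addrA; apply: le_trans (ler_normD _ _) _.
    by have := vcorner j; have := scS_le j; lra.
  have lw : vec (Phi w) *m L (j, a j) = 0.
    by have [_ /(_ (inva j))] := LP (j, a j); apply.
  have /mapP[e] := abr j; rewrite mem_enum finset.in_setC => /negP ebad aE; apply: ebad.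
  rewrite finset.in_set; apply/asboolP; exists (w - corner j (a j)); split => //.
    move=> i; have := av j.+1 i; have := le_lt_trans (rV_coord_le (w - v) i) wv.
    rewrite aE tnth_mktuple !mxE -/(sc j.+1) (scS j).
    have -> : 2 / m%:R * (sc j.+1 * m%:R) = 2 * sc j.+1 by field; rewrite gt_eqF.
    have -> : (tnth e i)%:R / m%:R * (sc j.+1 * m%:R) = sc j.+1 * (tnth e i)%:R.
      by field; rewrite gt_eqF.
    rewrite -natr1 natrD natrM !ltr_norml ler_norml => /andP[? ?] /andP[? ?].
    by apply/andP; split; lra.
  by rewrite /= addrC subrK.
(* [eta] covers rational points too far away to be captured by the chart. In the other bound, [C]
   converts chart distance and 2 comes from the doubled radius. *)
exists (Num.min eta (eps1 / 2 / C)).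
  by rewrite lt_min eta0 !divr_gt0.
move=> p rp Mp; set H := std_height p.
have H1 : 1 <= H.
  by have [q [qp _ Hq]] := rational_primitive rp; rewrite /H Hq primitive_norm_ge1.
have [j Hj epsj] := scale _ H1.
rewrite /psi_pow /c_kd; set P := H `^ _ in epsj *.
have P0 : 0 <= P by exact: powR_ge0.
have P1 : P <= 1 by rewrite -(powRr0 H) ler_powR// oppr_le0 divr_ge0.
have [le_eta|lt_eta] := leP (riem_dist g p (class_pt (Phi v))) eta; last first.
  apply: le_trans (ltW lt_eta); rewrite -[X in _ <= X]mulr1; apply: ler_pM => //.
    by rewrite le_min !divr_ge0 ?(ltW eta0) ?(ltW C0) ?(ltW eps1_gt0).
  by rewrite ge_min lexx.
have [|w [wv0 _ wp]] := capt v p _ Mp le_eta; first by lra.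
have dwv : `|w - v| <= C * riem_dist g p (class_pt (Phi v)).
  by rewrite -wp; apply: distP => //; apply: le_trans vv0 rho3.
have swv : sc j.+1 <= `|w - v|.
  apply: far; rewrite wp //; move: Hj; rewrite -/H /sc mulrA; exact.
apply: (@le_trans _ _ (eps1 / 2 / C * P)).
  by apply: ler_wpM2r => //; rewrite ge_min lexx orbT.
rewrite -(@ler_pM2l _ C)//; apply: le_trans dwv; apply: le_trans swv.
rewrite (_ : C * _ = eps1 * P / 2); last by field; rewrite gt_eqF.
by rewrite ler_pdivrMr//; apply: le_trans epsj _; rewrite /sc -mulrA [X in X <= _]mulrC.
Qed.

(** * Covers of small cost and the dimension *)

(** Points at distance at most one side lie in closed cells whose indices differ by at most 2 in
    each coordinate, whence the five offsets. Truncation at 0 only creates repetitions. *)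
Definition neighbours (k : nat) (b : k.-tuple nat) : seq (k.-tuple nat) :=
  [seq [tuple (tnth b i + tnth e i - 2)%N | i < k] | e : k.-tuple 'I_5 <- enum {: k.-tuple 'I_5}].

Lemma size_neighbours (k : nat) (b : k.-tuple nat) : size (neighbours b) = (5 ^ k)%N.
Proof. by rewrite size_map -cardE card_tuple card_ord. Qed.

Lemma neighboursP (k : nat) (b c : k.-tuple nat) :
  (forall i, (tnth b i <= tnth c i + 2)%N /\ (tnth c i <= tnth b i + 2)%N) -> c \in neighbours b.
Proof.
move=> bc; apply/mapP.
exists [tuple (inord (tnth c i + 2 - tnth b i) : 'I_5) | i < k]; first by rewrite mem_enum.
apply: eq_from_tnth => i; have [h1 h2] := bc i.
by rewrite !tnth_mktuple inordK; move: (tnth b i) (tnth c i) h1 h2 => x y h1 h2; lia.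
Qed.

Lemma close_cells (R : realType) (k : nat) (v0 v w : 'rV[R]_k) (rho : R) (m j : nat)
    (b c : k.-tuple nat) : 0 < rho -> (0 < m)%N ->
  cell v0 rho m j b v -> cell v0 rho m j c w -> `|v - w| <= rho / m%:R ^+ j ->
  c \in neighbours b.
Proof.
move=> rho0 m0 vb wc vw; apply: neighboursP => i.
have s0 : 0 < rho / m%:R ^+ j by rewrite divr_gt0// exprn_gt0// ltr0n.
have := le_trans (rV_coord_le (v - w) i) vw; rewrite !mxE ler_norml.
have := vb i; have := wc i; set s := rho / _ in s0 *; move=> /andP[h1 h2] /andP[h3 h4] /andP[h5 h6].
split; rewrite -(ler_nat R) -(ler_pM2l s0) natrD; move: h2 h4; rewrite -!natr1; lra.
Qed.

Lemma large_base (R : realType) (k : nat) (s : R) (m0 : nat) : (0 < k)%N -> s < k%:R ->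
  exists m, [/\ (m0 <= m)%N, (1 < m)%N, 2 <= 2^-1 * m%:R ^+ k :> R & m%:R `^ s <= 2^-1 * m%:R ^+ k].
Proof.
move=> k0 sk; have ks0 : 0 < k%:R - s by rewrite subr_gt0.
pose n := (Num.trunc (2 `^ (k%:R - s)^-1 : R)).+1.
pose m := maxn (maxn m0 4) n.
have m4 : (4 <= m)%N by rewrite /m !leq_max leqnn orbT.
have m1 : 1 <= m%:R :> R by rewrite ler1n (leq_trans _ m4).
have mk : m%:R ^+ k = m%:R `^ s * m%:R `^ (k%:R - s) :> R.
  rewrite -powRD; first by rewrite addrC subrK powR_mulrn.
  by rewrite pnatr_eq0 -lt0n (leq_trans _ m4) ?implybT.
have two : 2 <= m%:R `^ (k%:R - s) :> R.
  have -> : 2 = (2 `^ (k%:R - s)^-1) `^ (k%:R - s) :> R.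
    by rewrite -powRrM mulVf ?gt_eqF// powRr1.
  apply: ge0_ler_powR; rewrite ?nnegrE ?powR_ge0 ?(ltW ks0)//.
  apply: (le_trans (ltW (truncnS_gt _))).
  by rewrite -/n ler_nat /m leq_max leqnn orbT.
exists m; split.
- by rewrite /m !leq_max leqnn.
- by rewrite (leq_trans _ m4).
- rewrite ler_pdivlMl// (@le_trans _ _ m%:R) ?ler_eXnr//.
  by rewrite -natrM ler_nat.
- rewrite ler_pdivlMl// mk mulrC ler_wpM2l// powR_ge0.
Qed.

(** A covering set is replaced by the cells meeting it at a level adapted to its diameter: at most
    [5 ^ k] of them, of cost [N ^- l] each. A branch avoiding all these lists converges to a badly
    approximable point lying in no covering set. *)
Lemma badly_approximable_not_null (R : realType) (k d n : nat) (g : riemannian_metric R d)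
    (M : set (RP R d)) (U : set 'rV[R]_k) (Phi : 'rV[R]_k -> nzvec R d) (v0 : 'rV[R]_k) (s : R) :
  (0 < k <= d)%N -> coordinate_lift M U Phi -> U v0 -> osculating_space Phi n v0 = fullv ->
  0 <= s -> s < k%:R ->
  ~ fine_covers (riem_dist g) s (BA (riem_dist g) M (psi_pow (c_kd R k d))).
Proof.
move=> kd lift Uv0 osc s0 sk covers; have [k0 _] := andP kd.
have [m0 branches] := badly_approximable_branches g kd lift Uv0 osc.
have [m [mm0 m1 N2 mN]] := large_base m0 k0 sk.
have [r /andP[r0 _] [C C0 distP]] := chart_dist_ge g lift Uv0.
have [rho /andP[rho0 rhor] [good [goodP BAP]]] := branches _ mm0 m1 _ r0.
set N := 2^-1 * _ in N2 mN goodP.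
have N0 : 0 < N by rewrite (lt_le_trans _ N2).
have [K K0 level] := level_selection rho0 C0 s0 m1 N2 mN.
pose A : R := 5 ^+ k; have A0 : 0 < A by rewrite exprn_gt0.
(* The total cost is at most [A * K * eps + A * eps = 1 / 2]; the second term sums the allowances
   [t] made for sets of diameter 0. *)
pose eps := (2 * A * (K + 1))^-1.
have K1 : 0 < K + 1 by rewrite addr_gt0.
have eps0 : 0 < eps by rewrite invr_gt0 !mulr_gt0.
have [V [BAV diamV sumV]] := covers _ _ (divr_gt0 rho0 C0) eps0.
have /choice[L LP] : forall i, exists L : nat * seq (k.-tuple nat),
    (((size L.2)%:R / N ^+ L.1)%:E <=
      (A * K)%:E * hausdorff_gauge (riem_dist g) s (V i) + (A * eps / (2 ^ i.+1)%:R)%:E)%E /\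
    forall b v, cell v0 rho m L.1 b v -> `|v - v0| <= rho -> V i (class_pt (Phi v)) -> b \in L.2.
  move=> i; have t0 : 0 < eps / (2 ^ i.+1)%:R by rewrite divr_gt0// ltr0n expn_gt0.
  have [Vi|/set0P[x Vx]] := eqVneq (V i) set0.
    exists (0%N, [::]); split; last by move=> b v _ _; rewrite Vi.
    rewrite mul0r adde_ge0 ?mule_ge0 ?hausdorff_gauge_ge0 ?lee_fin ?mulr_ge0 ?(ltW A0) ?(ltW K0)//.
    exact: ltW.
  have [D [D0 DE CD]] : exists D, [/\ 0 <= D, diam (riem_dist g) (V i) = D%:E & C * D <= rho].
    have := diamV i; have : (0 <= diam (riem_dist g) (V i))%E.
      apply: (@le_trans _ _ (riem_dist g x x)%:E); first by rewrite lee_fin riem_dist_ge0.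
      by apply: ereal_sup_ubound; exists x, x.
    case: (diam _ _) => [D| |] //; rewrite !lee_fin => D0 Dr.
    by exists D; split => //; rewrite mulrC -ler_pdivlMr.
  have -> : hausdorff_gauge (riem_dist g) s (V i) = (D `^ s)%:E.
    rewrite /hausdorff_gauge asboolF ?DE ?poweR_EFin//.
    by move=> Vi; move: Vx; rewrite Vi.
  have [l Cl Nl] := level D _ D0 CD t0.
  have bound (sz : nat) : (sz <= 5 ^ k)%N ->
      ((sz%:R / N ^+ l)%:E <= (A * K)%:E * (D `^ s)%:E + (A * eps / (2 ^ i.+1)%:R)%:E)%E.
    move=> szk; rewrite -EFinM -EFinD lee_fin.
    apply: (@le_trans _ _ (A * N ^- l)).
      by rewrite ler_wpM2r ?invr_ge0 ?exprn_ge0 ?(ltW N0)// /A -natrX ler_nat.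
    apply: le_trans (ler_wpM2l (ltW A0) Nl) _.
    by rewrite mulrDr !mulrA.
  have [[b0 [v1 [cv1 vv1 Vv1]]]|noV] := pselect (exists b v, [/\ cell v0 rho m l b v,
      `|v - v0| <= rho & V i (class_pt (Phi v))]).
    exists (l, neighbours b0); split; first by apply: bound; rewrite size_neighbours.
    move=> b v cv vv0 Vv; apply: close_cells rho0 (ltnW m1) cv1 cv _.
    apply: le_trans Cl; apply: le_trans (distP _ _ (le_trans vv1 rhor) (le_trans vv0 rhor)) _.
    rewrite ler_pM2l//.
    by rewrite -lee_fin -DE; apply: ereal_sup_ubound; exists (class_pt (Phi v1)), (class_pt (Phi v)).
  exists (l, [::]); split; first exact: bound.
  by move=> b v cv vv0 Vv; case: noV; exists b, v.
pose inv j (a : k.-tuple nat) := (forall i, tnth a i < m ^ j)%N.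
have [|||a [a0 abr aL]] := @tree_branch_avoiding R _ (@parent m k) inv good [tuple 0%N | _ < k] N
    (fun i => (L i).1) (fun i => (L i).2) N0.
- by move=> i; rewrite tnth_mktuple.
- by move=> j a; exact: goodP.
- have gauge0 i : (0 <= hausdorff_gauge (riem_dist g) s (V i))%E by exact: hausdorff_gauge_ge0.
  apply: (@le_lt_trans _ _ (A * K * eps + A * eps)%:E); last first.
    rewrite lte_fin (_ : _ + _ = 2^-1); last by rewrite /eps; field; rewrite !gt_eqF.
    by rewrite invf_lt1// ltr1n.
  apply: (@le_trans _ _ (\sum_(0 <= i <oo) ((A * K)%:E * hausdorff_gauge (riem_dist g) s (V i)
      + (A * eps / (2 ^ i.+1)%:R)%:E))%E).
    apply: lee_nneseries => [i _ _|i _]; last by have [] := LP i.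
    by rewrite lee_fin divr_ge0// exprn_ge0// ltW.
  rewrite nneseriesD; last 2 first.
  - by move=> i _ _; rewrite mule_ge0// lee_fin mulr_ge0// ltW.
  - by move=> i _ _; rewrite lee_fin divr_ge0// mulr_ge0// ltW.
  rewrite nneseriesZl// EFinD; apply: leeD; last first.
    by apply: epsilon_trick0; rewrite mulr_ge0// ltW.
  by rewrite [leRHS]EFinM; apply: lee_wpmul2l => //; rewrite lee_fin mulr_ge0// ltW.
have inva j : inv j (a j).
  elim: j => [|j IH]; first by move=> i; rewrite a0 tnth_mktuple.
  by have [_ _ /(_ _ (abr j))[]] := goodP _ _ IH.
have [|v vP] := @nested_cells R k v0 rho m a rho0 (ltnW m1).
  move=> j i; have [_ _ /(_ _ (abr j))[<- _]] := goodP _ _ (inva j).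
  exact: parent_bounds (ltnW m1).
have [i _ Vi] := BAV _ (BAP a v a0 abr vP).
have [_ /(_ _ _ (vP _) _ Vi)] := LP i.
have vv0 : `|v - v0| <= rho.
  by apply: (norm_cell_root (m := m)); rewrite -?a0//; exact: ltW.
by move=> /(_ vv0) aLi; have := aL i; rewrite aLi.
Qed.

Theorem theorem4p3 (R : realType) (k d : nat) (g : riemannian_metric R d)
    (M : set (RP R d)) :
  (1 <= k <= d)%N ->
  submanifold k M ->
  nondegenerate_submanifold k M ->
  hausdorff_dim (riem_dist g) (BA (riem_dist g) M (psi_pow (c_kd R k d)))
    = (k%:R)%:E.
Proof.
move=> kd sub [x0 Mx0 [D [U [Phi [v0 [lift Uv0 _ osc]]]]]].
apply/eqP; rewrite eq_le; apply/andP; split.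
  (* For every exponent [k + e] the whole of [M] is already a null set. *)
  apply/lee_addgt0Pr => e e0; apply: ereal_inf_lbound.
  exists (k%:R + e) => //; split; first by rewrite addr_ge0// ltW.
  apply/hausdorff_null_covers.
  apply: fine_covers_subset (fine_covers_submanifold g sub _); last by rewrite ltrDl.
  by move=> p [].
apply: le_ereal_inf_tmp => _ [s [s0 /hausdorff_null_covers null] <-].
rewrite lee_fin leNgt; apply/negP => sk.
exact: badly_approximable_not_null kd lift Uv0 osc s0 sk null.
Qed.
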